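(* Let $G\subset\mathbb{R}^n$ be a compact convex set with non-empty interior and $C^2$ boundary, and let $\mathcal{K}(G)$ denote the set of all compact convex subsets of $G$. For $K,L \in \mathcal{K}(G)$ define $$d_G(K,L) := \sum_{j=0}^{n}\Big( 2\,\mathrm{MV}_j(G, K\,\widetilde{\cup}\, L) - \mathrm{MV}_j(G,K) - \mathrm{MV}_j(G,L)\Big).$$ Then there exists $C>1$, depending only on $G$, such that $$\frac{1}{C}\, d_{\mathcal{H}}(K,L)^{\frac{n+1}{2}} \le d_G(K,L) \le C\, d_{\mathcal{H}}(K,L) \qquad \text{for all } K,L\in\mathcal{K}(G).$$
   Context: $K\,\widetilde{\cup}\,L$ denotes the closed convex hull of $K\cup L$. $d_{\mathcal H}$ is the Hausdorff distance: $d_{\mathcal H}(K,L)=\inf\{\delta>0: K\subset L+\delta B,\ L\subset K+\delta B\}$, where $B$ is the closed unit ball centered at the origin. The mixed volume $\mathrm{MV}(K_1,\dots,K_n)$ of compact convex sets $K_1,\dots,K_n\subset\mathbb{R}^n$ is the unique symmetric function such that $\mathrm{Vol}(t_1K_1+\cdots+t_nK_n)=\sum_{i_1,\dots,i_n=1}^n t_{i_1}\cdots t_{i_n}\mathrm{MV}(K_{i_1},\dots,K_{i_n})$ for all $t_1,\dots,t_n\ge 0$. $\mathrm{MV}_j(G,K):=\mathrm{MV}(G,\dots,G,K,\dots,K)$ with $G$ appearing $n-j$ times and $K$ appearing $j$ times. *)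

(* Defs.v *)
From HB Require Import structures.
From mathcomp Require Import all_boot all_order all_algebra all_fingroup.
From mathcomp Require Import all_classical all_reals all_analysis.
From Stdlib Require Import ClassicalEpsilon.

Set Implicit Arguments.
Unset Strict Implicit.
Unset Printing Implicit Defensive.

Import Order.TTheory GRing.Theory Num.Theory.
Import numFieldNormedType.Exports.
Local Open Scope classical_set_scope.
Local Open Scope ring_scope.

Section Defs.
Variables (R : realType) (n : nat).
Local Notation V := 'rV[R]_n.

Definition enorm (x : V) : R := Num.sqrt (\sum_(i < n) x ord0 i ^+ 2).

Definition convexR (A : set V) : Prop :=
  forall x y t, A x -> A y -> 0 <= t <= 1 -> A (t *: x + (1 - t) *: y).

Definition ccset (A : set V) : Prop := A !=set0 /\ compact A /\ convexR A.

Definition conv_hull (A : set V) : set V :=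
  \bigcap_(C in [set C : set V | convexR C /\ A `<=` C]) C.

Definition cchull (K L : set V) : set V := closure (conv_hull (K `|` L)).

Definition enlarge (A : set V) (d : R) : set V :=
  [set x | exists2 y, A y & enorm (x - y) <= d].

Definition hausdorff (K L : set V) : R :=
  inf [set d : R | 0 < d /\ K `<=` enlarge L d /\ L `<=` enlarge K d].

Definition box (a b : V) : set V := [set x | forall i, a ord0 i <= x ord0 i <= b ord0 i].
Definition box_vol (a b : V) : R := \prod_(i < n) Num.max (b ord0 i - a ord0 i) 0.
Definition lebesgue_outer (A : set V) : \bar R :=
  ereal_inf [set s : \bar R | exists a b : nat -> V,
                A `<=` \bigcup_k box (a k) (b k) /\
                s = (\sum_(0 <= k <oo) (box_vol (a k) (b k))%:E)%E].
Definition Vol (A : set V) : R := fine (lebesgue_outer A).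

Definition mink_comb (K : 'I_n -> set V) (t : 'I_n -> R) : set V :=
  [set x | exists y : 'I_n -> V, (forall i, K i (y i)) /\ x = \sum_(i < n) t i *: y i].

Definition is_mixed_volume (MV : ('I_n -> set V) -> R) : Prop :=
  (forall (K : 'I_n -> set V) (s : {perm 'I_n}),
      (forall i, ccset (K i)) -> MV (K \o s) = MV K) /\
  (forall (K : 'I_n -> set V) (t : 'I_n -> R),
      (forall i, ccset (K i)) -> (forall i, 0 <= t i) ->
      Vol (mink_comb K t) =
      \sum_(f : {ffun 'I_n -> 'I_n}) (\prod_(k < n) t (f k)) * MV (fun k => K (f k))).

Definition MV : ('I_n -> set V) -> R :=
  epsilon (inhabits (fun _ => 0)) is_mixed_volume.

Definition MVj (j : nat) (G K : set V) : R :=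
  MV (fun i : 'I_n => if (i < n - j)%N then G else K).

Definition dG (G K L : set V) : R :=
  \sum_(j < n.+1) (2 * MVj j G (cchull K L) - MVj j G K - MVj j G L).

Definition evec (i : 'I_n) : V := delta_mx ord0 i.
Definition partial (i : 'I_n) (f : V -> R) : V -> R := fun x => 'D_(evec i) f x.
Definition C2 (f : V -> R) : Prop :=
  continuous f /\
  (forall i x, derivable f x (evec i)) /\ (forall i, continuous (partial i f)) /\
  (forall i j x, derivable (partial i f) x (evec j)) /\
  (forall i j, continuous (partial j (partial i f))).

Definition C2_boundary (G : set V) : Prop :=
  forall x, closure G x -> ~ (G°) x ->
  exists U : set V, open U /\ U x /\
  exists rho : V -> R, C2 rho /\ (exists i, partial i rho x != 0) /\
     forall y, U y -> (G y <-> rho y <= 0).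

End Defs.

(* Main.v *)
Require Import Defs.
From HB Require Import structures.
From mathcomp Require Import all_boot all_order all_algebra all_fingroup.
From mathcomp Require Import finmap.
From mathcomp Require Import all_classical all_reals all_analysis.
From mathcomp Require Import zify ring lra.
From mathcomp Require polyrcf.
Set Implicit Arguments.
Unset Strict Implicit.
Unset Printing Implicit Defensive.
Import Order.TTheory GRing.Theory Num.Theory.
Import numFieldNormedType.Exports.
Local Open Scope classical_set_scope.
Local Open Scope ring_scope.

(* With M the closed convex hull of K and L, and q_A(s) = Vol((1-s)G + sA)
   the Bernstein polynomial with coefficients MV_j(G,A), one has
   sum_j MV_j(G,A) = (n+1) int_0^1 q_A(s) ds, so
   d_G(K,L) = (n+1) int_0^1 (2 q_M - q_K - q_L)(s) ds with a nonnegative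
   integrand, and no monotonicity of individual mixed volumes is needed.
   Lower bound: if p in K is at distance e from L, with separating direction u,
   then (1-s)G + sL misses the top slice of thickness s e, in direction u, of
   (1-s)G + sM; by the C^2 boundary a ball of fixed radius rolls inside G, so
   that slice contains a ball cap of height proportional to e, whose volume is
   at least a constant times e^((n+1)/2).
   Upper bound: since G contains a ball, G + tM lies in a translate of
   (1 + O(d))(G + tK) when M lies in K + 2dB, so Vol(G+tM) - Vol(G+tK) = O(d)
   for t in [0,1], which bounds the coefficients of this polynomial in t.
   Mixed volumes exist because Vol(sum_j t_j K_j) is approximated by the number
   of lattice points, up to a rounding error by the size of sums of t_j copies
   of finite sets A_j of lattice points, which is eventually a polynomial in t
   by Khovanskii's theorem. *)

(** * Polynomial growth of sumsets *)

Section PolynomialFunctions.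
Variables (R : numFieldType) (J : finType).
Implicit Types p q : (J -> R) -> R.

(** The [epsilon] behind [MV] carries no information until some mixed volume is exhibited, and [Vol]
    is an outer measure by boxes, a priori only subadditive. Lattice counts settle both
    difficulties: they add over disjoint sets, they bound the volume of a bounded set from above
    once it is thickened by the mesh, and on compact sets they exceed it by arbitrarily little. The
    mixed volume is exhibited by the polarization formula, an alternating sum of volumes of integer
    Minkowski sums. That formula is exact on homogeneous forms, so forms that approximate the volume
    at finitely many integer points already yield the exact expansion, without a limit of their
    coefficients. The exponent (n+1)/2 is that of a ball cap: height h, and width of order sqrt h in
    the n-1 remaining directions. Restricting s to [1/3, 2/3] keeps both weights 1-s and s away from
    0, so the cap has height of order e and the ball that it is cut from has a fixed radius.
    Dimension 0 is treated apart, because there every box has volume 1. *)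

Definition polyfun p := exists L : seq (R * seq J),
  forall s, p s = \sum_(cw <- L) cw.1 * \prod_(j <- cw.2) s j.

Lemma polyfun_ext p q : p =1 q -> polyfun p -> polyfun q.
Proof. by move=> e [L hL]; exists L => s; rewrite -e hL. Qed.

Lemma polyfun_const a : polyfun (fun=> a).
Proof. by exists [:: (a, [::])] => s; rewrite big_seq1 big_nil mulr1. Qed.

Lemma polyfun_var j : polyfun (fun s => s j).
Proof. by exists [:: (1, [:: j])] => s; rewrite big_seq1 big_seq1 mul1r. Qed.

Lemma polyfunD p q : polyfun p -> polyfun q -> polyfun (fun s => p s + q s).
Proof. by move=> [L hL] [M hM]; exists (L ++ M) => s; rewrite big_cat hL hM. Qed.

Lemma polyfunM p q : polyfun p -> polyfun q -> polyfun (fun s => p s * q s).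
Proof.
move=> [L hL] [M hM].
exists [seq (x.1 * y.1, x.2 ++ y.2) | x <- L, y <- M] => s.
rewrite big_allpairs_dep hL hM mulr_suml; apply: eq_bigr => x _.
by rewrite mulr_sumr; apply: eq_bigr => y _; rewrite /= big_cat mulrACA.
Qed.

Lemma polyfunB p q : polyfun p -> polyfun q -> polyfun (fun s => p s - q s).
Proof.
move=> hp hq; apply: (@polyfun_ext (fun s => p s + -1 * q s)).
  by move=> s; rewrite mulN1r.
exact/polyfunD/polyfunM/hq/polyfun_const.
Qed.

Lemma polyfun_prod (T : Type) (r : seq T) (F : T -> (J -> R) -> R) :
  (forall i, polyfun (F i)) -> polyfun (fun s => \prod_(i <- r) F i s).
Proof.
move=> hF; elim: r => [|i r IH].
  by apply: polyfun_ext (polyfun_const 1) => s; rewrite big_nil.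
by apply: polyfun_ext (polyfunM (hF i) IH) => s; rewrite big_cons.
Qed.

Lemma polyfun_sum (T : Type) (r : seq T) (F : T -> (J -> R) -> R) :
  (forall i, polyfun (F i)) -> polyfun (fun s => \sum_(i <- r) F i s).
Proof.
move=> hF; elim: r => [|i r IH].
  by apply: polyfun_ext (polyfun_const 0) => s; rewrite big_nil.
by apply: polyfun_ext (polyfunD (hF i) IH) => s; rewrite big_cons.
Qed.

Lemma polyfun_shift p (d : J -> R) :
  polyfun p -> polyfun (fun s => p (fun j => s j + d j)).
Proof.
move=> [L hL]; apply: (@polyfun_ext (fun s => \sum_(cw <- L) cw.1 * \prod_(j <- cw.2) (s j + d j))).
  by move=> s; rewrite hL.
apply: polyfun_sum => cw; apply: polyfunM; first exact: polyfun_const.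
by apply: polyfun_prod => j; apply: polyfunD; [exact: polyfun_var|exact: polyfun_const].
Qed.

(** Agreement is asked only where every coordinate is large. A later ray [m * s j] is therefore
    shifted by [t0], which keeps the coordinates with [s j = 0] admissible. *)
Definition evpoly (h : {ffun J -> nat} -> nat) :=
  exists p, polyfun p /\ exists t0 : nat, forall t : {ffun J -> nat},
    (forall j, (t0 <= t j)%N) -> (h t)%:R = p (fun j => (t j)%:R).

End PolynomialFunctions.

(** * Dickson's lemma and the lexicographic order on exponent vectors *)

Section Dickson.
Variable I : finType.
Implicit Types (x y z w : {ffun I -> nat}) (l : seq I).

Definition fle x y := [forall i, x i <= y i]%N.
Definition fadd x y := [ffun i => x i + y i]%N.
Definition fsub x y := [ffun i => x i - y i]%N.
Let upd x i m : {ffun I -> nat} := [ffun k => if k == i then m else x k].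

Lemma faddC x y : fadd x y = fadd y x.
Proof. by apply/ffunP => i; rewrite !ffunE addnC. Qed.

Lemma fsubK x y : fle x y -> fadd (fsub y x) x = y.
Proof. by move=> /forallP h; apply/ffunP => i; rewrite !ffunE subnK. Qed.

Lemma faddK x y : fsub (fadd x y) y = x.
Proof. by apply/ffunP => i; rewrite !ffunE addnK. Qed.

Lemma fle_subLR x y z : fle (fsub x y) z = fle x (fadd y z).
Proof. by apply: eq_forallb => i; rewrite !ffunE leq_subLR. Qed.

Lemma fle_addl x y : fle x (fadd y x).
Proof. by apply/forallP => i; rewrite ffunE leq_addl. Qed.

(** Induction over the list of compared coordinates. The slices of [U] at height m in coordinate [i]
    increase with m. The finitely many generators of their union all lie in the slice at height
    [ms], so the slices stop growing there, and generators of the slices up to [ms] suffice. *)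
Let dickson_seq l (U : {ffun I -> nat} -> Prop) :
  (forall x y, {in l, forall i, x i <= y i}%N -> U x -> U y) ->
  exists W : seq {ffun I -> nat}, {in W, forall w, U w} /\
    forall x, U x -> exists2 w, w \in W & {in l, forall i, w i <= x i}%N.
Proof.
elim: l U => [|i l IH] U clU.
  have [[x0 Ux0]|nU] := pselect (exists x, U x); last first.
    by exists [::]; split=> // x Ux; case: nU; exists x.
  exists [:: x0]; split=> [w|x _]; first by rewrite inE => /eqP->.
  by exists x0 => //; rewrite inE.
have clm m x y : {in l, forall i, x i <= y i}%N -> U (upd x i m) -> U (upd y i m).
  move=> xy; apply: clU => k; rewrite !ffunE inE.
  by case: eqP => [//|_ /= /xy].
have clm2 m m' x : (m <= m')%N -> U (upd x i m) -> U (upd x i m').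
  move=> mm; apply: clU => k _; rewrite !ffunE.
  by case: eqP.
have updE x : upd x i (x i) = x.
  by apply/ffunP => k; rewrite ffunE; case: eqP => [->|].
have [W' [W'U W'P]] := IH (fun x => exists m, U (upd x i m))
  (fun x y xy '(ex_intro m Um) => ex_intro _ m (clm m x y xy Um)).
have [ms hms] : exists ms, {in W', forall w, U (upd w i ms)}.
  elim: W' W'U {W'P} => [|w W' IHW] hW; first by exists 0%N.
  have [|m1 h1] := IHW; first by move=> v vW; apply: hW; rewrite inE vW orbT.
  have [|m2 h2] := hW w; first by rewrite mem_head.
  exists (maxn m1 m2) => v; rewrite inE => /orP[/eqP->|/h1].
    exact: clm2 (leq_maxr _ _) h2.
  by apply: clm2; exact: leq_maxl.
have /choice[Wm hWm] m := IH (fun x => U (upd x i m)) (clm m).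
exists [seq upd w i m | m <- iota 0 ms.+1, w <- Wm m]; split.
  by move=> w /allpairsPdep [m [v [_ vW ->]]]; have [+ _] := hWm m; apply.
move=> x Ux; have [xim|xim] := leqP (x i) ms.
  have [_ h] := hWm (x i); have [|w wW wx] := h x; first by rewrite updE.
  exists (upd w i (x i)).
    by apply/allpairsPdep; exists (x i), w; split; rewrite ?mem_iota //= add0n ltnS.
  by move=> k; rewrite inE ffunE; case: eqP => [->|_ /= /wx].
have [|v vW vx] := W'P x; first by exists (x i); rewrite updE.
have [_ h] := hWm ms; have [|w wW wx] := h x.
  exact: clm vx (hms _ vW).
exists (upd w i ms).
  by apply/allpairsPdep; exists ms, w; split; rewrite ?mem_iota //= add0n ltnS.
by move=> k; rewrite inE ffunE; case: eqP => [-> _|_ /= /wx //]; apply: ltnW.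
Qed.

Lemma dickson (U : {ffun I -> nat} -> Prop) :
  (forall x y, fle x y -> U x -> U y) ->
  exists W : seq {ffun I -> nat}, forall x, U x <-> has (fle^~ x) W.
Proof.
move=> clU; have [|W [WU WP]] := @dickson_seq (enum I) U.
  by move=> x y xy; apply: clU; apply/forallP => i; apply: xy; rewrite mem_enum.
exists W => x; split=> [/WP[w wW wx]|/hasP[w wW wx]].
  by apply/hasP; exists w => //; apply/forallP => i; apply: wx; rewrite mem_enum.
exact: clU wx (WU _ wW).
Qed.

Fixpoint lexlt l x y := if l is i :: l' then
  (x i < y i)%N || ((x i == y i) && lexlt l' x y) else false.

Lemma lexlt_total l x y : {in l, forall i, x i = y i} \/ lexlt l x y \/ lexlt l y x.
Proof.
elim: l => [|i l IH] /=; first by left.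
have [xy|yx|xy] := ltngtP (x i) (y i); [by right; left|by right; right|].
case: IH => [h|[h|h]]; [left|by right; left|by right; right].
by move=> k; rewrite inE => /orP[/eqP->|/h].
Qed.

Lemma lexlt_add l x y z : lexlt l x y -> lexlt l (fadd x z) (fadd y z).
Proof.
elim: l => [//|i l IH] /=; rewrite !ffunE ltn_add2r eqn_add2r.
by case/orP => [->//|/andP[-> /IH ->]]; rewrite orbT.
Qed.

(** Minimise the first coordinate over [S], then recurse inside the set of minimisers. *)
Lemma lexlt_min l (S : {ffun I -> nat} -> Prop) x0 : S x0 ->
  exists2 x, S x & forall y, S y -> ~~ lexlt l y x.
Proof.
elim: l S x0 => [|i l IH] S x0 Sx0; first by exists x0.
have ex : exists m, `[< exists2 x, S x & x i = m >].
  by exists (x0 i); apply/asboolP; exists x0.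
case: (ex_minnP ex) => m /asboolP[x1 Sx1 x1m] mmin.
have [x [Sx xm] hx] := IH (fun x => S x /\ x i = m) x1 (conj Sx1 x1m).
exists x => // y Sy /=; rewrite negb_or -leqNgt xm negb_and.
rewrite mmin /=; last by apply/asboolP; exists y.
by have [ym|//] := eqVneq (y i) m; rewrite /= hx.
Qed.

End Dickson.

Arguments fle {I}.
Arguments fadd {I}.
Arguments fsub {I}.

(** * Hilbert functions of monomial ideals and Khovanskii's theorem *)

Section Khovanskii.
Variables (I J : finType) (c : I -> J).
Implicit Types (x y z w : {ffun I -> nat}) (t : {ffun J -> nat}).

(** Each generator [i] has a colour [c i], and [deg] is the multidegree by colour: multidegree [t]
    means [t j] generators of colour [j], with repetition. *)
Definition deg x : {ffun J -> nat} := [ffun j => \sum_(i | c i == j) x i]%N.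

Lemma degD x y : deg (fadd x y) = fadd (deg x) (deg y).
Proof.
apply/ffunP => j; rewrite !ffunE -big_split /=.
by apply: eq_bigr => i _; rewrite ffunE.
Qed.

Lemma leq_deg x i : (x i <= deg x (c i))%N.
Proof. by rewrite ffunE (bigD1 i) //= leq_addr. Qed.

Definition ffun_nat m (f : {ffun I -> 'I_m}) : {ffun I -> nat} :=
  [ffun i => f i : nat].

(** No exponent exceeds the total degree, so the fibre can be enumerated through functions with
    bounded values. *)
Definition degfib t : {fset {ffun I -> nat}} :=
  [fset ffun_nat f | f : {ffun I -> 'I_(\sum_j t j).+1} in
    [pred f : {ffun I -> 'I_(\sum_j t j).+1} | deg (ffun_nat f) == t]]%fset.

Lemma mem_degfib t x : (x \in degfib t) = (deg x == t).
Proof.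
apply/imfsetP/idP => [[f /= + ->]//|/eqP dx].
have xt i : (x i < (\sum_j t j).+1)%N.
  rewrite ltnS (leq_trans (leq_deg x i)) // dx.
  by rewrite (bigD1 (c i)) //= leq_addr.
have e : x = ffun_nat [ffun k => Ordinal (xt k)].
  by apply/ffunP => i; rewrite !ffunE.
exists [ffun i => Ordinal (xt i)]; last exact: e. by apply/eqP; rewrite -e dx.
Qed.

Definition nodiv (W : seq {ffun I -> nat}) x := ~~ has (fle^~ x) W.

(** With exponent vectors read as monomials, this is the multigraded Hilbert function of the
    quotient by the monomial ideal that [W] generates. *)
Definition avoid (W : seq {ffun I -> nat}) t :=
  #|` [fset x in degfib t | nodiv W x]%fset |.

(** The monomials outside the ideal of [W] split into those not divisible by [w] and the multiples
    of [w]. A multiple [y + w] avoids [W] exactly when [y] avoids the colon ideal, generated by the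
    truncated differences [fsub v w]. *)
Lemma avoid_cons w W t : fle (deg w) t ->
  (avoid (w :: W) t + avoid [seq fsub v w | v <- W] (fsub t (deg w)))%N = avoid W t.
Proof.
move=> wt; rewrite /avoid.
set A := [fset x in degfib t | nodiv (w :: W) x]%fset.
set B := [fset x in degfib (fsub t (deg w)) | _]%fset.
have injw : injective (fadd^~ w) by move=> x y /(congr1 (@fsub _ ^~ w)); rewrite !faddK.
have <- : #|` [fset fadd y w | y in B]%fset| = #|` B| by rewrite card_imfset.
rewrite -cardfsUI; set E := (A `&` _)%fset.
have -> : E = fset0.
  apply/fsetP => x; rewrite !inE /nodiv /= negb_or; apply/negP => /andP[/andP[_ /andP[wx _]]].
  by move=> /imfsetP[y _ xe]; move: wx; rewrite xe fle_addl.
rewrite cardfs0 addn0; congr #|` _ |.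
apply/fsetP => x; rewrite !inE mem_degfib /nodiv /= negb_or.
apply/orP/andP => [[/and3P[-> _ ->]//|]|[dx nx]].
  move=> /imfsetP[y]; rewrite !inE mem_degfib /nodiv /= => /andP[/eqP dy ny] ->.
  rewrite degD dy fsubK // eqxx; split=> //; apply: contra ny => /hasP[v vW vy].
  apply/hasP; exists (fsub v w); first exact: map_f.
  by rewrite fle_subLR faddC.
have [wx|wx] := boolP (fle w x); last by left; rewrite dx nx.
right; apply/imfsetP; exists (fsub x w); last by rewrite fsubK.
rewrite !inE mem_degfib /=; apply/andP; split.
  by apply/eqP; rewrite -(eqP dx) -{2}(fsubK wx) degD faddK.
apply: contra nx => /hasP[_ /mapP[v vW ->]]; rewrite fle_subLR faddC fsubK // => vx.
by apply/hasP; exists v.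
Qed.

Definition supp_in (l : seq I) x := [forall i, (i \notin l) ==> (x i == 0)%N].

Let suppfib (l : seq I) t := [fset x in degfib t | supp_in l x]%fset.

(** Stars and bars in each colour class; Pascal's rule splits on whether generator [i] occurs. The
    truncated predecessor is right for an empty class too: the binomial is then 1 in degree 0 and 0
    in positive degree. *)
Let card_suppfib l t : uniq l ->
  #|` suppfib l t| = \prod_j 'C((t j + count (fun i => c i == j) l).-1, t j).
Proof.
elim: l t => [|i l IH] t.
  move=> _ /=; under eq_bigr do rewrite addn0.
  have deg0 : deg [ffun=> 0%N] = [ffun=> 0%N].
    by apply/ffunP => j; rewrite !ffunE big1 // => i _; rewrite ffunE.
  have [->|t0] := eqVneq t [ffun=> 0%N].
    rewrite big1 => [|j _]; last by rewrite ffunE.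
    apply/eqP/cardfs1P; exists [ffun=> 0%N]; apply/fsetP => x; rewrite !inE mem_degfib /=.
    apply/andP/eqP => [[_ /forallP h]|->].
      by apply/ffunP => i; rewrite ffunE; apply/eqP/(implyP (h i)).
    by rewrite deg0 eqxx; split=> //; apply/forallP => i; rewrite ffunE.
  have [j tj] : exists j, t j != 0%N.
    apply/existsP; apply: contraNT t0; rewrite negb_exists => /forallP h.
    by apply/eqP/ffunP => j; rewrite ffunE; apply/eqP; rewrite -[_ == _]negbK h.
  rewrite (bigD1 j) //= bin_small ?mul0n; last by rewrite prednK // lt0n.
  apply/eqP; rewrite cardfs_eq0; apply/eqP/fsetP => x; rewrite !inE mem_degfib /=.
  apply/negP => /andP[/eqP dx /forallP h]; case/eqP: t0; rewrite -dx -deg0.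
  by congr deg; apply/ffunP => i; rewrite ffunE; apply/eqP/(implyP (h i)).
move=> /= /andP[il ul].
pose e : {ffun I -> nat} := [ffun k => (k == i : nat)].
have dege : deg e = [ffun j => (j == c i : nat)].
  apply/ffunP => j; rewrite !ffunE; have [->|ij] := eqVneq j (c i).
    rewrite (bigD1 i) //= ffunE eqxx big1 // => k /andP[_ /negbTE ki].
    by rewrite ffunE ki.
  rewrite big1 // => k /eqP kj; rewrite ffunE; case: eqP => // ki.
  by rewrite -kj ki eqxx in ij.
have rec0 (s : {ffun J -> nat}) : s (c i) = 0%N -> #|` suppfib (i :: l) s| = #|` suppfib l s|.
  move=> s0; congr #|` _|; apply/fsetP => x; rewrite !inE mem_degfib /=.
  have [/eqP dx|//] := boolP (deg x == s); apply: eq_forallb => k; rewrite inE.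
  have [-> /=|//] := eqVneq k i; rewrite (negbTE il).
  by have := leq_deg x i; rewrite dx s0 leqn0 => ->.
have recS (s : {ffun J -> nat}) : (0 < s (c i))%N -> #|` suppfib (i :: l) s| =
    (#|` suppfib l s| + #|` suppfib (i :: l) (fsub s (deg e))|)%N.
  move=> s0; have es : fle (deg e) s.
    by apply/forallP => j; rewrite dege ffunE; case: eqP => [->|].
  have inje : injective (fadd^~ e) by move=> x y /(congr1 (@fsub _ ^~ e)); rewrite !faddK.
  have <- : #|` [fset fadd y e | y in suppfib (i :: l) (fsub s (deg e))]%fset| =
      #|` suppfib (i :: l) (fsub s (deg e))| by rewrite card_imfset.
  rewrite -cardfsUI (_ : (_ `&` _)%fset = fset0); last first.
    apply/fsetP => x; rewrite !inE mem_degfib /=; apply/negP => /andP[/andP[_ /forallP/(_ i)]].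
    by rewrite il /= => /eqP xi /imfsetP[y _ xe]; move: xi; rewrite xe !ffunE eqxx addn1.
  rewrite cardfs0 addn0; congr #|` _|; apply/fsetP => x; rewrite !inE mem_degfib /=.
  apply/andP/orP => [[/eqP dx /forallP h]|[/andP[dx /forallP h]|]].
  - have [xi|xi] := eqVneq (x i) 0%N.
      left; rewrite dx eqxx; apply/forallP => k; apply/implyP => kl.
      have [->|ki] := eqVneq k i; first by rewrite xi.
      by apply: (implyP (h k)); rewrite inE negb_or ki.
    have ex : fle e x.
      by apply/forallP => k; rewrite ffunE; case: eqP => [->|//]; rewrite lt0n.
    right; apply/imfsetP; exists (fsub x e); last by rewrite fsubK.
    rewrite !inE mem_degfib /= -dx -{2}(fsubK ex) degD faddK eqxx /=.
    apply/forallP => k; apply/implyP => kl; have := implyP (h k) kl.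
    by rewrite !ffunE => /eqP ->.
  - rewrite dx; split=> //; apply/forallP => k; apply/implyP; rewrite inE negb_or.
    by move=> /andP[_ kl]; exact: (implyP (h k)).
  - move=> /imfsetP[y]; rewrite !inE mem_degfib /= => /andP[/eqP dy /forallP h] ->.
    rewrite degD dy fsubK // eqxx; split=> //; apply/forallP => k; apply/implyP.
    move=> kl; have := implyP (h k) kl; rewrite !ffunE => /eqP ->.
    by move: kl; rewrite inE negb_or => /andP[/negbTE ->].
have [m tm] : exists m, t (c i) = m by exists (t (c i)).
elim: m t tm => [|m IHm] t tm.
  rewrite rec0 // IH //; apply: eq_bigr => j _.
  have [<-|//] := eqVneq (c i) j; by rewrite tm !bin0.
rewrite recS ?tm // IH // IHm; last by rewrite dege !ffunE eqxx tm subn1.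
have D (F : J -> nat) : (\prod_j F j = F (c i) * \prod_(j | j != c i) F j)%N.
  by rewrite (bigD1 (c i)).
rewrite !D /= dege !ffunE eqxx tm subn1 /=.
set r := count _ _; have -> : (m + (1 + r) = (m + r).+1)%N by lia.
rewrite binS mulnDl /=; congr (_ * _ + _ * _)%N.
- by apply: eq_bigr => j jc; rewrite eq_sym (negbTE jc).
- by apply: eq_bigr => j jc; rewrite !ffunE (negbTE jc) subn0.
Qed.

Let card_degfib t : #|` degfib t| = \prod_j 'C((t j + #|[pred i | c i == j]|).-1, t j).
Proof.
have -> : degfib t = suppfib (enum I) t.
  apply/fsetP => x; rewrite !inE mem_degfib; case: eqP => //= _.
  by apply/esym/forallP => i; rewrite mem_enum.
rewrite card_suppfib ?enum_uniq //; apply: eq_bigr => j _.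
by rewrite -sum1_count big_enum_cond /= -sum1_card.
Qed.

Variable (R : numFieldType).

(** For fixed [r] the binomial is (t+1)...(t+r)/r!, a polynomial in t. *)
Let evpoly_bin r : exists q : R -> (J -> R) -> R, forall (t : nat) s,
  ('C(t + r, t))%:R = q t%:R s /\ forall j, polyfun (fun s => q (s j) s).
Proof.
elim: r => [|r [q hq]].
  exists (fun _ _ => 1) => t s; rewrite addn0 binn; split=> // j; exact: polyfun_const.
exists (fun (x : R) s => (x + r.+1%:R) * q x s / r.+1%:R) => t s; split; last first.
  move=> j; apply: polyfunM; last exact: polyfun_const.
  apply: polyfunM; last by have [] := hq t s.
  by apply: polyfunD; [exact: polyfun_var|exact: polyfun_const].
have [<- _] := hq t s.
have : ((t + r).+1 * 'C(t + r, r) = r.+1 * 'C((t + r).+1, r.+1))%N := mul_bin_diag _ _.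
move=> /(congr1 (fun n => n%:R : R)).
have e1 : 'C(t + r, r) = 'C(t + r, t) by rewrite -bin_sub ?leq_addl // addnK.
have e2 : 'C((t + r).+1, r.+1) = 'C((t + r).+1, t).
  by rewrite -bin_sub ?ltnS ?leq_addl // subSS addnK.
rewrite e1 e2 !natrM -natrD addnS => ->; rewrite mulrC mulKf //.
Qed.

(** Induction on the number of generators: [avoid_cons] expresses the count through two shorter
    lists, one of them evaluated at a shifted degree. For the empty list the count is a product of
    binomials. *)
Lemma evpoly_avoid W : (forall j, exists i, c i = j) -> evpoly R (avoid W).
Proof.
move=> csurj; have [k] : exists k, (size W <= k)%N by exists (size W).
elim: k W => [|k IH] [|w W] // ; last first.
  rewrite ltnS => sW; have [p [pp [t1 h1]]] := IH _ sW.
  have [|q [pq [t2 h2]]] := IH [seq fsub v w | v <- W]; first by rewrite size_map.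
  exists (fun s => p s - q (fun j => s j + - (deg w j)%:R)); split.
    exact/polyfunB/polyfun_shift.
  exists (t1 + t2 + \sum_j deg w j)%N => t ht.
  have wt : fle (deg w) t.
    by apply/forallP => j; apply: leq_trans (ht j); rewrite (bigD1 j) //=; lia.
  have h j : (t2 + deg w j <= t j)%N.
    by apply: leq_trans (ht j); rewrite (bigD1 j) //=; lia.
  rewrite -h1; last by move=> j; have := ht j; lia.
  rewrite -(avoid_cons W wt) natrD h2; last by move=> j; rewrite ffunE; have := h j; lia.
  rewrite (_ : (fun j => _) = (fun j => (t j)%:R + - (deg w j)%:R)) ?addrK //.
  by apply: funext => j; rewrite ffunE natrB //; have := h j; lia.
all: move=> _; exists (fun s => \prod_(j <- enum J) (projT1 (cid (evpoly_bin #|[pred i | c i == j]|.-1))) (s j) s).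
all: split; first by apply: polyfun_prod => j; case: cid => q /= hq; have [] := hq 0%N (fun=>0).
all: exists 0%N => t _; rewrite /avoid (_ : [fset x in _ | _]%fset = degfib t).
all: try by apply/fsetP => x; rewrite !inE /= andbT.
all: rewrite card_degfib natr_prod big_enum; apply: eq_bigr => j _.
all: case: cid => q /= hq; have [<- _] := hq (t j) (fun j => (t j)%:R).
(* Every colour class is nonempty, so the predecessor does not truncate and the upper entry of the
   binomial is [t j] plus a constant. *)
all: suff : (0 < #|[pred i | c i == j]|)%N by case: #|_| => // r _; rewrite addnS.
all: by have [i ij] := csurj j; apply/card_gt0P; exists i; rewrite inE ij.
Qed.

(* Khovanskii's theorem, after Nathanson and Ruzsa: each element of the
   sumset is counted by its lexicographically least representation, and the
   other representations form an up-set of the monomials. *)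
Theorem evpoly_sumset (Z : zmodType) (a : I -> Z) :
  (forall j, exists i, c i = j) ->
  evpoly R (fun t => #|` [fset \sum_i a i *+ (x i) | x : {ffun I -> nat} in degfib t]%fset|).
Proof.
move=> csurj; pose sg x := \sum_i a i *+ x i.
have sgD x y : sg (fadd x y) = sg x + sg y.
  by rewrite /sg -big_split; apply: eq_bigr => i _; rewrite ffunE mulrnDr.
have [|W hW] := @dickson I (fun x => exists y, [/\ deg y = deg x, sg y = sg x & lexlt (enum I) y x]).
  move=> x x' xx' [y [dy sy yx]]; exists (fadd y (fsub x' x)).
  rewrite degD sgD dy sy -degD -sgD faddC fsubK //; split=> //.
  by rewrite -{2}(fsubK xx') [fadd (fsub _ _) x]faddC; exact: lexlt_add.
have [p [pp [t0 ht]]] := evpoly_avoid W csurj.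
exists p; split=> //; exists t0 => t tt0; rewrite -ht //; congr _%:R; rewrite /avoid.
pose B := [fset x in degfib t | nodiv W x]%fset.
have <- : #|` [fset sg x | x in B]%fset| = #|` B|.
  apply: card_in_imfset => x y /=.
  rewrite !inE !mem_degfib => /andP[/eqP dx nx] /andP[/eqP dy ny] sxy.
  have [e|[l|l]] := lexlt_total (enum I) x y.
  - by apply/ffunP => i; apply: e; rewrite mem_enum.
  - by case/negP: ny; apply/hW; exists x; rewrite dx dy.
  - by case/negP: nx; apply/hW; exists y; rewrite dx dy.
congr #|` _|; apply/fsetP => z; apply/imfsetP/imfsetP => [[x /=]|[x /=]].
    rewrite mem_degfib => /eqP dx ->.
    have [y [dy sy] ymin] := @lexlt_min _ (enum I) (fun y => deg y = t /\ sg y = sg x) x (conj dx erefl).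
    exists y; last by rewrite sy.
    rewrite !inE mem_degfib dy eqxx /=; apply/negP => /hW[y' [dy' sy' ylt]].
    by have := ymin y'; rewrite ylt dy' sy' => /(_ (conj dy sy)).
  by rewrite !inE => /andP[xt _] ->; exists x.
Qed.

End Khovanskii.

(** * Volume and lattice points *)

Lemma row_ext (T : Type) n (x y : 'rV[T]_n) : (forall i, x ord0 i = y ord0 i) -> x = y.
Proof. by move=> e; apply/rowP => i; exact: e. Qed.

Section Lattice.
Variables (R : realType) (n : nat).
Local Notation V := 'rV[R]_n.
Local Notation Z := 'rV[int]_n.
Implicit Types (X Y : set V) (M : nat).

(** A neighbourhood in the sup norm, fitted to the cubic cells of the lattice, with the bound
    attained at some point of [X]. *)
Definition thick X (e : R) : set V :=
  [set x | exists2 y, X y & forall i, `|x ord0 i - y ord0 i| <= e].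

Definition coord_bound X (b : R) := forall x, X x -> forall i, `|x ord0 i| <= b.

Definition scale_lattice M (z : Z) : V := \row_i ((z ord0 i)%:~R / M%:R).

Definition lattice M X : set Z := [set z | X (scale_lattice M z)].

(** A Riemann sum for the volume: each point of mesh 1/M has the weight of its cell. [fset_set]
    sends an infinite set to the empty one, which is why comparisons of counts carry boundedness
    hypotheses. *)
Definition cnt M X : R := #|` fset_set (lattice M X)|%:R / M%:R ^+ n.

Lemma coord_bound_thick X b e : coord_bound X b -> coord_bound (thick X e) (b + e).
Proof.
move=> Xb x [y Xy xy] i; rewrite -(subrK (y ord0 i) (x ord0 i)) addrC.
by rewrite (le_trans (ler_normD _ _)) // lerD // Xb.
Qed.

Lemma coord_bound_sub X Y b : X `<=` Y -> coord_bound Y b -> coord_bound X b.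
Proof. by move=> XY Yb x /XY /Yb. Qed.

Lemma thick_ge0 X e : 0 <= e -> X `<=` thick X e.
Proof. by move=> e0 x Xx; exists x => // i; rewrite subrr normr0. Qed.

Lemma compact_coord_bound X : compact X -> exists2 b, 0 <= b & coord_bound X b.
Proof.
move=> /compact_bounded [B [_ hB]]; exists (`|B| + 1); first by rewrite addr_ge0.
move=> x Xx i.
have /hB/(_ x Xx) h : B < `|B| + 1 by rewrite (le_lt_trans (ler_norm B)) // ltrDl.
apply: le_trans h; rewrite [leRHS]/Num.norm /= mx_normrE.
by apply/bigmax_geP; right => /=; exists (ord0, i).
Qed.

Definition zbox (lo : Z) (len : 'I_n -> nat) : set Z :=
  [set z | forall i, lo ord0 i <= z ord0 i < lo ord0 i + (len i)%:Z].

Lemma zboxE lo len : exists S : {fset Z},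
  zbox lo len = [set` S] /\ #|` S| = (\prod_i len i)%N.
Proof.
pose Q := (\max_i len i).+1.
pose F i : pred 'I_Q := [pred x : 'I_Q | (x < len i)%N].
pose g (f : {ffun 'I_n -> 'I_Q}) : Z := \row_i (lo ord0 i + (f i : nat)%:Z).
have gi : injective g.
  move=> f f' /rowP e; apply/ffunP => i; apply/val_inj.
  by have := e i; rewrite !mxE => /addrI [].
exists [fset g f | f : {ffun 'I_n -> 'I_Q} in family F]%fset; split; last first.
  rewrite card_imfset //= -cardE card_family foldrE big_map big_enum /=.
  apply: eq_bigr => i _; rewrite -sum1_card big_mkcond /=.
  have lQ : (len i <= Q)%N by rewrite /Q (leq_trans (leq_bigmax i)).
  rewrite (eq_bigr (fun x : 'I_Q => if (x < len i)%N then 1%N else 0%N)); last first.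
    by move=> x _; rewrite unfold_in.
  by rewrite -big_mkcond /= -(big_ord_widen Q (fun=> 1%N)) // sum1_card card_ord.
apply/seteqP; split=> z /=.
  move=> hz; have zlt i : (`|z ord0 i - lo ord0 i|%N < len i)%N by have := hz i; lia.
  have zQ i : (`|z ord0 i - lo ord0 i|%N < Q)%N.
    by rewrite ltnS (leq_trans (ltnW (zlt i))) // leq_bigmax.
  apply/imfsetP; exists [ffun i => Ordinal (zQ i)] => /=.
    by apply/familyP => i; rewrite ffunE inE /= zlt.
  by apply: row_ext => i; rewrite !mxE ffunE /=; have := hz i; lia.
move=> /imfsetP[f /= /familyP hf ->] i; rewrite mxE.
by have := hf i; rewrite inE /=; lia.
Qed.

Lemma finite_zbox lo len : finite_set (zbox lo len).
Proof. by have [S [-> _]] := zboxE lo len; exact: finite_fset. Qed.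

Lemma card_zbox lo len : #|` fset_set (zbox lo len)| = (\prod_i len i)%N.
Proof. by have [S [-> <-]] := zboxE lo len; rewrite set_fsetK. Qed.

Lemma finite_lattice M X b : (0 < M)%N -> coord_bound X b -> finite_set (lattice M X).
Proof.
move=> M0 Xb; pose K := (Num.truncn (b * M%:R)).+1.
apply: sub_finite_set (finite_zbox (\row_i - K%:Z) (fun=> K.*2)).
move=> z /Xb hz i; have := hz i; rewrite !mxE normrM normfV normr_nat.
rewrite ler_pdivrMr ?ltr0n // => h.
have : `|z ord0 i|%:~R < K%:~R :> R.
  by rewrite intr_norm (le_lt_trans h) // /K truncnS_gt.
by rewrite ltr_int; lia.
Qed.

Lemma card_fset_set_le (T : choiceType) (A B : set T) : finite_set B -> A `<=` B ->
  (#|` fset_set A| <= #|` fset_set B|)%N.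
Proof.
move=> fB AB; apply: fsubset_leq_card; rewrite -fset_set_sub //.
exact: sub_finite_set fB.
Qed.

Lemma card_fset_set_bigcup (T : choiceType) (A : set T) (s : seq nat) (F : nat -> set T) :
  (forall k, finite_set (F k)) -> (A `<=` [set x | exists2 k, k \in s & F k x]) ->
  (#|` fset_set A| <= \sum_(k <- s) #|` fset_set (F k)|)%N.
Proof.
move=> fF; elim: s A => [|k s IH] A hA.
  rewrite big_nil (_ : A = set0) ?fset_set0 ?cardfs0 //.
  by apply/seteqP; split=> // x /hA[].
have fin (s' : seq nat) : finite_set [set x | exists2 k, k \in s' & F k x].
  rewrite (_ : [set _ | _] = \bigcup_(k in [set` s']) F k).
    by apply: bigcup_finite => //; exact: finite_seq.
  by apply/seteqP; split=> x [j js Fx]; exists j.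
rewrite big_cons.
apply: leq_trans (card_fset_set_le (B := F k `|` [set x | exists2 k, k \in s & F k x]) _ _) _.
- by rewrite finite_setU.
- move=> x /hA [j]; rewrite inE => /orP[/eqP-> Fx|js Fx]; first by left.
  by right; exists j.
- rewrite fset_setU // (leq_trans (leq_card_fsetU _ _)) // leq_add2l.
  exact: IH.
Qed.

Lemma cnt_le M X Y b : (0 < M)%N -> coord_bound Y b -> X `<=` Y -> cnt M X <= cnt M Y.
Proof.
move=> M0 Yb XY; rewrite ler_pM2r ?invr_gt0 ?exprn_gt0 ?ltr0n // ler_nat.
by apply: card_fset_set_le (finite_lattice M0 Yb) _ => z /XY.
Qed.

(** An interval of length l meets at most M l + 1 points of mesh 1/M, hence the extra 1/M on each
    side. *)
Lemma cnt_box M a b : (0 < M)%N ->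
  finite_set (lattice M (box a b)) /\
  cnt M (box a b) <= \prod_(i < n) (Num.max (b ord0 i - a ord0 i) 0 + M%:R^-1).
Proof.
move=> M0; have M0' : 0 < M%:R :> R by rewrite ltr0n.
pose lo : Z := \row_i Num.ceil (M%:R * a ord0 i).
pose len i := absz (Num.max (Num.floor (M%:R * b ord0 i) - Num.ceil (M%:R * a ord0 i) + 1) 0).
have sub : lattice M (box a b) `<=` zbox lo len.
  move=> z hz i; have := hz i; rewrite !mxE => /andP[h1 h2].
  have h1' : Num.ceil (M%:R * a ord0 i) <= z ord0 i.
    by rewrite ceil_le_int mulrC -ler_pdivlMr.
  have h2' : z ord0 i <= Num.floor (M%:R * b ord0 i).
    by rewrite floor_ge_int mulrC -ler_pdivrMr.
  by rewrite h1' /= /len; lia.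
split; first exact: sub_finite_set sub (finite_zbox _ _).
rewrite ler_pdivrMr ?exprn_gt0 // -[X in _ * M%:R ^+ X]card_ord -prodr_const -big_split /=.
apply: (@le_trans _ _ (\prod_i len i)%N%:R).
  by rewrite ler_nat -(card_zbox lo) card_fset_set_le //; exact: finite_zbox.
rewrite natr_prod; apply: ler_prod => i _; rewrite ler0n /=.
rewrite mulrDl mulVf ?gt_eqF // maxr_pMl ?ler0n // mul0r.
have := floor_le (M%:R * b ord0 i); have := ceil_ge (M%:R * a ord0 i).
rewrite /len => ha hb; set m := _ - _ + 1; have [m0|m0] := lerP m 0.
  by rewrite /= addr_ge0 // le_max lexx orbT.
rewrite natr_absz gtr0_norm // /m intrD intrB lerD2r le_max mulrBl.
by apply/orP; left; rewrite ![_ * M%:R]mulrC; lra.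
Qed.

End Lattice.

Section Volume.
Variables (R : realType) (n : nat).
Hypothesis n_gt0 : (0 < n)%N.
Local Notation V := 'rV[R]_n.
Local Notation Z := 'rV[int]_n.
Implicit Types (X Y : set V) (M : nat).
Local Notation cb := coord_bound.

Lemma box_vol_ge0 (a b : V) : 0 <= box_vol a b.
Proof. by apply: prodr_ge0 => i _; rewrite le_max lexx orbT. Qed.

Lemma outer_ge0 X : (0 <= lebesgue_outer X)%E.
Proof.
apply: le_ereal_inf_tmp => _ [a [b [_ ->]]].
by apply: nneseries_ge0 => k _ _; rewrite lee_fin box_vol_ge0.
Qed.

Lemma outer_sub X Y : X `<=` Y -> (lebesgue_outer X <= lebesgue_outer Y)%E.
Proof.
move=> XY; apply: ereal_inf_le_tmp => _ [a [b [cov ->]]].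
by exists a, b; split=> // x /XY /cov.
Qed.

(* Padding with empty boxes of volume [0] needs [0 < n]: for [n = 0] every box has volume [1]. *)
Lemma outer_le_seq X (s : seq (V * V)) :
  X `<=` [set x | exists2 p, p \in s & box p.1 p.2 x] ->
  (lebesgue_outer X <= (\sum_(p <- s) box_vol p.1 p.2)%:E)%E.
Proof.
move=> cov; pose d : V * V := (const_mx 1, const_mx 0).
have d0 : box_vol d.1 d.2 = 0.
  have mx01 : Num.max (0 - 1) 0 = 0 :> R by rewrite max_r // lerBlDr add0r ler01.
  by rewrite /box_vol (bigD1 (Ordinal n_gt0)) //= !mxE mx01 mul0r.
apply: ge_ereal_inf; eexists.
  exists (fun k => (nth d s k).1), (fun k => (nth d s k).2); split; last by [].
  move=> x /cov [p ps px]; exists (index p s) => //.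
  by rewrite nth_index.
rewrite (nneseries_split 0 (size s)); last by move=> k _; rewrite lee_fin box_vol_ge0.
rewrite eseries0 ?adde0 => [|k + _]; last by rewrite add0n => sk; rewrite nth_default // d0.
rewrite sumEFin lee_fin add0n [leRHS](big_nth d) lexx //.
Qed.

(** Rounding the coordinates of points of [X] down to mesh 1/M gives corners of cubes of side 1/M
    that cover [X], and these corners are within 1/M of [X]. *)
Lemma outer_le_cnt X M b : (0 < M)%N -> cb X b ->
  (lebesgue_outer X <= (cnt M (thick X M%:R^-1))%:E)%E.
Proof.
move=> M0 Xb; have M0' : 0 < M%:R :> R by rewrite ltr0n.
have fS := finite_lattice M0 (coord_bound_thick (e := M%:R^-1) Xb).
set S := fset_set (lattice M (thick X M%:R^-1)).
pose f (z : Z) : V * V := (scale_lattice R M z, scale_lattice R M z + const_mx M%:R^-1).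
have cov : X `<=` [set x | exists2 p, p \in [seq f z | z <- S] & box p.1 p.2 x].
  move=> x Xx; pose z : Z := \row_i Num.floor (M%:R * x ord0 i).
  have h i : (scale_lattice R M z) ord0 i <= x ord0 i <= (scale_lattice R M z) ord0 i + M%:R^-1.
    rewrite !mxE; set u := Num.floor _; have := floor_le (M%:R * x ord0 i).
    have := floorD1_gt (M%:R * x ord0 i); rewrite -/u intrD => /ltW u1 u2.
    rewrite ler_pdivrMr // [x ord0 i * _]mulrC u2 /= -[leLHS](mulKf (lt0r_neq0 M0')).
    by rewrite -[X in _ + X]mulr1 ![M%:R^-1 * _]mulrC -mulrDl ler_pM2r ?invr_gt0.
  exists (f z); last by move=> i; have := h i; rewrite /= !mxE.
  apply: map_f; rewrite in_fset_set // inE /lattice /=; exists x => // i.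
  by have := h i; rewrite ler_norml => /andP[h1 h2]; apply/andP; split; lra.
apply: le_trans (outer_le_seq cov) _; rewrite lee_fin big_map.
rewrite (eq_bigr (fun=> M%:R ^- n)) => [|z _]; last first.
  rewrite /box_vol (eq_bigr (fun=> M%:R^-1)) => [|i _]; last first.
    by rewrite !mxE addrAC subrr add0r max_l // invr_ge0 ltW.
  by rewrite prodr_const card_ord exprVn.
by rewrite big_const_seq count_predT iter_addr_0 -[leLHS]mulr_natl; exact: lexx.
Qed.

(** [fine] reads infinity as 0; finiteness on bounded sets is what transfers inequalities between
    outer measures to [Vol]. *)
Lemma outer_fin X b : cb X b -> lebesgue_outer X \is a fin_num.
Proof.
move=> Xb; rewrite ge0_fin_numE ?outer_ge0 //.
exact: le_lt_trans (outer_le_cnt (ltn0Sn 0) Xb) (ltry _).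
Qed.

Lemma VolE X b : cb X b -> (Vol X)%:E = lebesgue_outer X.
Proof. by move=> /outer_fin h; rewrite /Vol fineK. Qed.

Lemma Vol_ge0 X : 0 <= Vol X.
Proof. by rewrite /Vol fine_ge0 // outer_ge0. Qed.

Lemma Vol_le X Y b : cb Y b -> X `<=` Y -> Vol X <= Vol Y.
Proof.
move=> Yb XY; rewrite -lee_fin (VolE Yb) (VolE (coord_bound_sub XY Yb)).
exact: outer_sub.
Qed.

Lemma Vol_le_cnt X M b : (0 < M)%N -> cb X b -> Vol X <= cnt M (thick X M%:R^-1).
Proof. by move=> M0 Xb; rewrite -lee_fin (VolE Xb); exact: outer_le_cnt Xb. Qed.

Let affine (c : R) (v : V) X := [set c *: x + v | x in X].

Let outer_affine_le (c : R) v X : 0 < c ->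
  (lebesgue_outer (affine c v X) <= (c ^+ n)%:E * lebesgue_outer X)%E.
Proof.
move=> c0; rewrite -lee_pdivrMl ?exprn_gt0 //.
apply: le_ereal_inf_tmp => _ [a [b [cov ->]]].
rewrite lee_pdivrMl ?exprn_gt0 //.
apply: ge_ereal_inf; eexists.
  exists (fun k => c *: a k + v), (fun k => c *: b k + v); split; last by [].
  move=> _ [x /cov [k _ xk] <-]; exists k => // i; have := xk i.
  by rewrite !mxE !lerD2r !ler_pM2l.
rewrite -nneseriesZl; last by move=> k _; rewrite lee_fin box_vol_ge0.
apply: lee_nneseries => [k _ _|k _]; rewrite ?lee_fin ?box_vol_ge0 //.
rewrite /box_vol -[X in c ^+ X]card_ord -prodr_const -big_split /=.
apply: ler_prod => i _; rewrite le_max lexx orbT /= !mxE.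
by rewrite maxr_pMr ?(ltW c0) // mulr0 opprD addrACA subrr addr0 -mulrBr.
Qed.

Lemma Vol_affine (c : R) (v : V) X b : 0 < c -> cb X b ->
  Vol [set c *: x + v | x in X] = c ^+ n * Vol X.
Proof.
move=> c0 Xb; rewrite /Vol.
have cn0 : c ^+ n != 0 by rewrite expf_neq0 // gt_eqF.
have -> : lebesgue_outer [set c *: x + v | x in X] = ((c ^+ n)%:E * lebesgue_outer X)%E.
  apply/eqP; rewrite eq_le outer_affine_le //=.
  rewrite -lee_pdivlMl ?exprn_gt0 //.
  have c1 : 0 < c^-1 by rewrite invr_gt0.
  (* The reverse inequality is the same one for the inverse map. *)
  have := outer_affine_le (- (c^-1 *: v)) (affine c v X) c1.
  rewrite exprVn; apply: le_trans; apply: outer_sub => x Xx.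
  exists (c *: x + v); first by exists x.
  by rewrite scalerDr scalerA mulVf ?gt_eqF // scale1r addrK.
by rewrite fineM // (outer_fin Xb).
Qed.

Let prod_near (I : finType) (c : I -> R) (t : R) : 0 < t ->
  exists2 e : R, 0 < e & \prod_i (c i + e) <= \prod_i c i + t.
Proof.
move=> t0; have cont (s : seq I) : continuous (fun e : R => \prod_(i <- s) (c i + e)).
  elim: s => [|i s IH].
    by under eq_fun do rewrite big_nil; exact: cst_continuous.
  under eq_fun do rewrite big_cons.
  move=> x; apply: cvgM; last exact: IH.
  by apply: cvgD; [exact: cvg_cst|exact: cvg_id].
have /cvgrPdist_le /(_ t t0) := cont (enum I) 0.
move=> /nbhs_ballP [e /= e0 he].
exists (e / 2); first by rewrite divr_gt0.
have /he : ball (0 : R) e (e / 2).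
  by rewrite /ball /= sub0r normrN gtr0_norm ?divr_gt0 // ltr_pdivrMr // ltr_pMr // ltr1n.
rewrite !big_enum /= (eq_bigr c) => [|i _]; last by rewrite addr0.
by rewrite ler_norml; lra.
Qed.

Lemma interior_box (a b x : V) (e : R) : 0 < e -> box a b x ->
  (box (a - const_mx e) (b + const_mx e))° x.
Proof.
move=> e0 xab; apply/nbhs_ballP; exists e => //= y [_ /(_ ord0) xy] i.
have := xy i; have := xab i; rewrite /ball /= !mxE ltr_norml => /andP[h1 h2] /andP[h3 h4].
by apply/andP; split; lra.
Qed.

Lemma cnt_le_Vol X (t : R) : compact X -> 0 < t ->
  exists2 e : R, 0 < e & forall M, (0 < M)%N -> M%:R^-1 <= e ->
    cnt M (thick X e) <= Vol X + t.
Proof.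
move=> cX t0; have [B _ XB] := compact_coord_bound cX.
have t4 : 0 < t / 4 by rewrite divr_gt0.
have [_ [a [b [cov ->]]]] := lb_ereal_inf_adherent t4 (outer_fin XB).
rewrite -/(lebesgue_outer X) -(VolE XB) -EFinD => hsum.
pose m k (i : 'I_n) := Num.max (b k ord0 i - a k ord0 i) 0.
have m0 k i : 0 <= m k i by rewrite le_max lexx orbT.
have /choice[e he] k : exists e : R, 0 < e /\
    \prod_i (m k i + e) <= box_vol (a k) (b k) + t / 4 / (2 ^ k.+1)%:R.
  have [|e e0 h] := @prod_near _ (m k) (t / 4 / (2 ^ k.+1)%:R).
    by rewrite !divr_gt0 // ltr0n expn_gt0.
  by exists e.
have e0 k : 0 < e k by have [] := he k.
pose eb k : V := const_mx (e k / 8).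
move: (cX); rewrite compact_cover => /(_ nat setT (fun k => (box (a k - eb k) (b k + eb k))°)).
case=> [k _|x /cov [k _ xk]|D _ covD]; first exact: open_interior.
  by exists k => //; apply: interior_box xk; rewrite divr_gt0.
have [N hN] : exists N, forall k, k \in D -> (k < N)%N.
  exists (\max_(k <- D) k).+1 => k kD; rewrite ltnS.
  exact: (@leq_bigmax_seq _ _ xpredT (fun k => k)).
pose ee := \big[Num.min/1]_(k < N) (e k / 8).
have ee0 : 0 < ee by apply: lt_bigmin => // i _; rewrite divr_gt0.
have eek k : (k < N)%N -> ee <= e k / 8.
  by move=> kN; apply: (@bigmin_le _ _ _ 1 (Ordinal kN) (fun k : 'I_N => e k / 8)).
(* Budget for box [k]: [e k / 8] at each end makes it open and another [e k / 8] absorbs the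
   thickening by [ee], so the sides grow by [e k / 2]. The mesh adds at most [e k / 8], within the
   allowance [e k] of [he]. *)
pose bk k := box (a k - const_mx (e k / 4)) (b k + const_mx (e k / 4)).
exists ee => // M M0 Me.
have fb k : finite_set (lattice M (bk k)).
  by have [] := @cnt_box R n M (a k - const_mx (e k / 4)) (b k + const_mx (e k / 4)) M0.
have sub : lattice M (thick X ee) `<=` [set z | exists2 k, k \in iota 0 N & lattice M (bk k) z].
  move=> z [y /covD [k /= kD /interior_subset yk] zy].
  exists k; first by rewrite mem_iota /= add0n hN.
  move=> i; have := yk i; have := zy i; have := eek k (hN k kD).
  rewrite !mxE ler_norml => h1 /andP[h2 h3] /andP[h4 h5]; apply/andP; split; lra.
have h1 : cnt M (thick X ee) <= \sum_(k <- iota 0 N) cnt M (bk k).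
  rewrite /cnt -mulr_suml ler_pM2r ?invr_gt0 ?exprn_gt0 ?ltr0n // -natr_sum ler_nat.
  exact: card_fset_set_bigcup.
have h2 k : (k < N)%N -> cnt M (bk k) <= box_vol (a k) (b k) + t / 4 / (2 ^ k.+1)%:R.
  move=> kN; have [_ h] := @cnt_box R n M (a k - const_mx (e k / 4)) (b k + const_mx (e k / 4)) M0.
  have [_ /(le_trans _)] := he k; apply; apply: le_trans h _.
  apply: ler_prod => i _; apply/andP; split.
    by rewrite addr_ge0 ?invr_ge0 ?ler0n // le_max lexx orbT.
  have := eek k kN; have := e0 k; rewrite !mxE => p0 p1.
  have : Num.max (b k ord0 i + e k / 4 - (a k ord0 i - e k / 4)) 0 <= m k i + e k / 2.
    rewrite ge_max; apply/andP; split; last by rewrite addr_ge0 ?m0 ?divr_ge0 // ltW.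
    have : b k ord0 i - a k ord0 i <= m k i by rewrite le_max lexx.
    lra.
  lra.
apply: le_trans h1 _.
apply: (@le_trans _ _ (\sum_(k <- iota 0 N) (box_vol (a k) (b k) + t / 4 / (2 ^ k.+1)%:R))).
  by rewrite !big_seq; apply: ler_sum => k; rewrite mem_iota add0n => /h2.
rewrite big_split /= -lee_fin EFinD.
have s1 : ((\sum_(k <- iota 0 N) box_vol (a k) (b k))%:E <= (Vol X + t / 4)%:E)%E.
  apply: le_trans (ltW hsum); rewrite -sumEFin -[N]subn0.
  by apply: nneseries_lim_ge => k _ _; rewrite lee_fin box_vol_ge0.
have s2 : ((\sum_(k <- iota 0 N) (t / 4 / (2 ^ k.+1)%:R))%:E <= (t / 4)%:E)%E.
  apply: le_trans (epsilon_trick0 xpredT (ltW t4)); rewrite -sumEFin -[N]subn0.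
  apply: nneseries_lim_ge => k _ _; rewrite lee_fin.
  by rewrite !divr_ge0 // ?ler0n // ltW.
by move: s1 s2; rewrite -EFinD !lee_fin; lra.
Qed.

End Volume.

(** * Minkowski sums and sumsets of lattice points *)

Lemma poly_ge0_lead_ge0 (R : realType) (p : {poly R}) (m0 : nat) :
  (forall m, (m0 <= m)%N -> 0 <= p.[m%:R]) -> 0 <= lead_coef p.
Proof.
move=> hp; rewrite leNgt; apply/negP => lp.
have /polyrcf.poly_pinfty_gt_lc [x hx] : 0 < lead_coef (- p) by rewrite lead_coefN oppr_gt0.
pose m := maxn m0 (Num.truncn x).+1.
have xm : x <= m%:R.
  by apply: ltW; apply: lt_le_trans (truncnS_gt x) _; rewrite ler_nat leq_maxr.
have := hx _ xm; rewrite hornerN lead_coefN.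
by have := hp m (leq_maxl _ _); lra.
Qed.

(** The differences p - a X^n and b X^n - p are nonnegative at large integers, so their leading
    coefficients are nonnegative. If p had degree above n, these would be opposite nonzero numbers;
    hence the degree is at most n and the coefficients at n compare. *)
Lemma poly_growth_coef (R : realType) (p : {poly R}) (n m0 : nat) (a b : R) :
  (forall m, (m0 <= m)%N -> a * m%:R ^+ n <= p.[m%:R] <= b * m%:R ^+ n) ->
  a <= p`_n <= b.
Proof.
move=> hp.
pose q (c : R) := p - c *: 'X^n.
have qE c m : (q c).[m%:R] = p.[m%:R] - c * m%:R ^+ n.
  by rewrite /q hornerD hornerN hornerZ hornerXn.
have lq : 0 <= lead_coef (q a).
  by apply: (@poly_ge0_lead_ge0 _ _ m0) => m /hp /andP[h _]; rewrite qE subr_ge0.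
have lq' : lead_coef (q b) <= 0.
  rewrite -oppr_ge0 -lead_coefN.
  by apply: (@poly_ge0_lead_ge0 _ _ m0) => m /hp /andP[_ h]; rewrite hornerN qE oppr_ge0 subr_le0.
have sX c : (size (c *: 'X^n : {poly R}) <= n.+1)%N.
  by rewrite (leq_trans (size_scale_leq _ _)) // size_polyXn.
have sp : (size p <= n.+1)%N.
  rewrite leqNgt; apply/negP => h.
  have lc c : lead_coef (q c) = lead_coef p.
    by rewrite /q lead_coefDl // size_polyN (leq_ltn_trans (sX c)).
  have : lead_coef p == 0 by rewrite eq_le; move: lq lq'; rewrite !lc => -> ->.
  by rewrite lead_coef_eq0 => /eqP p0; rewrite p0 size_poly0 in h.
have qn c : (q c)`_n = p`_n - c by rewrite /q coefB coefZ coefXn eqxx mulr1.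
have sq c : (size (q c) <= n.+1)%N.
  by rewrite (leq_trans (size_polyD _ _)) // geq_max size_polyN sp sX.
have lc c : (q c)`_n = 0 \/ (q c)`_n = lead_coef (q c).
  have := sq c; rewrite leq_eqVlt => /orP[/eqP e|h]; last by left; rewrite nth_default.
  by right; rewrite lead_coefE e.
apply/andP; split.
  by rewrite -subr_ge0 -qn; case: (lc a) => ->.
by rewrite -subr_le0 -qn; case: (lc b) => ->.
Qed.

Section Sumset.
Variables (R : realType) (n : nat) (J : finType).
Local Notation V := 'rV[R]_n.
Local Notation Z := 'rV[int]_n.
Local Notation cb := coord_bound.
Implicit Types (t s : {ffun J -> nat}).

(** [mink_comb] over any finite index type, so that two bodies can be indexed by [bool]; for
    ordinals the two are convertible. *)
Definition msum (K : J -> set V) (t : J -> R) : set V :=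
  [set x | exists y : J -> V, (forall j, K j (y j)) /\ x = \sum_j t j *: y j].

Lemma conv_comb (X : set V) x0 (I : Type) (r : seq I) (P : pred I) (w : I -> R) (y : I -> V) :
  convexR X -> X x0 -> (forall i, P i -> 0 <= w i) -> (forall i, P i -> X (y i)) ->
  exists2 u, X u & \sum_(i <- r | P i) w i *: y i = (\sum_(i <- r | P i) w i) *: u.
Proof.
move=> cX Xx0 w0 Xy; elim: r => [|i r [u Xu IH]].
  by exists x0 => //; rewrite !big_nil scale0r.
have W0 : 0 <= \sum_(j <- r | P j) w j by apply: sumr_ge0.
rewrite !big_cons; case: ifPn => [Pi|_]; last by exists u.
rewrite IH; set W := \sum_(j <- r | P j) w j in W0 *.
have wi := w0 i Pi; have [S0|S0] := eqVneq (w i + W) 0.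
  have [-> ->] : w i = 0 /\ W = 0 by split; lra.
  by exists x0 => //; rewrite !addr0 !scale0r addr0.
have Sp : 0 < w i + W by rewrite lt_neqAle eq_sym S0 addr_ge0.
exists ((w i / (w i + W)) *: y i + (1 - w i / (w i + W)) *: u).
  apply: cX => //; first exact: Xy.
  by rewrite divr_ge0 ?(ltW Sp) //= ler_pdivrMr // mul1r lerDl.
rewrite scalerDr !scalerA mulrC divfK // mulrBr mulr1 [(w i + W) * _]mulrC divfK //.
by rewrite [w i + W - w i]addrAC subrr add0r.
Qed.

(* Rounding the partial sums, rather than the summands, keeps the error of the
   total bounded independently of the number of summands. *)
Lemma round_seq (cls : seq J) (w : J -> V) (W0 : V) : exists s : seq (J * Z),
  [/\ map fst s = cls,
    forall i, (\sum_(p <- s) p.2) ord0 i =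
      Num.floor ((W0 + \sum_(j <- cls) w j) ord0 i) - Num.floor (W0 ord0 i) &
    forall p, p \in s -> forall i, `|(p.2 ord0 i)%:~R - w p.1 ord0 i| <= 1].
Proof.
elim: cls W0 => [|j cls IH] W0.
  by exists [::]; split=> // i; rewrite !big_nil addr0 subrr mxE.
have [s [s1 s2 s3]] := IH (W0 + w j).
pose a : Z := \row_i (Num.floor ((W0 + w j) ord0 i) - Num.floor (W0 ord0 i)).
exists ((j, a) :: s); split; first by rewrite /= s1.
  by move=> i; rewrite !big_cons addrA mxE s2 mxE addrC addrA subrK.
move=> p; rewrite inE => /orP[/eqP-> i /=|/s3 //].
rewrite !mxE intrB.
have := floor_le (W0 ord0 i + w j ord0 i); have := floorD1_gt (W0 ord0 i + w j ord0 i).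
have := floor_le (W0 ord0 i); have := floorD1_gt (W0 ord0 i).
by rewrite !intrD !rmorph1 => *; rewrite ler_norml; apply/andP; split; lra.
Qed.

Section Fixed.
Variables (K : J -> set V) (b : R) (N : nat).
Hypothesis N_gt0 : (0 < N)%N.
Hypothesis Kb : forall j, cb (K j) b.
Hypothesis K0 : forall j, K j 0.
Hypothesis Kc : forall j, convexR (K j).

Let N_gt0' : 0 < N%:R :> R. Proof. by rewrite ltr0n. Qed.

(** The radius 2 adds two unit errors met in [sub_sumset]: the rounding of partial sums, and each
    summand's share of the distance from [z] to the Minkowski sum. The tag in [J] records the body
    that a lattice point serves. *)
Let near_pts : set (J * Z) :=
  [set p : J * Z | exists2 y, K p.1 y & forall i, `|(p.2 ord0 i)%:~R - N%:R * y ord0 i| <= 2].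

Let fin_near_pts : finite_set near_pts.
Proof.
have fin j : finite_set (lattice N (thick (K j) (2 / N%:R))).
  exact: finite_lattice N_gt0 (coord_bound_thick (Kb (j := j))).
have : finite_set ([set: J] `*` \bigcup_(j in [set: J]) lattice N (thick (K j) (2 / N%:R))).
  by apply: finite_setX => //; apply: bigcup_finite.
apply: sub_finite_set => -[j z] [y /= Ky zy]; split=> //; exists j => //.
exists y => // i; rewrite mxE ler_pdivlMr // -{2}[N%:R]gtr0_norm // -normrM.
by rewrite mulrBl divfK ?gt_eqF // [y _ _ * _]mulrC.
Qed.

Let A := fset_set near_pts.

Let mem_A p : (p \in A) <-> near_pts p.
Proof. by rewrite in_fset_set // inE. Qed.

Let c (i : A) : J := (val i).1.
Let a (i : A) : Z := (val i).2.

Definition sumset t : {fset Z} :=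
  [fset \sum_i a i *+ (x i) | x : {ffun A -> nat} in degfib c t]%fset.

Let csurj j : exists i, c i = j.
Proof.
have jA : (j, 0) \in A by apply/mem_A; exists 0 => //= i; rewrite !mxE mulr0 subrr normr0.
by exists [` jA]%fset.
Qed.

Lemma evpoly_card_sumset : evpoly R (fun t => #|` sumset t|).
Proof. exact: evpoly_sumset csurj. Qed.

Let mem_sumset (s : seq (J * Z)) t :
  (forall p, p \in s -> near_pts p) -> (forall j, count (fun p => p.1 == j) s = t j) ->
  \sum_(p <- s) p.2 \in sumset t.
Proof.
move=> sA st; apply/imfsetP.
have sumE (M : zmodType) (f : J * Z -> M) (P : pred (J * Z)) : \sum_(p <- s | P p) f p =
    \sum_(i : A | P (val i)) f (val i) *+ count_mem (val i) s.
  elim: s sA {st} => [|p s IH] sA; first by rewrite big_nil big1.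
  rewrite big_cons (eq_bigr (fun i : A => f (val i) *+ (p == val i) +
    f (val i) *+ count_mem (val i) s)); last by move=> i _; rewrite /= mulrnDr.
  rewrite big_split /= -IH; last by move=> q qs; apply: sA; rewrite inE qs orbT.
  have pA : p \in A by apply/mem_A/sA; rewrite mem_head.
  case: ifPn => Pp.
    congr (_ + _); rewrite (bigD1 [` pA]%fset) //= eqxx mulr1n big1 ?addr0 // => i /andP[_ ip].
    by case: eqP => // pi; case/eqP: ip; apply/val_inj.
  rewrite -[LHS]add0r; congr (_ + _).
  by rewrite big1 // => i Pi; case: eqP => // pi; rewrite -pi (negbTE Pp) in Pi.
exists [ffun i : A => count_mem (val i) s].
  rewrite mem_degfib; apply/eqP/ffunP => j; rewrite ffunE -st -sum1_count.
  suff : (\sum_(i | c i == j) [ffun i : A => count_mem (val i) s] i)%N%:R =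
      (\sum_(p <- s | p.1 == j) 1)%N%:R :> int by rewrite !natz => -[].
  rewrite !natr_sum (sumE _ (fun=> 1) (fun p => p.1 == j)).
  by apply: eq_bigr => i _; rewrite ffunE.
by rewrite sumE; apply: eq_bigr => i _; rewrite ffunE.
Qed.

(** The discrepancy between [z] and N times a point of the Minkowski sum is spread evenly over the
    summands, at most 1 for each. The total is then the integral point [z], so rounding the partial
    sums reproduces [z] exactly. *)
Lemma sub_sumset t z :
  lattice N (thick (msum K (fun j => (t j)%:R)) ((\sum_j t j)%N%:R / N%:R)) z ->
  z \in sumset t.
Proof.
move=> [_ [y [Ky ->]] zy]; set T := (\sum_j t j)%N%:R : R.
pose x := \sum_j (t j)%:R *: y j.
pose e : V := \row_i (((z ord0 i)%:~R - N%:R * x ord0 i) / T).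
have eT i : T * e ord0 i = (z ord0 i)%:~R - N%:R * x ord0 i.
  rewrite mxE mulrC; have [T0|T0] := eqVneq T 0; last by rewrite divfK.
  have := zy i; rewrite -/x -/T T0 mul0r normr_le0 mxE subr_eq0 => /eqP <-.
  by rewrite mulr0 [N%:R * _]mulrC divfK ?gt_eqF // subrr.
have e1 i : `|e ord0 i| <= 1.
  rewrite mxE normrM normfV; have [T0|T0] := eqVneq T 0.
    by rewrite T0 normr0 invr0 mulr0.
  have Tp : 0 < T by rewrite lt_neqAle eq_sym T0 ler0n.
  rewrite (gtr0_norm Tp) ler_pdivrMr // mul1r.
  have := zy i; rewrite -/x -/T mxE ler_pdivlMr // -{2}[N%:R]gtr0_norm // -normrM.
  by rewrite mulrBl divfK ?gt_eqF // [x _ _ * _]mulrC.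
pose cls := flatten [seq nseq (t j) j | j <- enum J].
pose w j := N%:R *: y j + e.
have [s [s1 s2 s3]] := round_seq cls w 0.
have clsE (f : J -> V) : \sum_(j <- cls) f j = \sum_j (t j)%:R *: f j.
  rewrite big_flatten big_map big_enum /=; apply: eq_bigr => j _.
  by rewrite big_nseq iter_addr_0 scaler_nat.
have -> : z = \sum_(p <- s) p.2.
  apply: row_ext => i; rewrite s2 add0r clsE !mxE floor0 subr0.
  have -> : (\sum_j (t j)%:R *: w j) ord0 i = (z ord0 i)%:~R.
    rewrite /w.
    have -> : \sum_j (t j)%:R *: (N%:R *: y j + e) = N%:R *: x + T *: e.
      rewrite /x scaler_sumr /T natr_sum scaler_suml -big_split; apply: eq_bigr => j _.
      by rewrite scalerDr !scalerA mulrC.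
    by rewrite mxE [(T *: e) _ _]mxE eT mxE addrC subrK.
  by rewrite intrKfloor.
apply: mem_sumset => [p ps|j].
  exists (y p.1) => // i; have := s3 p ps i; have := e1 i; rewrite !ler_norml /w !mxE.
  by move=> /andP[h1 h2] /andP[h3 h4]; apply/andP; split; lra.
rewrite -(count_map fst (pred1 j)) s1 /cls count_flatten -map_comp sumnE big_map big_enum /=.
rewrite (bigD1 j) //= count_nseq /= eqxx mul1n big1 ?addn0 // => k kj.
by rewrite count_nseq /= (negbTE kj).
Qed.

(** Each summand is off by at most 2 at scale N, and by convexity the true points of colour [j] add
    up to [t j] times a single point of [K j]. *)
Lemma sumset_sub t z : z \in sumset t ->
  lattice N (thick (msum K (fun j => (t j)%:R)) (2 * (\sum_j t j)%N%:R / N%:R)) z.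
Proof.
move=> /imfsetP [x /=]; rewrite mem_degfib => /eqP dx ->.
have /choice[y hy] (i : A) : exists y, K (c i) y /\ forall k, `|(a i ord0 k)%:~R - N%:R * y ord0 k| <= 2.
  by have /mem_A [y Ky h] := valP i; exists y.
have /choice[u hu] j : exists u, K j u /\ \sum_(i | c i == j) (x i)%:R *: y i = (t j)%:R *: u.
  have [||u Ku e] := @conv_comb (K j) 0 _ (index_enum _) (fun i : A => c i == j)
      (fun i => ((x : {ffun A -> nat}) i)%:R) y (Kc (j := j)) (K0 j).
  - by move=> i _; rewrite ler0n.
  - by move=> i /eqP <-; have [] := hy i.
  exists u; split=> //; rewrite e.
  by rewrite -dx ffunE natr_sum.
exists (\sum_j (t j)%:R *: u j).
  by exists u; split=> // j; have [] := hu j.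
move=> k; have -> : \sum_j (t j)%:R *: u j = \sum_i (x i)%:R *: y i.
  rewrite [RHS](partition_big c xpredT) //=; apply: eq_bigr => j _.
  by have [_ ->] := hu j.
have tE : (\sum_j t j = \sum_i x i)%N.
  by rewrite [RHS](partition_big c xpredT) //=; apply: eq_bigr => j _; rewrite -dx ffunE.
rewrite mxE ler_pdivlMr // -{2}[N%:R]gtr0_norm // -normrM mulrBl divfK ?gt_eqF //.
rewrite !summxE rmorph_sum /= mulr_suml -sumrB tE natr_sum mulr_sumr.
apply: le_trans (ler_norm_sum _ _ _) _; apply: ler_sum => i _.
have [_ /(_ k) h] := hy i.
have -> : ((a i *+ x i) ord0 k)%:~R - ((x i)%:R *: y i) ord0 k * N%:R =
    (x i)%:R * ((a i ord0 k)%:~R - N%:R * y i ord0 k).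
  by rewrite mulmxnE mxE rmorphMn /= -[_ *+ x i]mulr_natl; ring.
by rewrite normrM normr_nat mulrC ler_wpM2r.
Qed.

End Fixed.
End Sumset.

(** * Approximation of volumes of Minkowski sums by forms of degree n *)

Section MinkowskiSums.
Variables (R : realType) (n : nat) (J : finType).
Local Notation V := 'rV[R]_n.
Local Notation Z := 'rV[int]_n.
Local Notation cb := coord_bound.
Implicit Types (K : J -> set V) (s t : J -> R).

Lemma msum_scale K t c x : msum K t x -> msum K (fun j => c * t j) (c *: x).
Proof.
move=> [y [Ky ->]]; exists y; split=> //.
by rewrite scaler_sumr; apply: eq_bigr => j _; rewrite scalerA.
Qed.

Lemma msum_sub K t t' : (forall j, convexR (K j)) -> (forall j, K j 0) ->
  (forall j, 0 <= t j <= t' j) -> msum K t `<=` msum K t'.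
Proof.
move=> Kc K0 tt' _ [y [Ky ->]].
exists (fun j => (t j / t' j) *: y j); split=> [j|].
  rewrite -[X in K j X]addr0 -(scaler0 _ (1 - t j / t' j)); apply: Kc => //.
  have /andP[t0 tt] := tt' j; have [->|t'0] := eqVneq (t' j) 0; first by rewrite invr0 mulr0 lexx ler01.
  have t'p : 0 < t' j by rewrite lt_neqAle eq_sym t'0 (le_trans t0).
  by rewrite divr_ge0 ?(ltW t'p) //= ler_pdivrMr // mul1r.
apply: eq_bigr => j _; rewrite scalerA mulrC; have [t'0|t'0] := eqVneq (t' j) 0.
  by have /andP[h1 h2] := tt' j; rewrite t'0 in h2 *; rewrite mulr0; congr (_ *: _); apply/eqP; rewrite eq_le h1 h2.
by rewrite divfK.
Qed.

Lemma compact_msum K t : (forall j, compact (K j)) -> compact (msum K t).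
Proof.
move=> cK.
have cP := @tychonoff J (fun=> V) K cK.
pose f (y : prod_topology (fun _ : J => V)) : V := \sum_(j <- index_enum J) t j *: y j.
have fc : continuous f.
  apply: continuous_big; first exact: add_continuous.
  move=> j _ y; pose pj : prod_topology (fun _ : J => V) -> V := @proj J (fun=> V) j.
  have p : {for y, continuous pj} := @proj_continuous J (fun=> V) j y.
  have q := @continuous_comp _ _ _ pj (fun v : V => t j *: v) y p (@scaler_continuous _ _ (t j) _).
  exact q.
have := continuous_compact (continuous_subspaceT fc) cP.
congr compact; apply/seteqP; split=> x.
  by move=> [y Ky <-]; exists y.
by move=> [y [Ky ->]]; exists y.
Qed.

Lemma msum_translate K t (v : J -> V) x :
  msum (fun j => [set u | K j (u + v j)]) t x <-> msum K t (x + \sum_j t j *: v j).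
Proof.
split=> [[y [Ky ->]]|[y [Ky e]]].
  exists (fun j => y j + v j); split=> //.
  by rewrite -big_split; apply: eq_bigr => j _; rewrite /= scalerDr.
exists (fun j => y j - v j); split=> [j|]; first by rewrite /= subrK.
apply: (addIr (\sum_j t j *: v j)); rewrite e -big_split.
by apply: eq_bigr => j _; rewrite /= -scalerDr subrK.
Qed.

(* The part of degree [n] of a polynomial function given by its monomials. *)
Definition hform (L : seq (R * seq J)) s :=
  \sum_(cw <- L | size cw.2 == n) cw.1 * \prod_(j <- cw.2) s j.

Section Fixed.
Hypothesis n_gt0 : (0 < n)%N.
Variables (K : J -> set V) (b : R).
Hypothesis b_ge0 : 0 <= b.
Hypothesis Kb : forall j, cb (K j) b.
Hypothesis K0 : forall j, K j 0.
Hypothesis Kc : forall j, convexR (K j).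

(** For fixed N the cardinality of the sumset along the ray [m * s j + t0] is a polynomial [Q] in m.
    Scaling by m turns mesh 1/N into mesh 1/(N m), so [Q] lies between the volume and the lattice
    count of a thickening, both times (N m)^n. Its coefficient of degree n, which is the degree-n
    part of the counting polynomial at [s], is squeezed accordingly. The same [L] serves all [s]. *)
Lemma approx_hform N : (0 < N)%N -> exists L, forall s : J -> nat, (0 < \sum_j s j)%N ->
  Vol (msum K (fun j => (s j)%:R)) <= hform L (fun j => (s j)%:R) /\
  forall e B, 3 * (\sum_j s j)%N%:R / N%:R <= e ->
    (forall M, (0 < M)%N -> M%:R^-1 <= e ->
      cnt M (thick (msum K (fun j => (s j)%:R)) e) <= B) ->
    hform L (fun j => (s j)%:R) <= B.
Proof.
move=> N0; have N0' : 0 < N%:R :> R by rewrite ltr0n.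
have [p [pp [t0 hp]]] := evpoly_card_sumset N0 Kb K0.
have [L0 hL0] := polyfun_shift (fun=> t0%:R) pp.
exists [seq (cw.1 / N%:R ^+ n, cw.2) | cw <- L0] => s s0.
set sr := fun j => (s j)%:R : R; set S := (\sum_j s j)%N in s0 *.
pose Q : {poly R} := \sum_(cw <- L0) (cw.1 * \prod_(j <- cw.2) sr j) *: 'X^(size cw.2).
pose tm m : {ffun J -> nat} := [ffun j => (m * s j + t0)%N].
have QE m : Q.[m%:R] = #|` sumset K N (tm m)|%:R.
  rewrite hp; last by move=> j; rewrite ffunE leq_addl.
  rewrite (_ : (fun j => _) = (fun j => m%:R * sr j + t0%:R)); last first.
    by apply: funext => j; rewrite ffunE natrD natrM.
  rewrite hL0 horner_sum; apply: eq_bigr => cw _; rewrite hornerZ hornerXn -mulrA.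
  congr (_ * _); rewrite big_split /= mulrC; congr (_ * _).
  by rewrite big_const_seq count_predT iter_mulr_1.
have Qn : Q`_n = hform L0 sr.
  rewrite coef_sum /hform [RHS]big_mkcond /=; apply: eq_bigr => cw _.
  by rewrite coefZ coefXn eq_sym; case: eqP; rewrite ?mulr1 ?mulr0.
have hE : hform [seq (cw.1 / N%:R ^+ n, cw.2) | cw <- L0] sr = hform L0 sr / N%:R ^+ n.
  by rewrite /hform big_map /= mulr_suml; apply: eq_bigr => cw _; rewrite mulrAC.
have Nn0 : 0 < N%:R ^+ n :> R by rewrite exprn_gt0.
have Kbs : cb (msum K sr) (\sum_j sr j * b).
  move=> _ [y [Ky ->]] i; rewrite summxE; apply: le_trans (ler_norm_sum _ _ _) _.
  by apply: ler_sum => j _; rewrite mxE normrM normr_nat; apply: ler_wpM2l => //; exact: Kb.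
have Kbt m : cb (msum K (fun j => (tm m j)%:R)) (\sum_j (tm m j)%:R * b).
  move=> _ [y [Ky ->]] i; rewrite summxE; apply: le_trans (ler_norm_sum _ _ _) _.
  by apply: ler_sum => j _; rewrite mxE normrM normr_nat; apply: ler_wpM2l => //; exact: Kb.
have Tm m : (\sum_j tm m j = m * S + #|J| * t0)%N.
  rewrite /tm; under eq_bigr do rewrite ffunE.
  by rewrite big_split /= -big_distrr /= sum_nat_const.
have cardE M (X : set V) : (0 < M)%N -> #|` fset_set (lattice M X)|%:R = cnt M X * M%:R ^+ n.
  by move=> M0; rewrite /cnt divfK // expf_neq0 // pnatr_eq0 -lt0n.
have slE m (z : Z) : (0 < m)%N -> scale_lattice R (N * m) z = m%:R^-1 *: scale_lattice R N z.
  by move=> m0; apply: row_ext => i; rewrite !mxE natrM invfM mulrA mulrC.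
have low m : (0 < m)%N -> Vol (msum K sr) * (N * m)%:R ^+ n <= Q.[m%:R].
  move=> m0; have Nm0 : (0 < N * m)%N by rewrite muln_gt0 N0.
  have m0' : 0 < m%:R :> R by rewrite ltr0n.
  apply: le_trans (_ : cnt (N * m) (thick (msum K sr) (N * m)%:R^-1) * (N * m)%:R ^+ n <= _).
    by rewrite ler_pM2r ?exprn_gt0 ?ltr0n //; exact: Vol_le_cnt Kbs.
  rewrite -cardE // QE ler_nat; apply: fsubset_leq_card; apply/fsubsetP => z.
  rewrite in_fset_set; last exact: finite_lattice Nm0 (coord_bound_thick Kbs).
  rewrite inE => -[x Kx zx]; apply: sub_sumset => //; exists (m%:R *: x).
    apply: msum_sub (msum_scale m%:R Kx) => // j.
    by rewrite ffunE natrD natrM mulr_ge0 ?ler0n //= lerDl ler0n.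
  move=> i; have := zx i; rewrite slE // [in X in X -> _]mxE [(_ *: x) _ _]mxE => h.
  have -> : scale_lattice R N z ord0 i - m%:R * x ord0 i =
      m%:R * (m%:R^-1 * scale_lattice R N z ord0 i - x ord0 i).
    by rewrite mulrBr mulrA mulfV ?mul1r // lt0r_neq0.
  rewrite normrM gtr0_norm //; apply: le_trans (ler_wpM2l (ltW m0') h) _.
  rewrite natrM invfM mulrCA mulfV ?lt0r_neq0 // mulr1 -[leLHS]mul1r.
  rewrite ler_pM2r ?invr_gt0 // Tm ler1n.
  by rewrite (leq_trans _ (leq_addr _ _)) // muln_gt0 m0 s0.
(* [C] collects what the shift by [t0] adds. Once m >= C, this fits into the margin between the
   factor 2 of [sumset_sub] and the factor 3 of the statement. *)
pose C : R := 2 * (#|J| * t0)%:R + (#|J| * t0)%:R * b * N%:R.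
pose m0 := (Num.truncn C).+1.
have Cm m : (m0 <= m)%N -> C <= m%:R.
  move=> m0m; apply/ltW/(lt_le_trans (truncnS_gt C)); by rewrite ler_nat.
have upp e B m : 3 * S%:R / N%:R <= e ->
    (forall M, (0 < M)%N -> M%:R^-1 <= e -> cnt M (thick (msum K sr) e) <= B) ->
    (m0 <= m)%N -> Q.[m%:R] <= B * (N * m)%:R ^+ n.
  move=> Se hB m0m; have m1 : (0 < m)%N by apply: leq_trans m0m.
  have Nm0 : (0 < N * m)%N by rewrite muln_gt0 N0.
  have m0' : 0 < m%:R :> R by rewrite ltr0n.
  apply: le_trans (_ : cnt (N * m) (thick (msum K sr) e) * (N * m)%:R ^+ n <= _); last first.
    rewrite ler_pM2r ?exprn_gt0 ?ltr0n //; apply: hB => //; apply: le_trans Se.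
    rewrite natrM invfM ler_pdivlMr // mulrAC mulVf ?lt0r_neq0 // mul1r.
    apply: (@le_trans _ _ 1); first by rewrite invf_le1 // ler1n.
    by rewrite -natrM ler1n muln_gt0.
  rewrite -cardE // QE ler_nat; apply: fsubset_leq_card; apply/fsubsetP => z.
  move=> /(sumset_sub N0 Kb K0 Kc) [x [y [Ky xE]] zx].
  rewrite in_fset_set; last exact: finite_lattice Nm0 (coord_bound_thick Kbs).
  rewrite inE; exists (\sum_j sr j *: y j); first by exists y.
  move=> i; rewrite slE // mxE; apply: le_trans Se.
  set a := scale_lattice R N z ord0 i; set x' := (\sum_j sr j *: y j) ord0 i.
  have xe : x ord0 i = m%:R * x' + t0%:R * \sum_j y j ord0 i.
    rewrite xE /x' !summxE mulr_sumr mulr_sumr -big_split; apply: eq_bigr => j _.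
    by rewrite !mxE ffunE natrD natrM mulrDl mulrA.
  have hy : `|t0%:R * \sum_j y j ord0 i| <= (#|J| * t0)%:R * b.
    rewrite normrM normr_nat mulnC natrM -mulrA ler_wpM2l ?ler0n //.
    apply: le_trans (ler_norm_sum _ _ _) _.
    apply: le_trans (_ : \sum_(j : J) b <= _); first by apply: ler_sum => j _; exact: Kb.
    by rewrite sumr_const mulr_natl.
  have h := zx i; rewrite -/a xe Tm in h.
  have -> : m%:R^-1 * a - x' = (a - m%:R * x') / m%:R by field; rewrite lt0r_neq0.
  rewrite normrM normfV (gtr0_norm m0') ler_pdivrMr //.
  have -> : a - m%:R * x' = (a - (m%:R * x' + t0%:R * \sum_j y j ord0 i)) + t0%:R * \sum_j y j ord0 i by ring.
  apply: le_trans (ler_normD _ _) _; apply: le_trans (lerD h hy) _.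
  rewrite [leRHS]mulrAC ler_pdivlMr // mulrDl divfK ?lt0r_neq0 //.
  have := Cm m m0m; rewrite /C natrD natrM => hC.
  have mS : m%:R <= m%:R * S%:R :> R by rewrite ler_peMr ?ler0n // ler1n.
  lra.
rewrite hE; split.
  rewrite ler_pdivlMr // -Qn.
  (* [poly_growth_coef] also asks for an upper bound; any bound on the counts that is uniform in M
     serves, here that of a large box. *)
  pose e0 : R := 3 * S%:R / N%:R; pose b0 := \sum_j sr j * b + e0.
  have e00 : 0 <= e0 by rewrite /e0 divr_ge0 ?mulr_ge0.
  have b00 : 0 <= b0 by rewrite addr_ge0 // sumr_ge0 // => j _; rewrite mulr_ge0.
  have crude M : (0 < M)%N -> M%:R^-1 <= e0 ->
      cnt M (thick (msum K sr) e0) <= \prod_(i < n) (2 * b0 + e0).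
    move=> M0 Me; pose B0 : set V := box (const_mx (- b0)) (const_mx b0).
    have [fb hb] := @cnt_box R n M (const_mx (- b0)) (const_mx b0) M0.
    have sub : thick (msum K sr) e0 `<=` B0.
      by move=> x /(coord_bound_thick Kbs) hx i; rewrite !mxE -ler_norml; exact: hx.
    apply: le_trans (_ : cnt M B0 <= _).
      have bb : cb B0 b0.
        by move=> x hx i; have := hx i; rewrite !mxE -ler_norml.
      exact: cnt_le M0 bb sub.
    apply: le_trans hb _; apply: ler_prod => i _; rewrite !mxE opprK -(mulr2n b0) -(mulr_natl b0).
    by rewrite max_l ?mulr_ge0 // addr_ge0 ?mulr_ge0 ?invr_ge0 ?ler0n //= lerD2l.
  have [|+ _] := andP (@poly_growth_coef R Q n (maxn 1 m0) (Vol (msum K sr) * N%:R ^+ n)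
    (\prod_(i < n) (2 * b0 + e0) * N%:R ^+ n) _); last by [].
  move=> m; rewrite geq_max => /andP[m1 m0m].
  by rewrite -!mulrA -!exprMn -natrM low // (upp e0).
move=> e B Se hB; rewrite ler_pdivrMr // -Qn.
have [|_ +] := andP (@poly_growth_coef R Q n (maxn 1 m0) (Vol (msum K sr) * N%:R ^+ n)
    (B * N%:R ^+ n) _); last by [].
move=> m; rewrite geq_max => /andP[m1 m0m].
by rewrite -!mulrA -!exprMn -natrM low // (upp e).
Qed.

End Fixed.
End MinkowskiSums.

(** * Mixed volumes *)

Section Polarization.
Local Close Scope classical_set_scope.
Variables (R : realType) (n : nat).

(** If some [x] lies outside [T], toggling [x] is a sign-reversing involution on the supersets of
    [T]. *)
Lemma sum_superset_sign (T : {set 'I_n}) :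
  \sum_(S : {set 'I_n} | T \subset S) (-1) ^+ (n - #|S|) = (T == [set: 'I_n])%:R :> R.
Proof.
have [->|/eqP neT] := eqVneq T [set: 'I_n].
  rewrite (big_pred1 [set: 'I_n]) => [|S]; last by rewrite finset.subTset.
  by rewrite cardsT card_ord subnn.
have [x xT] : exists x, x \notin T.
  apply/existsP; rewrite -[[exists _, _]]negbK negb_exists; apply/negP => /forallP h.
  by apply: neT; apply/finset.setP => x; rewrite inE; have := h x; rewrite negbK.
rewrite (bigID (fun S : {set 'I_n} => x \in S)) /=.
rewrite (reindex_onto (fun S : {set 'I_n} => x |: S) (fun S => S :\ x)) /=; last first.
  by move=> S /andP[_ xS]; rewrite finset.setD1K.
rewrite (eq_big (fun S : {set 'I_n} => (T \subset S) && (x \notin S)) (fun S : {set 'I_n} => - (-1) ^+ (n - #|S|))).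
- by rewrite sumrN addNr.
- move=> S; rewrite finset.setU11 andbT; apply/andP/andP => [[TS /eqP e]|[TS xS]].
    have xS : x \notin S by rewrite -e !inE eqxx.
    split=> //; apply/fintype.subsetP => y yT; have := fintype.subsetP TS y yT; rewrite !inE.
    by case: eqP => // yx; rewrite yx (negbTE xT) in yT.
  by rewrite finset.setU1K // eqxx (fintype.subset_trans TS) // finset.subsetUr.
- move=> S /andP[/andP[_ _] /eqP e].
  have xS : x \notin S by rewrite -e !inE eqxx.
  have Sn : (#|S| < n)%N.
    by rewrite -[X in (_ < X)%N](card_ord n) -cardsT proper_card // properE finset.subsetT /=; apply/fintype.subsetPn; exists x.
  by rewrite cardsU1 xS add1n -[(n - #|S|)%N]prednK ?subn_gt0 // exprS mulN1r opprK subnS.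
Qed.

(** After exchanging the sums, the coefficient of [c g] is the alternating sum over the supersets of
    the image of [g], which vanishes unless [g] is a permutation. *)
Lemma incl_excl (c : {ffun 'I_n -> 'I_n} -> R) :
  \sum_(S : {set 'I_n}) (-1) ^+ (n - #|S|) *
    \sum_(g : {ffun 'I_n -> 'I_n} | [forall l, g l \in S]) c g =
  \sum_(s : 'S_n) c (val s).
Proof.
under eq_bigr do rewrite mulr_sumr.
rewrite (exchange_big_dep xpredT) //=.
have E (g : {ffun 'I_n -> 'I_n}) : \sum_(S : {set 'I_n} | [forall l, g l \in S]) (-1) ^+ (n - #|S|) * c g =
    if injectiveb g then c g else 0.
  rewrite -mulr_suml (eq_bigl (fun S : {set 'I_n} => [set g l | l in 'I_n] \subset S)); last first.
    move=> S; apply/forallP/fintype.subsetP => [h _ /imsetP[l _ ->]//|h l].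
    by apply: h; apply: imset_f.
  rewrite sum_superset_sign.
  have -> : ([set g l | l in 'I_n] == [set: 'I_n]) = injectiveb g.
    rewrite eqEcard finset.subsetT /= cardsT card_ord.
    apply/idP/injectiveP => [h|gi]; last by rewrite card_imset // card_ord.
    have /imset_injP gi : #|[set g l | l in 'I_n]| == #|'I_n|.
      by rewrite eqn_leq leq_imset_card card_ord.
    by move=> x y; exact: gi.
  by case: injectiveb; rewrite ?mul1r ?mul0r.
rewrite (eq_bigr _ (fun g _ => E g)) -big_mkcond /=.
rewrite (reindex (fun s : 'S_n => val s)) /=; last first.
  exists (insubd (1%g : 'S_n)) => [s _|g]; first exact: valKd.
  by rewrite inE => ?; exact: insubdK.
by apply: eq_bigl => s; rewrite (valP s).
Qed.

Variable J : finType.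
Implicit Types (f g : {ffun 'I_n -> J}) (F : {ffun J -> nat} -> R).

Definition mult (S : {set 'I_n}) f : {ffun J -> nat} :=
  [ffun j => #|[set l in S | f l == j]|].

(** The polarization formula. With [F] the volume of integer Minkowski sums, it is 1/n! times the
    alternating sum of the volumes of the partial sums of [K (f l)] over [l] in [S], the usual
    expression of a mixed volume. *)
Definition pol F f : R :=
  (n`!)%:R^-1 * \sum_(S : {set 'I_n}) (-1) ^+ (n - #|S|) * F (mult S f).

Definition form (c : {ffun 'I_n -> J} -> R) (s : J -> R) :=
  \sum_(g : {ffun 'I_n -> J}) (\prod_(l < n) s (g l)) * c g.

Let fcomp f (s : {ffun 'I_n -> 'I_n}) : {ffun 'I_n -> J} := [ffun l => f (s l)].

(** Write each multiplicity as a sum of indicators over [S] and distribute the product: the terms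
    are the maps into [S]. *)
Lemma form_mult c f (S : {set 'I_n}) :
  form c (fun j => (mult S f j)%:R) =
  \sum_(g : {ffun 'I_n -> 'I_n} | [forall l, g l \in S]) c (fcomp f g).
Proof.
rewrite /form.
have E (g : {ffun 'I_n -> J}) : \prod_l (mult S f (g l))%:R =
    \sum_(h : {ffun 'I_n -> 'I_n} | [forall l, h l \in S]) (fcomp f h == g)%:R :> R.
  rewrite (eq_bigr (fun l => \sum_(k in S) (f k == g l)%:R)) => [|l _]; last first.
    rewrite ffunE -sum1_card natr_sum big_mkcond [RHS]big_mkcond /=; apply: eq_bigr => k _.
    by rewrite inE; case: (k \in S); case: (f k == g l).
  rewrite bigA_distr_big /=; apply: eq_big => [h|h _].
    by apply/ffun_onP/forallP.
  have [e|ne] := eqVneq (fcomp f h) g.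
    by rewrite big1 // => l _; rewrite -e ffunE eqxx.
  have [l hl] : exists l, f (h l) != g l.
    apply/existsP; rewrite -[[exists _, _]]negbK negb_exists; apply/negP => /forallP hh.
    case/eqP: ne; apply/ffunP => l; rewrite ffunE; apply/eqP; rewrite -[_ == _]negbK; exact: hh.
  by rewrite (bigD1 l) //= (negbTE hl) mul0r.
under eq_bigr do rewrite E mulr_suml.
rewrite exchange_big /=; apply: eq_bigr => h _.
rewrite (bigD1 (fcomp f h)) //= eqxx mul1r big1 ?addr0 // => g.
by rewrite eq_sym => /negbTE->; rewrite mul0r.
Qed.

Lemma pol_form c f :
  pol (fun s => form c (fun j => (s j)%:R)) f =
  (n`!)%:R^-1 * \sum_(s : 'S_n) c [ffun l => f (s l)].
Proof.
rewrite /pol; congr (_ * _).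
rewrite (eq_bigr _ (fun S _ => congr1 _ (form_mult c f S))) incl_excl.
by apply: eq_bigr => s _; congr c; apply/ffunP => l; rewrite !ffunE pvalE.
Qed.

(** [pol] recovers the coefficients only up to symmetrization, and symmetrizing them leaves the form
    unchanged. *)
Lemma polarization c (t : J -> R) :
  form c t = form (pol (fun s => form c (fun j => (s j)%:R))) t.
Proof.
rewrite [RHS]/form; under eq_bigr do rewrite pol_form mulrCA mulr_sumr.
rewrite -mulr_sumr exchange_big /= (eq_bigr (fun=> form c t)) => [|s _].
  by rewrite sumr_const card_Sn -[form c t *+ _]mulr_natl mulKf // pnatr_eq0 -lt0n fact_gt0.
rewrite /form (reindex (fun g : {ffun 'I_n -> J} => [ffun l => g ((s^-1)%g l)])) /=.
  apply: eq_bigr => g _; congr (_ * c _).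
    rewrite [RHS](reindex (s^-1)%g) /=; last by exists s => l _; rewrite ?permK ?permKV.
    by apply: eq_bigr => l _; rewrite ffunE.
  by apply/ffunP => l; rewrite !ffunE permK.
exists (fun g : {ffun 'I_n -> J} => [ffun l => g (s l)]) => g _; apply/ffunP => l.
  by rewrite !ffunE permK.
by rewrite !ffunE permKV.
Qed.

Lemma hform_form (L : seq (R * seq J)) : exists c, hform n L =1 form c.
Proof.
exists (fun g => \sum_(cw <- L | cw.2 == [seq g l | l <- enum 'I_n]) cw.1) => s.
rewrite /hform /form; under [RHS]eq_bigr do rewrite mulr_sumr.
rewrite (exchange_big_dep xpredT) //= [LHS]big_mkcond /=; apply: eq_bigr => -[a w] _ /=.
case: eqP => [wn|wn].
  pose tw : n.-tuple J := Tuple (introT eqP wn).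
  pose g0 : {ffun 'I_n -> J} := [ffun l => tnth tw l].
  have e : w = [seq g0 l | l <- enum 'I_n].
    by apply: (etrans (esym (map_tnth_enum tw))); apply: eq_map => l; rewrite ffunE.
  rewrite (big_pred1 g0) => [|g].
    by rewrite mulrC; congr (_ * _); rewrite e big_map big_enum.
  rewrite e; apply/eqP/eqP => [/eqP h|->//]; apply/ffunP => l.
  by have /eq_in_map/(_ l) := esym (eqP h); apply; rewrite mem_enum.
rewrite big_pred0 // => g; apply/eqP => e; apply: wn.
by rewrite e size_map size_enum_ord.
Qed.

End Polarization.

(** * Polynomiality of the volume of Minkowski combinations *)

Section MixedVolume.
Variables (R : realType) (n : nat).
Hypothesis n_gt0 : (0 < n)%N.
Local Notation V := 'rV[R]_n.

Section Bodies.
Variable J : finType.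
Implicit Types (K : J -> set V) (s : {ffun J -> nat}) (f : {ffun 'I_n -> J}).

Definition volf K s : R := Vol (msum K (fun j => (s j)%:R)).

Local Notation mvol K := (@pol R n _ (volf K)).

Let idf : {ffun 'I_n -> 'I_n} := [ffun l => l].

Let multE (S : {set 'I_n}) f j : (mult S f j)%:R = \sum_(l | f l == j) (l \in S)%:R :> R.
Proof.
rewrite ffunE -sum1_card natr_sum big_mkcond [RHS]big_mkcond /=; apply: eq_bigr => l _.
by rewrite inE; case: (l \in S); case: (f l == j).
Qed.

(** By convexity m K is the sum of m copies of K, so repeated bodies may be given separate
    indices. *)
Lemma msum_mult K (S : {set 'I_n}) f : (forall j, K j !=set0) -> (forall j, convexR (K j)) ->
  msum K (fun j => (mult S f j)%:R) = msum (fun l => K (f l)) (fun l => (mult S idf l)%:R).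
Proof.
move=> K0 Kc.
have multid l : (mult S idf l)%:R = (l \in S)%:R :> R.
  rewrite ffunE -sum1_card natr_sum big_mkcond /= (bigD1 l) //= inE ffunE eqxx andbT.
  rewrite big1 ?addr0 => [|k kl]; first by case: (l \in S).
  by rewrite inE ffunE (negbTE kl) andbF.
apply/seteqP; split=> x [y [Ky ->]].
  exists (fun l => y (f l)); split=> //.
  rewrite [RHS](partition_big f xpredT) //=; apply: eq_bigr => j _.
  rewrite multE scaler_suml; apply: eq_bigr => l /eqP <-.
  by rewrite multid.
have /choice[u hu] j : exists u, K j u /\
    \sum_(l | f l == j) (l \in S)%:R *: y l = (mult S f j)%:R *: u.
  have [z Kz] := K0 j.
  have [||u Ku e] := @conv_comb R n (K j) z _ (index_enum _) (fun l => f l == j)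
      (fun l => (l \in S)%:R) y (Kc j) Kz.
  - by move=> l _; rewrite ler0n.
  - by move=> l /eqP <-; exact: Ky.
  by exists u; rewrite e multE.
exists u; split=> [j|]; first by have [] := hu j.
rewrite [LHS](partition_big f xpredT) //=; apply: eq_bigr => j _.
by have [_ <-] := hu j; apply: eq_bigr => l _; rewrite multid.
Qed.

Lemma pol_volf_comp K f : (forall j, K j !=set0) -> (forall j, convexR (K j)) ->
  mvol K f = pol (fun s : {ffun 'I_n -> nat} =>
    Vol (msum (fun l => K (f l)) (fun l => (s l)%:R))) idf.
Proof.
move=> K0 Kc; rewrite /pol; congr (_ * _); apply: eq_bigr => S _.
by rewrite /volf msum_mult.
Qed.

Let polB (F G : {ffun J -> nat} -> R) f : pol (fun s => F s - G s) f = pol F f - pol G f.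
Proof.
rewrite /pol -mulrBr -sumrB; congr (_ * _); apply: eq_bigr => S _.
by rewrite mulrBr.
Qed.

Section Centered.
Variable K : J -> set V.
Hypothesis cK : forall j, compact (K j).
Hypothesis K0 : forall j, K j 0.
Hypothesis Kc : forall j, convexR (K j).

Let Kb : exists b, 0 <= b /\ forall j, coord_bound (K j) b.
Proof.
have /choice[b hb] j : exists b, 0 <= b /\ coord_bound (K j) b.
  by have [b b0 h] := compact_coord_bound (@cK j); exists b.
exists (\sum_j b j); split; first by apply: sumr_ge0 => j _; have [] := hb j.
move=> j x Kx i; have [_ h] := hb j; apply: le_trans (h x Kx i) _.
by rewrite (bigD1 j) //= lerDl sumr_ge0 // => k _; have [] := hb k.
Qed.

(** [cnt_le_Vol] fixes a tolerance for each of the finitely many points; an N large enough for all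
    of them makes one form good at all of them. *)
Lemma approx_volf (ls : seq {ffun J -> nat}) (eta : R) : 0 < eta ->
  exists L, forall s, s \in ls -> `|hform n L (fun j => (s j)%:R) - volf K s| <= eta.
Proof.
move=> eta0; have [b [b0 hb]] := Kb.
have [N0 hN0] : exists N0, forall N, (N0 <= N)%N -> (0 < N)%N -> forall s, s \in ls ->
    exists e, 3 * (\sum_j s j)%N%:R / N%:R <= e /\
    forall M, (0 < M)%N -> M%:R^-1 <= e ->
      cnt M (thick (msum K (fun j => (s j)%:R)) e) <= volf K s + eta.
  elim: ls => [|s ls [N0 IH]]; first by exists 0%N.
  have [e e0 he] := cnt_le_Vol n_gt0 (compact_msum (t := fun j => (s j)%:R) cK) eta0.
  exists (maxn N0 (Num.truncn (3 * (\sum_j s j)%N%:R / e)).+1) => N.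
  rewrite geq_max => /andP[NN0 Ne] Np s'; rewrite inE => /orP[/eqP->|]; last exact: IH.
  exists e; split=> //; rewrite ler_pdivrMr ?ltr0n // [e * _]mulrC -ler_pdivrMr //.
  by apply/ltW/(lt_le_trans (truncnS_gt _)); rewrite ler_nat.
have [L hL] := approx_hform n_gt0 b0 hb K0 Kc (ltn0Sn N0).
exists L => s sls; have [/eqP|s0] := posnP (\sum_j s j)%N.
  rewrite sum_nat_eq0 => /forallP /= s0.
  have sE : (fun j => (s j)%:R) = (fun=> 0) :> (J -> R).
    by apply: funext => j; rewrite (eqP (s0 j)).
  have -> : hform n L (fun j => (s j)%:R) = 0.
    rewrite sE /hform big1 // => -[a [|j w]] /= /eqP wn; first by move: n_gt0; rewrite -wn.
    by rewrite big_cons mul0r mulr0.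
  have -> : volf K s = 0.
    have e : msum K (fun j => (s j)%:R) = [set 0].
      rewrite sE; apply/seteqP; split=> x.
        by move=> [y [_ ->]]; rewrite big1 // => j _; rewrite scale0r.
      by move=> ->; exists (fun=> 0); split=> //; rewrite big1 // => j _; rewrite scaler0.
    rewrite /volf e.
    have b1 : coord_bound [set 0 : V] 0 by move=> _ -> i; rewrite mxE normr0.
    (* The set is its own double, so its volume v satisfies v = 2^n v, and n > 0 forces v = 0. *)
    have := Vol_affine n_gt0 0 (ltr0n R 2) b1.
    rewrite (_ : [set _ | _ in _] = [set 0]); last first.
      by rewrite image_set1 scaler0 addr0.
    have n2 : 1 < 2 ^+ n :> R by rewrite exprn_egt1 ?ltr1n // -lt0n.
    move=> /eqP; rewrite -subr_eq0 -{1}[Vol _]mul1r -mulrBl mulf_eq0 subr_eq0.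
    by rewrite lt_eqF //= => /eqP.
  by rewrite subrr normr0 ltW.
have [h1 h2] := hL s s0.
have [e [e1 e2]] := hN0 N0.+1 (leqnSn _) (ltn0Sn _) s sls.
have h3 := h2 e _ e1 e2.
by rewrite ler_norml; apply/andP; split; rewrite /volf in h3 *; lra.
Qed.

(** Polarization is exact on forms, so replacing the volume by its defect [D] from an approximating
    form changes nothing in the difference of the two sides. Only finitely many integer points occur
    there, and [D] can be made arbitrarily small at all of them. *)
Lemma volf_form s : volf K s = form (mvol K) (fun j => (s j)%:R).
Proof.
set t := fun j => (s j)%:R : R.
(* The 1 accounts for the defect at [s] itself, the sum for the weights with which polarized defects
   enter the form. *)
pose C : R := 1 + \sum_(f : {ffun 'I_n -> J}) (\prod_l t (f l)) * ((n`!)%:R^-1 * #|{set 'I_n}|%:R).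
have tp f : 0 <= \prod_(l < n) t (f l) by apply: prodr_ge0 => l _; rewrite ler0n.
have C0 : 0 < C.
  rewrite /C ltr_wpDr // sumr_ge0 // => f _.
  by rewrite !mulr_ge0 ?invr_ge0 ?ler0n.
apply/eqP; rewrite -subr_eq0 -normr_eq0 eq_le normr_ge0 andbT.
apply/ler_addgt0Pr => e e0; rewrite add0r.
have eC : 0 < e / C by rewrite divr_gt0.
have [L hL] := approx_volf (s :: [seq mult p.1 p.2 | p : {set 'I_n} * {ffun 'I_n -> J}]) eC.
have [c hc] := hform_form n L.
pose D u := volf K u - form c (fun j => (u j)%:R).
have Dle u : u \in s :: [seq mult p.1 p.2 | p : {set 'I_n} * {ffun 'I_n -> J}] -> `|D u| <= e / C.
  by move=> /hL; rewrite hc distrC.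
have -> : volf K s - form (mvol K) t = D s - form (@pol R n _ D) t.
  rewrite /D -/t {1}(polarization c t).
  have -> : form (@pol R n _ D) t =
      form (mvol K) t - form (@pol R n _ (fun s => form c (fun j => (s j)%:R))) t.
    rewrite /form -sumrB; apply: eq_bigr => f _; rewrite -mulrBr; congr (_ * _).
    exact: polB.
  by ring.
have polD (f : {ffun 'I_n -> J}) : `|pol D f| <= (n`!)%:R^-1 * #|{set 'I_n}|%:R * (e / C).
  rewrite /pol normrM ger0_norm ?invr_ge0 ?ler0n // -mulrA ler_wpM2l ?invr_ge0 ?ler0n //.
  apply: le_trans (ler_norm_sum _ _ _) _.
  apply: (@le_trans _ _ (\sum_(S : {set 'I_n}) e / C)).
    apply: ler_sum => S _; rewrite normrM normrX normrN1 expr1n mul1r Dle // inE.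
    by apply/orP; right; apply/fintype.imageP; exists (S, f).
  by rewrite sumr_const mulr_natl lexx.
apply: le_trans (ler_normB _ _) _.
apply: (@le_trans _ _ (e / C + \sum_(f : {ffun 'I_n -> J}) (\prod_l t (f l)) * ((n`!)%:R^-1 * #|{set 'I_n}|%:R * (e / C)))).
  rewrite lerD // ?Dle ?mem_head //.
  apply: le_trans (ler_norm_sum _ _ _) _; apply: ler_sum => f _.
  by rewrite normrM ger0_norm // ler_wpM2l.
rewrite -[X in X + _]mul1r (eq_bigr (fun f : {ffun 'I_n -> J} => (\prod_l t (f l)) * ((n`!)%:R^-1 * #|{set 'I_n}|%:R) * (e / C))).
  by rewrite -mulr_suml -mulrDl mulrC divfK // lt0r_neq0.
by move=> f _; rewrite mulrA.
Qed.

(** Homogeneity extends the formula from integer to rational weights. Since 0 lies in every [K j],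
    the combination is monotone in the weights, and continuity of the form squeezes real weights
    between rational ones. *)
Lemma Vol_msum_centered t : (forall j, 0 <= t j) ->
  Vol (msum K t) = form (mvol K) t.
Proof.
move=> t0; have [b [b0 hb]] := Kb.
have msb u : coord_bound (msum K u) (\sum_j `|u j| * b).
  move=> _ [y [Ky ->]] i; rewrite summxE; apply: le_trans (ler_norm_sum _ _ _) _.
  by apply: ler_sum => j _; rewrite mxE normrM; apply: ler_wpM2l => //; exact: hb.
set P := form (mvol K).
have rat q (s : J -> nat) : (0 < q)%N -> Vol (msum K (fun j => (s j)%:R / q%:R)) = P (fun j => (s j)%:R / q%:R).
  move=> q0; have q0' : 0 < q%:R^-1 :> R by rewrite invr_gt0 ltr0n.
  have -> : msum K (fun j => (s j)%:R / q%:R) =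
      [set q%:R^-1 *: x + 0 | x in msum K (fun j => ([ffun j => s j] j)%:R)].
    apply/seteqP; split=> x.
      move=> [y [Ky ->]]; exists (\sum_j (s j)%:R *: y j).
        by exists y; split=> //; apply: eq_bigr => j _; rewrite ffunE.
      by rewrite addr0 scaler_sumr; apply: eq_bigr => j _; rewrite scalerA mulrC.
    move=> [_ [y [Ky ->]] <-]; exists y; split=> //.
    by rewrite addr0 scaler_sumr; apply: eq_bigr => j _; rewrite scalerA mulrC ffunE.
  rewrite (Vol_affine n_gt0 0 q0' (msb _)) -/(volf K [ffun j => s j]) volf_form /P /form mulr_sumr.
  apply: eq_bigr => f _; rewrite big_split /= prodr_const card_ord [RHS]mulrAC mulrC.
  by congr (_ * _ * _); apply: eq_bigr => l _; rewrite ffunE.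
have Pcont (u : nat -> J -> R) : (forall j, u q j @[q --> \oo] --> t j) -> P (u q) @[q --> \oo] --> P t.
  move=> hu; apply: cvg_big; first exact: add_continuous.
  move=> f _; apply: cvgM; last exact: cvg_cst.
  by apply: cvg_big; first exact: mul_continuous.
have near_t (u : nat -> J -> R) : (forall q j, (0 < q)%N -> `|t j - u q j| <= q%:R^-1) ->
    forall j, u q j @[q --> \oo] --> t j.
  move=> hu j; apply/cvgrPdist_le => e e0; exists (Num.truncn e^-1).+1 => // q /= hq.
  have q0 : (0 < q)%N by apply: leq_trans hq.
  apply: le_trans (hu q j q0) _; rewrite invf_ple ?posrE ?ltr0n //.
  by apply/ltW/(lt_le_trans (truncnS_gt _)); rewrite ler_nat.
pose s q j := Num.truncn (q%:R * t j).
have sP q j : (s q j)%:R <= q%:R * t j < (s q j).+1%:R.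
  by rewrite truncn_itv // mulr_ge0.
have lo : P (fun j => (s q j)%:R / q%:R) @[q --> \oo] --> P t.
  apply: (Pcont (fun q j => (s q j)%:R / q%:R)); apply: near_t => q j q0.
  have q0' : 0 < q%:R :> R by rewrite ltr0n.
  have /andP[h1 h2] := sP q j.
  rewrite -[t j](mulKf (lt0r_neq0 q0')) [_ / q%:R]mulrC -mulrBr normrM gtr0_norm ?invr_gt0 //.
  rewrite -[leRHS]mulr1 ler_pM2l ?invr_gt0 // ger0_norm ?subr_ge0 //.
  by move: h2; rewrite -natr1; lra.
have up : P (fun j => (s q j).+1%:R / q%:R) @[q --> \oo] --> P t.
  apply: (Pcont (fun q j => (s q j).+1%:R / q%:R)); apply: near_t => q j q0.
  have q0' : 0 < q%:R :> R by rewrite ltr0n.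
  have /andP[h1 h2] := sP q j.
  rewrite -[t j](mulKf (lt0r_neq0 q0')) [_ / q%:R]mulrC -mulrBr normrM gtr0_norm ?invr_gt0 //.
  rewrite -[leRHS]mulr1 ler_pM2l ?invr_gt0 // distrC ger0_norm ?subr_ge0 ?(ltW h2) //.
  by rewrite -natr1; lra.
apply/eqP; rewrite eq_le; apply/andP; split; apply/ler_addgt0Pr => e e0.
  move/cvgrPdist_le: up => /(_ e e0) [q0 _ /(_ q0.+1 (leqnSn _))] /=.
  rewrite -rat // => h; have : Vol (msum K t) <= Vol (msum K (fun j => (s q0.+1 j).+1%:R / q0.+1%:R)).
    apply: Vol_le (msb _) _ => //; apply: msum_sub => // j; rewrite t0 /=.
    by rewrite ler_pdivlMr ?ltr0n // mulrC; have /andP[_ /ltW] := sP q0.+1 j.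
  by move: h; rewrite ler_norml; lra.
move/cvgrPdist_le: lo => /(_ e e0) [q0 _ /(_ q0.+1 (leqnSn _))] /=.
rewrite -rat // => h; have : Vol (msum K (fun j => (s q0.+1 j)%:R / q0.+1%:R)) <= Vol (msum K t).
  apply: Vol_le (msb _) _ => //; apply: msum_sub => // j; rewrite divr_ge0 ?ler0n //=.
  by rewrite ler_pdivrMr ?ltr0n // mulrC; have /andP[] := sP q0.+1 j.
by move: h; rewrite ler_norml; lra.
Qed.

End Centered.

(** Translating each body so that it contains 0 translates every combination and leaves its volume
    unchanged. *)
Lemma Vol_msum_pol K t : (forall j, ccset (K j)) -> (forall j, 0 <= t j) ->
  Vol (msum K t) = form (mvol K) t.
Proof.
move=> hK t0; have /choice[v Kv] j : K j !=set0 by have [] := hK j.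
pose K' j := [set u | K j (u + v j)].
have K'E j : K' j = [set x - v j | x in K j].
  apply/seteqP; split=> x; first by move=> h; exists (x + v j) => //; rewrite addrK.
  by move=> [y Ky <-]; rewrite /K' /= subrK.
have cK' j : compact (K' j).
  rewrite K'E; apply: continuous_compact; last by have [_ []] := hK j.
  have cf : continuous (fun y : V => y - v j).
    move=> y; apply: (@cvgB R V V (nbhs y) _ (fun y => y) (fun=> v j) y (v j)).
      exact: cvg_id.
    exact: cvg_cst.
  exact: continuous_subspaceT cf.
have K'0 j : K' j 0 by rewrite /K' /= add0r.
have K'c j : convexR (K' j).
  move=> x y a Kx Ky a01; have [_ [_ h]] := hK j; have := h _ _ _ Kx Ky a01.
  by rewrite /K' /= !scalerDr addrACA -scalerDl [a + _]addrC subrK scale1r.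
have VE u : Vol (msum K u) = Vol (msum K' u).
  have [b _ hb] := compact_coord_bound (compact_msum (t := u) cK').
  rewrite (_ : msum K u = [set 1 *: x + \sum_j u j *: v j | x in msum K' u]).
    by rewrite (Vol_affine n_gt0 _ ltr01 hb) expr1n mul1r.
  apply/seteqP; split=> x.
    move=> Kx; exists (x - \sum_j u j *: v j); last by rewrite scale1r subrK.
    by apply/msum_translate; rewrite subrK.
  by move=> [y /msum_translate h <-]; rewrite scale1r.
rewrite VE (Vol_msum_centered cK' K'0 K'c t0); congr form.
by apply: funext => f; rewrite /pol; congr (_ * _); apply: eq_bigr => S _; rewrite /volf VE.
Qed.

End Bodies.
End MixedVolume.

(** * Existence, uniqueness and two-body expansion of mixed volumes *)

Section MV.
Variables (R : realType) (n : nat).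
Hypothesis n_gt0 : (0 < n)%N.
Local Notation V := 'rV[R]_n.
Local Notation mvol K := (@pol R n _ (volf K)).
Let idf : {ffun 'I_n -> 'I_n} := [ffun l => l].

Let volf_formE (J : finType) (K : J -> set V) (c : {ffun 'I_n -> J} -> R) :
  (forall t, (forall j, 0 <= t j) -> Vol (msum K t) = form c t) ->
  volf K = fun s => form c (fun j => (s j)%:R).
Proof. by move=> h; apply: funext => s; apply: h => j; rewrite ler0n. Qed.

Let ccset_conv (J : Type) (K : J -> set V) :
  (forall j, ccset (K j)) -> (forall j, K j !=set0) /\ (forall j, convexR (K j)).
Proof. by move=> hK; split=> j; have [? [? ?]] := hK j. Qed.

(** This witness is what gives the value chosen by [epsilon] in [MV] its defining properties. *)
Lemma is_mixed_volume_pol : is_mixed_volume (fun K : 'I_n -> set V => mvol K idf).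
Proof.
split=> [K s hK|K t hK t0].
  have [K0 Kc] := ccset_conv hK.
  have e := volf_formE (fun t => Vol_msum_pol n_gt0 hK (t := t)).
  have -> : mvol (K \o s) idf = mvol K [ffun l => s l].
    rewrite (@pol_volf_comp R n _ K [ffun l => s l] K0 Kc); congr (pol _ _).
    apply: funext => u; rewrite /volf; congr (Vol (msum _ _)).
    by apply: funext => l; rewrite /= ffunE.
  rewrite e !pol_form; congr (_ * _).
  rewrite (reindex (fun u : 'S_n => (u * s^-1)%g)) /=.
    by apply: eq_bigr => u _; congr (mvol K _); apply/ffunP => l; rewrite !ffunE permM permKV.
  by exists (fun u : 'S_n => (u * s)%g) => u _; rewrite ?mulgK ?mulgKV.
have [K0 Kc] := ccset_conv hK.
rewrite -[mink_comb K t]/(msum K t) (Vol_msum_pol n_gt0 hK t0) /form.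
by apply: eq_bigr => f _; rewrite pol_volf_comp.
Qed.

Lemma MV_is_mixed_volume : is_mixed_volume (@MV R n).
Proof. exact: ClassicalEpsilon.epsilon_spec (ex_intro _ _ is_mixed_volume_pol). Qed.

(** Uniqueness: polarizing the volume expansion averages its coefficients over permutations, and by
    symmetry of [MV] all the averaged terms are equal. *)
Lemma MV_comp (J : finType) (K : J -> set V) (f : {ffun 'I_n -> J}) :
  (forall j, ccset (K j)) -> MV (fun l => K (f l)) = mvol K f.
Proof.
move=> hK; have [K0 Kc] := ccset_conv hK; have [Msym Mform] := MV_is_mixed_volume.
rewrite pol_volf_comp //; set K' := fun l => K (f l).
have hK' l : ccset (K' l) by exact: hK.
have e := @volf_formE _ K' (fun g => MV (fun l => K' (g l))) (fun t t0 => Mform K' t hK' t0).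
rewrite -/(volf K') e pol_form (eq_bigr (fun=> MV K')) => [|s _].
  by rewrite sumr_const card_Sn -[MV K' *+ _]mulr_natl mulKf // pnatr_eq0 -lt0n fact_gt0.
rewrite -(Msym K' s hK'); congr (MV _); apply: funext => l.
by rewrite /= !ffunE.
Qed.

Theorem Vol_msum_MV (J : finType) (K : J -> set V) (t : J -> R) :
  (forall j, ccset (K j)) -> (forall j, 0 <= t j) ->
  Vol (msum K t) = \sum_(f : {ffun 'I_n -> J}) (\prod_l t (f l)) * MV (fun l => K (f l)).
Proof.
move=> hK t0; rewrite Vol_msum_pol //; apply: eq_bigr => f _.
by rewrite MV_comp.
Qed.

Lemma perm_of_card (f g : {ffun 'I_n -> bool}) :
  #|[pred l | f l]| = #|[pred l | g l]| -> exists s : 'S_n, forall l, f l = g (s l).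
Proof.
move=> fg.
have cnt_f (h : {ffun 'I_n -> bool}) : count_mem true [tuple h l | l < n] = #|[pred l | h l]|.
  rewrite /= count_map -sum1_count big_enum_cond /= -sum1_card.
  by apply: eq_bigl => l; rewrite !inE eqb_id.
have countE (a : pred bool) (s : seq bool) :
    count a s = (a true * count_mem true s + a false * (size s - count_mem true s))%N.
  elim: s => [|b s IH]; first by rewrite /= !muln0.
  rewrite /= IH eqb_id; have := count_size (pred1 true) s.
  move: (count _ s) (size s) => c m cs.
  case: b; case: (a true); case: (a false); rewrite /= ?mul1n ?mul0n; lia.
have /tuple_permP [s e] : perm_eq [tuple f l | l < n] [tuple g l | l < n].
  by apply/seq.permP => a; rewrite [LHS]countE [RHS]countE !cnt_f !size_tuple fg.
exists s => l; have /(congr1 (fun w : n.-tuple bool => tnth w l)) := val_inj e.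
by rewrite !tnth_mktuple.
Qed.

Definition segsum (G K : set V) (a b : R) : set V :=
  msum (fun i : bool => if i then K else G) (fun i => if i then b else a).

Lemma segsumP (G K : set V) a b x : segsum G K a b x <->
  exists u v, [/\ G u, K v & x = a *: u + b *: v].
Proof.
split=> [[y [Ky ->]]|[u [v [Gu Kv ->]]]].
  exists (y false), (y true); split; [exact: (Ky false)|exact: (Ky true)|].
  by rewrite big_bool addrC.
by exists (fun i => if i then v else u); split; [case|rewrite big_bool addrC].
Qed.

(** The index functions are grouped by how often they choose [K]; symmetry identifies all terms of
    one group with [MVj]. *)
Lemma Vol_segsum (G K : set V) a b : ccset G -> ccset K -> 0 <= a -> 0 <= b ->
  Vol (segsum G K a b) = \sum_(j < n.+1) 'C(n, j)%:R * (a ^+ (n - j) * b ^+ j) * MVj j G K.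
Proof.
move=> hG hK a0 b0; rewrite /segsum Vol_msum_MV; [|by case|by case].
have [Msym _] := MV_is_mixed_volume.
pose num (f : {ffun 'I_n -> bool}) : 'I_n.+1 := inord #|[pred l | f l]|.
have numE f : num f = #|[pred l | f l]| :> nat.
  by rewrite inordK // ltnS (leq_trans (max_card _)) // card_ord.
rewrite (partition_big num xpredT) //=; apply: eq_bigr => j _.
have jn : (j <= n)%N by rewrite -ltnS.
rewrite (eq_bigr (fun=> (a ^+ (n - j) * b ^+ j) * MVj j G K)) => [|f /eqP fj]; last first.
  have fjn : #|[pred l | f l]| = j by rewrite -numE fj.
  congr (_ * _).
    rewrite (bigID (fun l => f l)) /= mulrC; congr (_ * _).
      rewrite (eq_bigr (fun=> a)) => [|l /negbTE->//]; rewrite prodr_const; congr (_ ^+ _).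
      have fC := cardC [pred l | f l]; rewrite card_ord fjn in fC.
      by apply: (@addnI j); rewrite subnKC // -[RHS]fC; congr (_ + _)%N.
    rewrite (eq_bigr (fun=> b)) => [|l ->//]; rewrite prodr_const -fjn.
    by congr (_ ^+ _); apply: eq_card.
  pose g : {ffun 'I_n -> bool} := [ffun l : 'I_n => ~~ (l < n - j)%N].
  have [s hs] : exists s : 'S_n, forall l, f l = g (s l).
    apply: perm_of_card; rewrite fjn.
    have : #|[pred l : 'I_n | (l < n - j)%N]| = (n - j)%N.
      by rewrite -sum1_card -(big_ord_widen n (fun=> 1%N)) ?leq_subr // sum1_card card_ord.
    have := cardC [pred l : 'I_n | (l < n - j)%N]; rewrite card_ord => h1 h2.
    have -> : #|[pred l | g l]| = #|[predC [pred l : 'I_n | (l < n - j)%N]]|.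
      by apply: eq_card => l; rewrite !inE ffunE.
    by rewrite h2 in h1; apply: (@addnI (n - j)%N); rewrite h1 subnK.
  rewrite /MVj -(Msym (fun i : 'I_n => if (i < n - j)%N then G else K) s); last by move=> i; case: ifP.
  by congr (MV _); apply: funext => l; rewrite /= hs ffunE if_neg.
rewrite big_const iter_addr_0 -[RHS]mulrA [RHS]mulr_natl; congr (_ *+ _).
rewrite -[n in 'C(n, _)](card_ord n) -card_draws -!sum1_card.
rewrite (reindex (fun A : {set 'I_n} => [ffun l => l \in A])) /=; last first.
  exists (fun f : {ffun 'I_n -> bool} => finset (fun l => f l)) => [A _|f _].
    by apply/finset.setP => l; rewrite finset.in_set ffunE.
  by apply/ffunP => l; rewrite ffunE finset.in_set.
apply: eq_bigl => A; rewrite finset.in_set unfold_in eqnE numE.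
by congr (_ == _); apply: eq_card => l; rewrite !inE ffunE.
Qed.

End MV.

(** * Bernstein polynomials *)

Section Bernstein.
Variables (R : realType) (n : nat).

(** The primitive is the sum of the Bernstein polynomials of degree n+1 with index above [j], built
    by descending induction from j = n. Its values at 0 and 1 say that each basis polynomial of
    degree n has integral 1/(n+1). *)
Lemma bernstein_primitive j : (j <= n)%N -> exists Q : {poly R},
  [/\ Q^`() = n.+1%:R *: ('C(n, j)%:R *: ((1 - 'X) ^+ (n - j) * 'X^j)), Q.[0] = 0 & Q.[1] = 1].
Proof.
have [k] : exists k, (k = n - j)%N by eexists.
elim: k j => [|k IH] j kE jn.
  have jE : j = n by apply/eqP; rewrite eqn_leq jn -subn_eq0 -kE eqxx.
  exists 'X^(n.+1); rewrite jE subnn expr0 mul1r binn scale1r derivXn /=.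
  by rewrite -scaler_nat !hornerXn expr0n expr1n.
have jn' : (j < n)%N by rewrite -subn_gt0 -kE.
have [||Q [QE Q0 Q1]] := IH j.+1 => //; first by rewrite subnS -kE.
exists (Q + 'C(n.+1, j.+1)%:R *: ((1 - 'X) ^+ (n - j) * 'X^(j.+1))); split; last 2 first.
- by rewrite hornerD Q0 hornerZ hornerM hornerXn expr0n /= !mulr0 addr0.
- rewrite hornerD Q1 hornerZ hornerM horner_exp hornerD hornerN hornerX (hornerC 1).
  by rewrite subrr -kE expr0n /= mul0r mulr0 addr0.
have e1 : ('C(n.+1, j.+1) * j.+1 = n.+1 * 'C(n, j))%N by rewrite mul_bin_diag mulnC.
have e2 : ('C(n.+1, j.+1) * (n - j) = n.+1 * 'C(n, j.+1))%N.
  by rewrite (mul_bin_down n.+1 j.+1) subSS mulnC.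
have E1 : 'C(n.+1, j.+1)%:R * j.+1%:R = n.+1%:R * 'C(n, j)%:R :> {poly R}.
  by rewrite -!natrM e1.
have E2 : 'C(n.+1, j.+1)%:R * k.+1%:R = n.+1%:R * 'C(n, j.+1)%:R :> {poly R}.
  by rewrite -!natrM kE e2.
have dX : (1 - 'X : {poly R})^`() = -1 by rewrite derivB derivX (derivC 1) sub0r.
rewrite derivD QE derivZ derivM derivXn deriv_exp dX subnS -kE /=.
rewrite !scaler_nat -[_ *+ k.+1]mulr_natl -['X^j *+ _]mulr_natl !exprS.
rewrite -[_ *+ n.+1]mulr_natl -[_ *+ 'C(n, j.+1)]mulr_natl -[_ *+ 'C(n.+1, j.+1)]mulr_natl.
rewrite -[RHS]mulr_natl -[_ *+ 'C(n, j)]mulr_natl.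
move: E1 E2; set N := n.+1%:R; set c := 'C(n.+1, j.+1)%:R; set J := j.+1%:R; set k1 := k.+1%:R.
set c0 := 'C(n, j)%:R; set c1 := 'C(n, j.+1)%:R; set A := (1 - 'X) ^+ k; set B := 'X^j => E1 E2.
transitivity ((N * c1) * A * 'X * B - (c * k1) * A * 'X * B + (c * J) * (1 - 'X) * A * B); first by ring.
by rewrite E1 E2; ring.
Qed.

Definition bern (d : nat -> R) (s : R) :=
  \sum_(j < n.+1) 'C(n, j)%:R * ((1 - s) ^+ (n - j) * s ^+ j) * d j.

(* The mean of [d 0], ..., [d n] is the integral of [bern d] over [0, 1]. *)
Lemma bern_sum_ge (d : nat -> R) (b : R) :
  (forall s, 0 <= s <= 1 -> 0 <= bern d s) ->
  (forall s, 1 / 3 <= s <= 2 / 3 -> b <= bern d s) ->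
  b / 3 * n.+1%:R <= \sum_(j < n.+1) d j.
Proof.
move=> d0 db.
have /choice[Q hQ] (j : 'I_n.+1) := @bernstein_primitive j (leq_ord j).
pose P := \sum_(j < n.+1) d j *: Q j.
have P' s : P^`().[s] = n.+1%:R * bern d s.
  have -> : P^`() = \sum_(j < n.+1) d j *: (Q j)^`().
    by rewrite raddf_sum; apply: eq_bigr => j _; exact: derivZ.
  rewrite horner_sum mulr_sumr; apply: eq_bigr => j _; have [-> _ _] := hQ j.
  rewrite !hornerZ hornerM hornerXn horner_exp hornerD hornerN hornerX (hornerC 1).
  by rewrite mulrCA; congr (_ * _); rewrite mulrC.
have P1 : P.[1] = \sum_(j < n.+1) d j.
  by rewrite horner_sum; apply: eq_bigr => j _; have [_ _ h] := hQ j; rewrite hornerZ h mulr1.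
have P0 : P.[0] = 0.
  by rewrite horner_sum big1 // => j _; have [_ h _] := hQ j; rewrite hornerZ h mulr0.
have n1 : 0 <= n.+1%:R :> R by rewrite ler0n.
have incr (x y c : R) : x < y -> 0 <= x -> y <= 1 -> (forall s, x <= s <= y -> c <= bern d s) ->
    n.+1%:R * c * (y - x) <= P.[y] - P.[x].
  move=> xy x0 y1 h; have [z] := polyrcf.poly_mvt P xy; rewrite in_itv /= => /andP[xz zy] ->.
  by rewrite P' ler_wpM2r ?subr_ge0 ?(ltW xy) // ler_wpM2l // h // !ltW.
have := @incr 0 (1/3) 0; have := @incr (1/3) (2/3) b; have := @incr (2/3) 1 0.
rewrite P1 P0 mulr0 !mul0r => h3 h2 h1.
have : 0 <= P.[1 / 3] - 0 by apply: h1; [lra|lra|lra|move=> s hs; apply: d0; lra].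
have : n.+1%:R * b * (2 / 3 - 1 / 3) <= P.[2 / 3] - P.[1 / 3] by apply: h2; [lra|lra|lra|].
have : 0 <= \sum_(j < n.+1) d j - P.[2 / 3] by apply: h3; [lra|lra|lra|move=> s hs; apply: d0; lra].
lra.
Qed.

(** A polynomial of degree at most n is determined by its values at n+1 nodes of [0, 1], so the
    inverse Vandermonde matrix bounds its coefficients. Binomials are at least 1, so the bound
    passes to the [d j]. *)
Lemma coef_sum_bound : exists2 C : R, 0 <= C & forall (d : nat -> R) (B : R), 0 <= B ->
  (forall t, 0 <= t <= 1 -> `|\sum_(j < n.+1) 'C(n, j)%:R * t ^+ j * d j| <= B) ->
  `|\sum_(j < n.+1) d j| <= C * B.
Proof.
pose a : 'rV[R]_n.+1 := \row_j (j%:R / n.+1%:R).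
pose W := invmx (Vandermonde n.+1 a).
have n1 : 0 < n.+1%:R :> R by rewrite ltr0n.
have uV : Vandermonde n.+1 a \in unitmx.
  rewrite unitmxE det_Vandermonde unitfE; apply/prodf_neq0 => i _; apply/prodf_neq0 => j ij.
  rewrite /a !mxE -mulrBl; apply: mulf_neq0; last by rewrite invr_eq0 lt0r_neq0.
  by rewrite subr_eq0 eqr_nat gtn_eqF.
exists (\sum_(i < n.+1) \sum_(k < n.+1) `|W k i|).
  by apply: sumr_ge0 => i _; apply: sumr_ge0.
move=> d B B0 hB.
pose v : 'rV[R]_n.+1 := \row_j ('C(n, j)%:R * d j).
have vE : v = (v *m Vandermonde n.+1 a) *m W by rewrite -mulmxA mulmxV // mulmx1.
apply: le_trans (ler_norm_sum _ _ _) _; rewrite mulr_suml; apply: ler_sum => i _.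
have C1 : 1 <= 'C(n, i)%:R :> R by rewrite ler1n bin_gt0 leq_ord.
apply: (@le_trans _ _ `|v ord0 i|).
  by rewrite mxE normrM [X in X * _]ger0_norm ?ler0n // ler_peMl.
rewrite vE mxE mulr_suml; apply: le_trans (ler_norm_sum _ _ _) _; apply: ler_sum => k _.
rewrite normrM mulrC ler_wpM2l //.
have ak : 0 <= a ord0 k <= 1.
  rewrite mxE divr_ge0 ?ler0n //= ler_pdivrMr // mul1r ler_nat.
  by rewrite ltnW // ltnS leq_ord.
apply: le_trans (hB _ ak).
rewrite mxE le_eqVlt; apply/orP; left; apply/eqP; congr `|_|; apply: eq_bigr => j _.
by rewrite !mxE mulrAC.
Qed.

End Bernstein.

(** * Volume of caps *)

Section Euclid.
Variables (R : realType) (n : nat).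
Local Notation V := 'rV[R]_n.
Implicit Types (x y z u v : V).

Definition dot x y : R := \sum_i x ord0 i * y ord0 i.

Lemma dotDl x y z : dot (x + y) z = dot x z + dot y z.
Proof. by rewrite -big_split; apply: eq_bigr => i _; rewrite mxE mulrDl. Qed.

Lemma dotZl a x z : dot (a *: x) z = a * dot x z.
Proof. by rewrite mulr_sumr; apply: eq_bigr => i _; rewrite mxE mulrA. Qed.

Lemma dotC x y : dot x y = dot y x.
Proof. by apply: eq_bigr => i _; rewrite mulrC. Qed.

Lemma dotNl x z : dot (- x) z = - dot x z.
Proof. by rewrite -scaleN1r dotZl mulN1r. Qed.

Lemma dotBl x y z : dot (x - y) z = dot x z - dot y z.
Proof. by rewrite dotDl dotNl. Qed.

Lemma dotDr x y z : dot x (y + z) = dot x y + dot x z.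
Proof. by rewrite dotC dotDl !(dotC x). Qed.

Lemma dotZr a x z : dot x (a *: z) = a * dot x z.
Proof. by rewrite dotC dotZl dotC. Qed.

Lemma dotNr x y : dot x (- y) = - dot x y.
Proof. by rewrite dotC dotNl dotC. Qed.

Lemma dotBr x y z : dot x (y - z) = dot x y - dot x z.
Proof. by rewrite dotDr dotNr. Qed.

Definition dotE := (dotDl, dotDr, dotBl, dotBr, dotNl, dotNr, dotZl, dotZr).

Lemma dot_sub_sqr x y t :
  dot (x - t *: y) (x - t *: y) = dot x x - 2 * t * dot x y + t ^+ 2 * dot y y.
Proof. by rewrite !dotE (dotC y x); ring. Qed.

Lemma dot_add_sqr x y t :
  dot (x + t *: y) (x + t *: y) = dot x x + 2 * t * dot x y + t ^+ 2 * dot y y.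
Proof. by rewrite !dotE (dotC y x); ring. Qed.

Lemma dot_ge0 x : 0 <= dot x x.
Proof. by apply: sumr_ge0 => i _; rewrite -expr2 sqr_ge0. Qed.

Lemma enormE x : enorm x = Num.sqrt (dot x x).
Proof. by rewrite /enorm; congr Num.sqrt; apply: eq_bigr => i _; rewrite expr2. Qed.

Lemma enorm_le x (c : R) : 0 <= c -> (enorm x <= c) = (dot x x <= c ^+ 2).
Proof.
move=> c0; rewrite enormE -{1}(ger0_norm c0) -sqrtr_sqr ler_sqrt //.
exact: sqr_ge0.
Qed.

Lemma coord_sqr_le x i : x ord0 i ^+ 2 <= dot x x.
Proof.
rewrite /dot (bigD1 i) //= -expr2 lerDl; apply: sumr_ge0 => j _.
by rewrite -expr2 sqr_ge0.
Qed.

Lemma coord_le_enorm x i : `|x ord0 i| <= enorm x.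
Proof. by rewrite enormE -sqrtr_sqr ler_sqrt ?dot_ge0 // coord_sqr_le. Qed.

Lemma dot_le_norms x y : `|dot x y| <= \sum_i `|x ord0 i| * `|y ord0 i|.
Proof.
apply: le_trans (ler_norm_sum _ _ _) _; apply: ler_sum => i _.
by rewrite normrM.
Qed.

Lemma unit_coord_le1 u i : dot u u = 1 -> `|u ord0 i| <= 1.
Proof.
move=> u1; rewrite -(ler_pXn2r (n := 2)) ?nnegrE // expr1n real_normK ?num_real //.
by rewrite -u1 coord_sqr_le.
Qed.

Lemma cauchy_schwarz x u : dot u u = 1 -> dot x u ^+ 2 <= dot x x.
Proof.
move=> u1; have := dot_ge0 (x - dot x u *: u).
by rewrite !dotE u1 (dotC u x); nra.
Qed.

Lemma continuous_coord i : continuous (fun x : V => x ord0 i).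
Proof. exact: (@coord_continuous R 1 n ord0 i). Qed.

Lemma continuous_dist_sqr p : continuous (fun x : V => dot (p - x) (p - x)).
Proof.
apply: continuous_big; first exact: add_continuous.
move=> i _ x.
have h : (p - y) ord0 i @[y --> x] --> (p - x) ord0 i.
  have -> : (fun y : V => (p - y) ord0 i) = (fun y : V => p ord0 i - y ord0 i).
    by apply: funext => y; rewrite !mxE.
  have -> : (p - x) ord0 i = p ord0 i - x ord0 i by rewrite !mxE.
  apply: (@cvgB R _ _ (nbhs x) _ (fun=> p ord0 i) (fun y : V => y ord0 i)).
    exact: cvg_cst.
  exact: continuous_coord.
exact: (cvgM h h).
Qed.

(** [u] points from the nearest point [y] of [L] towards [p]; moving from [y] along a segment of [L]
    cannot decrease the distance to first order. *)
Lemma separation (L : set V) p (d : R) : ccset L -> 0 < d ->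
  (forall y, L y -> d ^+ 2 < dot (p - y) (p - y)) ->
  exists u, dot u u = 1 /\ forall z, L z -> dot z u <= dot p u - d.
Proof.
move=> [L0 [Lc Lv]] d0 hd.
have [y Ly ymin] := compact_EVT_min L0 Lc (continuous_subspaceT (@continuous_dist_sqr p)).
rewrite inE in Ly.
set w := p - y; have w2 : 0 < dot w w by apply: lt_trans (hd y Ly); rewrite exprn_gt0.
have ineq z : L z -> dot w (z - y) <= 0.
  move=> Lz; rewrite leNgt; apply/negP => wz.
  set q := dot (z - y) (z - y).
  have q0 : 0 <= q by exact: dot_ge0.
  (* The bound 1 keeps the point on the segment; the quotient makes the linear gain exceed the
     quadratic term. *)
  pose t := Num.min 1 (dot w (z - y) / (q + 1)).
  have q1 : 0 < q + 1 by lra.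
  have t0 : 0 < t by rewrite lt_min ltr01 divr_gt0.
  have t1 : t <= 1 by rewrite ge_min lexx.
  have tq : t * (q + 1) <= dot w (z - y) by rewrite -ler_pdivlMr // ge_min lexx orbT.
  have Lt : L (t *: z + (1 - t) *: y) by apply: Lv => //; rewrite t1 ltW.
  have := ymin (t *: z + (1 - t) *: y); rewrite inE => /(_ Lt).
  have -> : p - (t *: z + (1 - t) *: y) = w - t *: (z - y).
    by rewrite /w scalerBr scalerBl scale1r !opprD !opprK !addrA; apply: row_ext => i; rewrite !mxE; ring.
  rewrite -/w dot_sub_sqr -/q => h.
  have h1 : t * (t * (q + 1)) <= t * dot w (z - y) by rewrite ler_pM2l.
  have h2 : 0 < t * dot w (z - y) by rewrite mulr_gt0.
  have h3 := sqr_ge0 t; move: h h1 h2 h3; set A := dot w (z - y); nra.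
have sw : 0 < Num.sqrt (dot w w) by rewrite sqrtr_gt0.
have sE : Num.sqrt (dot w w) ^+ 2 = dot w w by rewrite sqr_sqrtr // ltW.
have ds : d <= Num.sqrt (dot w w).
  by rewrite -(ger0_norm (ltW d0)) -sqrtr_sqr ler_sqrt // ltW // hd.
set s := Num.sqrt (dot w w) in sw sE ds *.
exists (s^-1 *: w); split.
  by rewrite dotZl dotZr -sE; field; rewrite lt0r_neq0.
move=> z Lz.
have hz : dot z w <= dot p w - dot w w.
  have := ineq z Lz; have -> : z - y = z - p + w by rewrite /w addrA subrK.
  by rewrite dotDr dotBr !(dotC w); lra.
rewrite !dotZr -(ler_pM2l sw) mulrBr !mulVKf ?lt0r_neq0 //.
apply: le_trans hz _; rewrite lerD2l lerN2 -sE expr2.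
by rewrite ler_pM2l.
Qed.

End Euclid.

Section Cap.
Variables (R : realType) (n : nat).
Hypothesis n_gt0 : (0 < n)%N.
Local Notation V := 'rV[R]_n.
Local Notation Z := 'rV[int]_n.

(** Additivity across a gap, obtained by counting: rounding at mesh 1/M moves the height along [u]
    by at most n/M, so for n/M < t no lattice point is both near [X] and in [S]. [S] enters through
    its counts because these add over disjoint sets. *)
Lemma Vol_add_halfspace (X Y S : set V) (u : V) (c t b : R) :
  compact Y -> X `<=` Y -> S `<=` Y -> dot u u = 1 -> 0 < t ->
  (forall x, X x -> dot x u <= c) -> (forall x, S x -> c + t <= dot x u) ->
  (exists M0 : nat, forall M, (M0 <= M)%N -> (0 < M)%N -> b <= cnt M S) ->
  Vol X + b <= Vol Y.
Proof.
move=> cY XY SY u1 t0 hX hS [M0 hM]; apply/ler_addgt0Pr => e e0.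
have [d d0 hd] := cnt_le_Vol n_gt0 cY e0.
have [B B0 YB] := compact_coord_bound cY.
pose M := (maxn M0 (maxn (Num.truncn d^-1).+1 (Num.truncn (n%:R / t)).+1)).
have [MM0 Md Mt] : [/\ (M0 <= M)%N, (Num.truncn d^-1 < M)%N & (Num.truncn (n%:R / t) < M)%N].
  by split; rewrite /M !leq_max leqnn ?orbT.
have Mp : (0 < M)%N by apply: leq_ltn_trans Md.
have Mp' : 0 < M%:R :> R by rewrite ltr0n.
have Md' : M%:R^-1 <= d.
  rewrite invf_ple ?posrE //; apply/ltW/(lt_le_trans (truncnS_gt _)).
  by rewrite ler_nat.
have Mt' : n%:R * M%:R^-1 < t.
  rewrite ltr_pdivrMr // mulrC -ltr_pdivrMr //; apply/(lt_le_trans (truncnS_gt _)).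
  by rewrite ler_nat.
apply: le_trans (hd M Mp Md').
apply: le_trans (lerD (Vol_le_cnt n_gt0 Mp (coord_bound_sub XY YB)) (hM M MM0 Mp)) _.
rewrite /cnt -mulrDl ler_pM2r ?invr_gt0 ?exprn_gt0 // -natrD ler_nat.
have fY := finite_lattice Mp (coord_bound_thick (e := d) YB).
have sX : lattice M (thick X M%:R^-1) `<=` lattice M (thick Y d).
  move=> z [x Xx zx]; exists x; first exact: XY.
  by move=> i; apply: le_trans (zx i) Md'.
have sS : lattice M S `<=` lattice M (thick Y d).
  by move=> z /SY Yz; apply: thick_ge0 => //; exact: ltW.
have fX := sub_finite_set sX fY; have fS := sub_finite_set sS fY.
rewrite -cardfsUI -fset_setI // (_ : _ `&` _ = set0) ?fset_set0 ?cardfs0 ?addn0.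
  rewrite -fset_setU //; apply: card_fset_set_le => //.
  by move=> z [/sX|/sS].
apply/seteqP; split=> // z [[x Xx zx] /hS Sz].
have : `|dot (scale_lattice R M z - x) u| <= n%:R * M%:R^-1.
  apply: le_trans (dot_le_norms _ _) _.
  apply: (@le_trans _ _ (\sum_(i < n) M%:R^-1)); last by rewrite sumr_const card_ord mulr_natl.
  apply: ler_sum => i _; rewrite -[leRHS]mulr1; apply: ler_pM => //.
    by rewrite mxE [in X in `|_ + X|]mxE; exact: zx.
  exact: unit_coord_le1.
by rewrite dotBl ler_norml; have := hX x Xx; lra.
Qed.

(* Solving for the coordinate [i0], in which [u] does not vanish, turns the slab
   [S] into a sheared box. *)
Lemma cnt_slab (z0 u : V) (i0 : 'I_n) (a b : R) : dot u u = 1 -> u ord0 i0 != 0 ->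
  0 < a -> 0 < b ->
  let S := [set x : V | (forall j, j != i0 -> `|x ord0 j - z0 ord0 j| <= a) /\
                        - b <= dot (x - z0) u <= - (b / 2)] in
  (exists B, coord_bound S B) ->
  exists M0 : nat, forall M, (M0 <= M)%N -> (0 < M)%N -> a ^+ n.-1 * (b / 4) <= cnt M S.
Proof.
move=> u1 ui a0 b0 S [B SB].
exists (maxn (Num.truncn a^-1).+1 (Num.truncn (4 / b)).+1) => M; rewrite geq_max => /andP[Ma Mb] M0.
have M0' : 0 < M%:R :> R by rewrite ltr0n.
have Ma' : 1 <= a * M%:R.
  rewrite -ler_pdivrMl // mulr1; apply/ltW/(lt_le_trans (truncnS_gt _)).
  by rewrite ler_nat.
have Mb' : 4 <= b * M%:R.
  rewrite -ler_pdivrMl // mulrC; apply/ltW/(lt_le_trans (truncnS_gt _)).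
  by rewrite ler_nat.
pose r (z : Z) : R := \sum_(j | j != i0) (((z ord0 j)%:~R / M%:R - z0 ord0 j) * u ord0 j).
(* The point at height - 3 b / 4, the middle of the slab, on the line through the given other
   coordinates, lowered by b / 4. Coordinates of [u] are at most 1 in size, so the interval of
   length b / 2 above [low] stays in the slab. *)
pose low (z : Z) : R := z0 ord0 i0 + (- (3 * b / 4) - r z) / u ord0 i0 - b / 4.
pose lo j := Num.ceil (M%:R * (z0 ord0 j - a)).
pose lo0 z := Num.ceil (M%:R * low z).
pose qa := Num.truncn (2 * a * M%:R); pose qb := Num.truncn (b / 2 * M%:R).
pose len j := if j == i0 then qb else qa.
pose base (w : Z) : Z := \row_j (lo j + w ord0 j).
pose phi (w : Z) : Z := \row_j (if j == i0 then lo0 (base w) + w ord0 i0 else base w ord0 j).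
have r_phi w : r (phi w) = r (base w).
  by apply: eq_bigr => j /negbTE ji; congr ((_%:~R / _ - _) * _); rewrite [LHS]mxE ji.
have phi_inj : injective phi.
  move=> w w' e.
  have ej j : j != i0 -> w ord0 j = w' ord0 j.
    move=> /negbTE ji; have := congr1 (fun z : Z => z ord0 j) e; rewrite [LHS]mxE [RHS]mxE ji [LHS]mxE [RHS]mxE.
    exact: addrI.
  have eb : low (base w) = low (base w').
    rewrite /low; congr (_ + (_ - _) / _ - _); apply: eq_bigr => j ji.
    by congr ((_%:~R / _ - _) * _); rewrite [LHS]mxE [RHS]mxE (ej j ji).
  apply: row_ext => j; have [->|/ej //] := eqVneq j i0.
  have := congr1 (fun z : Z => z ord0 i0) e; rewrite [LHS]mxE [RHS]mxE eqxx /lo0 eb.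
  exact: addrI.
have sub : [set phi w | w in zbox 0 len] `<=` lattice M S.
  move=> _ [w hw <-].
  have ceilP (x : R) (k : int) (q : R) : 0 <= k -> k%:~R + 1 <= q ->
      x <= (Num.ceil x + k)%:~R <= x + q.
    move=> k0 kq; have := ceil_ge x; have := ceilB1_lt x; rewrite intrB intrD.
    have : 0 <= k%:~R :> R by rewrite ler0z.
    by rewrite rmorph1 => *; apply/andP; split; lra.
  have lenP j : (w ord0 j)%:~R + 1 <= (len j)%:R :> R.
    have /andP[_] := hw j; rewrite mxE add0r => h.
    have : ((w ord0 j + 1)%:~R : R) <= ((len j)%:Z)%:~R by rewrite ler_int; lia.
    by rewrite intrD rmorph1 -pmulrn.
  have w0 j : 0 <= w ord0 j by have /andP[] := hw j; rewrite mxE.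
  have qaE : qa%:R <= 2 * a * M%:R by rewrite truncn_le !mulr_ge0 ?ltW.
  have qbE : qb%:R <= b / 2 * M%:R by rewrite truncn_le mulr_ge0 ?divr_ge0 ?ltW.
  have scE (z : Z) j (l q : R) : M%:R * l <= (z ord0 j)%:~R <= M%:R * l + q * M%:R ->
      l <= scale_lattice R M z ord0 j <= l + q.
    by move=> /andP[h1 h2]; rewrite mxE ler_pdivlMr // ler_pdivrMr // mulrDl !(mulrC l) h1.
  have part1 j : j != i0 -> z0 ord0 j - a <= scale_lattice R M (phi w) ord0 j <= z0 ord0 j - a + 2 * a.
    move=> ji; apply: scE; rewrite [phi w _ _]mxE (negbTE ji) [base w _ _]mxE.
    apply: ceilP => //; apply: le_trans (lenP j) _; by rewrite /len (negbTE ji).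
  have part2 : low (base w) <= scale_lattice R M (phi w) ord0 i0 <= low (base w) + b / 2.
    apply: scE; rewrite [phi w _ _]mxE eqxx.
    by apply: ceilP => //; apply: le_trans (lenP i0) _; rewrite /len eqxx.
  split=> [j /part1 /andP[h1 h2]|]; first by rewrite ler_norml; apply/andP; split; lra.
  have -> : dot (scale_lattice R M (phi w) - z0) u =
      (scale_lattice R M (phi w) ord0 i0 - z0 ord0 i0) * u ord0 i0 + r (base w).
    rewrite /dot (bigD1 i0) //= -r_phi; congr (_ + _); first by rewrite !mxE.
    by apply: eq_bigr => j _; rewrite !mxE.
  pose e := scale_lattice R M (phi w) ord0 i0 - z0 ord0 i0 - (- (3 * b / 4) - r (base w)) / u ord0 i0.
  have eb : `|e| <= b / 4.
    by move: part2; rewrite /low /e => /andP[h1 h2]; rewrite ler_norml; apply/andP; split; lra.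
  have -> : scale_lattice R M (phi w) ord0 i0 - z0 ord0 i0 =
      e + (- (3 * b / 4) - r (base w)) / u ord0 i0 by rewrite /e subrK.
  rewrite mulrDl divfK //.
  have : `|e * u ord0 i0| <= b / 4.
    rewrite normrM -[leRHS]mulr1; apply: ler_pM => //; exact: unit_coord_le1.
  by rewrite ler_norml => /andP[h1 h2]; apply/andP; split; lra.
have fL := finite_lattice M0 SB.
rewrite /cnt ler_pdivlMr ?exprn_gt0 //.
apply: (@le_trans _ _ (#|` fset_set [set phi w | w in zbox 0 len]|)%:R); last first.
  by rewrite ler_nat card_fset_set_le.
rewrite fset_set_image; last exact: finite_zbox.
rewrite card_imfset //= card_zbox (bigD1 i0) //= /len eqxx.
rewrite (eq_bigr (fun=> qa)) => [|j /negbTE->//].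
rewrite prod_nat_const (_ : #|_| = n.-1); last by rewrite -[in RHS](card_ord n) -(cardC1 i0); apply: eq_card.
(* The mesh was chosen so that rounding [2 * a * M] and [b / 2 * M] down loses at most half of
   each. *)
have h1 : a * M%:R <= qa%:R.
  by have := truncnS_gt (2 * a * M%:R); rewrite -/qa -(addn1 qa) natrD; lra.
have h2 : b * M%:R / 4 <= qb%:R.
  by have := truncnS_gt (b / 2 * M%:R); rewrite -/qb -(addn1 qb) natrD; lra.
rewrite natrM natrX -[in M%:R ^+ n](prednK n_gt0) exprS.
have -> : a ^+ n.-1 * (b / 4) * (M%:R * M%:R ^+ n.-1) = (b * M%:R / 4) * (a * M%:R) ^+ n.-1.
  by rewrite exprMn; ring.
apply: ler_pM => //; first by rewrite divr_ge0 ?mulr_ge0 ?ltW.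
  by rewrite exprn_ge0 // mulr_ge0 ?ltW.
by rewrite lerXn2r ?nnegrE ?mulr_ge0 ?ler0n ?(ltW a0).
Qed.

End Cap.

Section CapVolume.
Variables (R : realType) (n : nat).
Hypothesis n_gt0 : (0 < n)%N.
Local Notation V := 'rV[R]_n.

(** Chosen so that [cap_const r * Num.sqrt h ^+ n.+1] is [a ^+ n.-1 * (b / 4)], the count of a slab
    of half-width [a = Num.sqrt (r / (4 * N)) * Num.sqrt h], where N = n + 2 n^3, and parameter
    [b = h / 2]. *)
Definition cap_const (r : R) : R :=
  Num.sqrt (r / (4 * (n%:R + 2 * n%:R ^+ 3))) ^+ n.-1 / 8.

Lemma cap_const_gt0 r : 0 < r -> 0 < cap_const r.
Proof.
move=> r0; have n0 : 0 < n%:R :> R by rewrite ltr0n.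
by rewrite divr_gt0 // exprn_gt0 // sqrtr_gt0 divr_gt0 // mulr_gt0 // ltr_wpDr.
Qed.

Lemma unit_big_coord (u : V) : dot u u = 1 -> exists i, 1 <= n%:R * u ord0 i ^+ 2.
Proof.
move=> u1; apply: contrapT => h.
have lt1 i : u ord0 i ^+ 2 < n%:R^-1.
  rewrite ltNge; apply/negP => hi; apply: h; exists i.
  by rewrite -ler_pdivrMl ?ltr0n // mulr1.
have : \sum_i u ord0 i * u ord0 i < \sum_(i < n) n%:R^-1.
  apply: ltr_sum => [|i _]; last by rewrite -expr2.
  by apply/hasP; exists (Ordinal n_gt0) => //; rewrite mem_index_enum.
rewrite -/(dot u u) u1 sumr_const card_ord -[_ *+ n]mulr_natl divff ?ltxx //.
by rewrite pnatr_eq0 -lt0n.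
Qed.

(** The cap contains a slab of width of order sqrt (r h), at depths between h/4 and h/2 below the
    top of the ball. [X] stays at depth at least h, which leaves a gap of h/2. A coordinate of [u]
    of square at least 1/n keeps the shear of the slab under control. *)
Lemma Vol_cap (X Y : set V) (o u : V) (r h : R) :
  compact Y -> X `<=` Y -> 0 < r -> dot u u = 1 ->
  (forall x, dot (x - o) (x - o) <= r ^+ 2 -> Y x) ->
  0 < h -> 2 * n%:R * h <= r -> (forall x, X x -> dot x u <= dot o u + r - h) ->
  Vol X + cap_const r * Num.sqrt h ^+ n.+1 <= Vol Y.
Proof.
move=> cY XY r0 u1 ball h0 hr hX.
have n0 : 1 <= n%:R :> R by rewrite ler1n.
have [i0 ui] := unit_big_coord u1.
have ui0 : u ord0 i0 != 0.
  by apply/eqP => e; move: ui; rewrite e expr0n mulr0 ler10.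
(* For [v] the offset from the top point, |v|^2 <= N a^2 + 2 n b^2. Each of these two terms is kept
   below r b / 2, so that the cross term 2 r (v.u) <= - r b compensates both. *)
pose N : R := n%:R + 2 * n%:R ^+ 3.
have N0 : 0 < N by rewrite ltr_wpDr ?mulr_ge0 ?exprn_ge0 ?ler0n // (lt_le_trans ltr01).
pose k := Num.sqrt (r / (4 * N)); pose a := k * Num.sqrt h; pose b := h / 2.
have k0 : 0 < k by rewrite sqrtr_gt0 divr_gt0 // mulr_gt0.
have sh0 : 0 < Num.sqrt h by rewrite sqrtr_gt0.
have a0 : 0 < a by rewrite mulr_gt0.
have b0 : 0 < b by rewrite divr_gt0.
have a2 : N * a ^+ 2 = r * b / 2.
  rewrite exprMn !sqr_sqrtr ?(ltW h0) //; last by rewrite ltW // divr_gt0 // mulr_gt0.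
  by rewrite /b; field; rewrite lt0r_neq0.
pose z0 := o + r *: u.
pose S := [set x : V | (forall j, j != i0 -> `|x ord0 j - z0 ord0 j| <= a) /\
                        - b <= dot (x - z0) u <= - (b / 2)].
have SY : S `<=` Y.
  move=> x [hj /andP[d1 d2]]; apply: ball; set v := x - z0 in d1 d2.
  have -> : x - o = v + r *: u by rewrite /v /z0 opprD addrA subrK.
  rewrite dot_add_sqr u1.
  have hj' j : j != i0 -> `|v ord0 j| <= a by move=> /hj; rewrite !mxE.
  set s := \sum_(j | j != i0) v ord0 j * u ord0 j.
  have sb : `|s| <= n%:R * a.
    apply: le_trans (ler_norm_sum _ _ _) _.
    apply: (@le_trans _ _ (\sum_(j | j != i0) a)).
      apply: ler_sum => j ji; rewrite normrM -[leRHS]mulr1.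
      by apply: ler_pM => //; [exact: hj'|exact: unit_coord_le1].
    rewrite big_mkcond /= mulr_natl -[X in _ *+ X](card_ord n) -sumr_const.
    by apply: ler_sum => j _; case: ifP => // _; exact: ltW.
  have dE : dot v u = v ord0 i0 * u ord0 i0 + s by rewrite /dot (bigD1 i0).
  have vv : dot v v <= v ord0 i0 ^+ 2 + n%:R * a ^+ 2.
    rewrite /dot (bigD1 i0) //= -expr2 lerD2l.
    apply: (@le_trans _ _ (\sum_(j | j != i0) a ^+ 2)).
      apply: ler_sum => j ji; rewrite -expr2 -[leLHS]real_normK ?num_real //.
      by rewrite lerXn2r ?nnegrE ?(ltW a0) //; exact: hj'.
    rewrite big_mkcond /= mulr_natl -[X in _ *+ X](card_ord n) -sumr_const.
    by apply: ler_sum => j _; case: ifP => // _; exact: sqr_ge0.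
  have vu : (v ord0 i0 * u ord0 i0) ^+ 2 <= 2 * b ^+ 2 + 2 * n%:R ^+ 2 * a ^+ 2.
    have : `|v ord0 i0 * u ord0 i0| <= b + n%:R * a.
      move: sb; rewrite !ler_norml => /andP[s1 s2]; apply/andP; split; lra.
    move=> hv; rewrite -real_normK ?num_real //.
    apply: (@le_trans _ _ ((b + n%:R * a) ^+ 2)).
      by rewrite lerXn2r ?nnegrE // addr_ge0 ?mulr_ge0 ?ler0n // ltW.
    have := sqr_ge0 (b - n%:R * a); nra.
  have vi : v ord0 i0 ^+ 2 <= n%:R * (v ord0 i0 * u ord0 i0) ^+ 2.
    by rewrite exprMn mulrCA -[leLHS]mulr1 ler_wpM2l // sqr_ge0.
  have vi' : v ord0 i0 ^+ 2 <= n%:R * (2 * b ^+ 2 + 2 * n%:R ^+ 2 * a ^+ 2).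
    by apply: le_trans vi _; rewrite ler_wpM2l.
  have nb : 2 * n%:R * b ^+ 2 <= r * b / 2.
    have : (2 * n%:R * h) * (b / 2) <= r * (b / 2) by rewrite ler_pM2r // divr_gt0.
    by rewrite /b; lra.
  have dvv : dot v v <= r * b.
    have : N * a ^+ 2 + 2 * n%:R * b ^+ 2 <= r * b by lra.
    by rewrite /N; lra.
  have : r * dot v u <= r * - (b / 2) by rewrite ler_pM2l.
  lra.
have Vadd := @Vol_add_halfspace R n n_gt0 X Y S u (dot o u + r - h) b (a ^+ n.-1 * (b / 4)) cY XY SY u1 b0 hX.
have -> : cap_const r * Num.sqrt h ^+ n.+1 = a ^+ n.-1 * (b / 4).
  rewrite /cap_const -/N -/k /a exprMn /b.
  have -> : n.+1 = (n.-1 + 2)%N by rewrite addn2 prednK.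
  by rewrite exprD sqr_sqrtr ?(ltW h0) //; field.
apply: Vadd => [x [_ /andP[d1 _]]|].
  have -> : dot x u = dot (x - z0) u + dot z0 u by rewrite -dotDl subrK.
  by rewrite /z0 [dot (o + _) _]dotDl dotZl u1 /b in d1 *; lra.
apply: cnt_slab => //.
have [B _ YB] := compact_coord_bound cY.
by exists B; exact: coord_bound_sub SY YB.
Qed.

End CapVolume.

(** * Inner rolling ball *)

Section RollingBall.
Variables (R : realType) (n : nat).
Local Notation V := 'rV[R]_n.
Implicit Types (x y z u v : V) (f rho : V -> R).

Lemma evecE i j : @evec R n i ord0 j = (i == j)%:R.
Proof. by rewrite mxE eqxx eq_sym. Qed.

Lemma is_derive_axis f k y t : derivable f (y + t *: evec R k) (evec R k) ->
  is_derive t 1 (fun s : R => f (y + s *: evec R k)) (partial k f (y + t *: evec R k)).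
Proof.
have e : (fun h : R => h^-1 *: (((fun s : R => f (y + s *: evec R k)) \o shift t) (h *: (1 : R)) -
             f (y + t *: evec R k))) =
         (fun h : R => h^-1 *: ((f \o shift (y + t *: evec R k)) (h *: evec R k) -
             f (y + t *: evec R k))).
  apply: funext => h; congr (_ *: (f _ - _)); rewrite /shift /= [h *: 1]mulr1.
  by rewrite scalerDl addrCA.
by move=> df; apply: DeriveDef; rewrite /derivable /derive e.
Qed.

Lemma axis_MVT f k y a : (forall x, derivable f x (evec R k)) ->
  exists2 c, `|c| <= `|a| &
    f (y + a *: evec R k) - f y = partial k f (y + c *: evec R k) * a.
Proof.
move=> df.
have d s := is_derive_axis (df (y + s *: evec R k)).
have cont : continuous (fun s : R => f (y + s *: evec R k)).
  by move=> s; apply/differentiable_continuous/derivable1_diffP; exact: (@ex_derive _ _ _ _ _ _ _ (d s)).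
have f0 : f (y + 0 *: evec R k) = f y by rewrite scale0r addr0.
have [a0|a0] := leP 0 a.
- have [c] := MVT_segment a0 (fun s _ => d s) (continuous_subspaceT cont).
  rewrite in_itv /= => /andP[c0 ca]; rewrite f0 subr0 => ->.
  by exists c; rewrite // !ger0_norm.
- have [c] := MVT_segment (ltW a0) (fun s _ => d s) (continuous_subspaceT cont).
  rewrite in_itv /= => /andP[ca c0]; rewrite f0 sub0r => e.
  exists c; first by rewrite !ler0_norm ?lerN2 // ltW.
  by apply: oppr_inj; rewrite opprB e mulrN.
Qed.

(** [C2] speaks of partial derivatives only, so the path from [x] to [x + v] changes one coordinate
    at a time. Its points differ from [x] by vectors dominated coordinatewise by [v], which is the
    region in the hypothesis. *)
Lemma axis_sum_bound f x v (B : R) (g : 'I_n -> R) :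
  (forall k y, derivable f y (evec R k)) ->
  (forall k z, (forall j, `|z ord0 j| <= `|v ord0 j|) -> `|partial k f (x + z) - g k| <= B) ->
  `|f (x + v) - f x - \sum_i v ord0 i * g i| <= B * \sum_i `|v ord0 i|.
Proof.
move=> df hB.
pose tr m : V := \row_j (if (j < m)%N then v ord0 j else 0).
have trn : tr n = v by apply: row_ext => j; rewrite mxE ltn_ord.
suff H m : (m <= n)%N -> `|f (x + tr m) - f x - \sum_(i < n | (i < m)%N) v ord0 i * g i| <=
    B * \sum_(i < n | (i < m)%N) `|v ord0 i|.
  have al (F : 'I_n -> R) : \sum_(i < n | (i < n)%N) F i = \sum_i F i.
    by apply: eq_bigl => i; rewrite ltn_ord.
  by have := H n (leqnn n); rewrite trn !al.
elim: m => [_|m IH mn].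
  rewrite !big_pred0 ?mulr0 // (_ : tr 0%N = 0) ?addr0 ?subrr ?normr0 //.
  by apply: row_ext => j; rewrite !mxE.
pose k := Ordinal mn.
have trS : x + tr m.+1 = x + tr m + v ord0 k *: evec R k.
  rewrite -addrA; congr (x + _); apply: row_ext => j; rewrite !mxE eqxx /= ltnS leq_eqVlt.
  have [e|jk] := eqVneq j k; first by rewrite e /= eqxx ltnn /= add0r mulr1.
  have -> : (j == m :> nat) = false by apply/negbTE; apply: contra jk => /eqP e; apply/eqP/val_inj.
  by rewrite mulr0 addr0.
have bS (F : 'I_n -> R) : \sum_(i < n | (i < m.+1)%N) F i = \sum_(i < n | (i < m)%N) F i + F k.
  rewrite (bigD1 k) //= addrC; congr (_ + _); apply: eq_bigl => i.
  by rewrite ltnS ltn_neqAle andbC; congr (_ && _).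
have [c cv e] := axis_MVT (x + tr m) (v ord0 k) (df k).
rewrite !bS trS mulrDr.
have -> : f (x + tr m + v ord0 k *: evec R k) =
    partial k f (x + tr m + c *: evec R k) * v ord0 k + f (x + tr m) by rewrite -e subrK.
have hk : `|partial k f (x + (tr m + c *: evec R k)) - g k| <= B.
  apply: hB => j; rewrite mxE [tr m _ _]mxE [X in _ + X]mxE evecE.
  have [<-|kj] := eqVneq k j; first by rewrite ltnn add0r mulr1.
  by rewrite mulr0 addr0; case: ifP => // _; rewrite normr0.
rewrite -(addrA x).
set p := partial k f _ in hk *.
have -> : p * v ord0 k + f (x + tr m) - f x -
   (\sum_(i < n | (i < m)%N) v ord0 i * g i + v ord0 k * g k) =
  (f (x + tr m) - f x - \sum_(i < n | (i < m)%N) v ord0 i * g i) + (p - g k) * v ord0 k.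
  by ring.
apply: le_trans (ler_normD _ _) _; apply: lerD; first exact: IH (ltnW mn).
by rewrite normrM ler_wpM2r.
Qed.

(** [axis_sum_bound] is used twice, for the partial derivatives and then for [rho]; the factor n^2
    comes from comparing the square of the sum of |v_i| with |v|^2. *)
Lemma taylor_upper_bound rho x v (M : R) : C2 rho -> 0 <= M ->
  (forall i j z, (forall k, `|z ord0 k| <= `|v ord0 k|) ->
     `|partial j (partial i rho) (x + z)| <= M) ->
  rho (x + v) <= rho x + dot (\row_i partial i rho x) v + M * n%:R ^+ 2 * dot v v.
Proof.
move=> [_ [d1 [_ [d2 _]]]] M0 hM.
set s := \sum_i `|v ord0 i|.
have s0 : 0 <= s by apply: sumr_ge0.
have h1 i z : (forall k, `|z ord0 k| <= `|v ord0 k|) ->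
    `|partial i rho (x + z) - partial i rho x| <= M * s.
  move=> zv; have := @axis_sum_bound (partial i rho) x z M (fun=> 0) (d2 i).
  rewrite big1 ?subr0 => [|j _]; last by rewrite mulr0.
  move=> h; apply: le_trans (h _) _ => [k w wz|].
    by rewrite subr0; apply: hM => j; apply: le_trans (wz j) (zv j).
  by apply: ler_wpM2l => //; apply: ler_sum.
have := axis_sum_bound (fun k y => d1 k y) h1; rewrite -/s.
have -> : \sum_i v ord0 i * partial i rho x = dot (\row_i partial i rho x) v.
  by apply: eq_bigr => i _; rewrite mxE mulrC.
have : s ^+ 2 <= n%:R ^+ 2 * dot v v.
  have -> : n%:R ^+ 2 * dot v v = (n%:R * enorm v) ^+ 2.
    by rewrite exprMn enormE sqr_sqrtr // dot_ge0.
  rewrite lerXn2r ?nnegrE ?mulr_ge0 ?sqrtr_ge0 //.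
  rewrite mulr_natl -[X in _ *+ X](card_ord n) -sumr_const.
  by apply: ler_sum => i _; exact: coord_le_enorm.
move=> /(ler_wpM2l M0); rewrite -mulrA -expr2 mulrA ler_norml => h /andP[_]; lra.
Qed.

(** Directions with positive component along [u] leave [G], so the gradient has a nonnegative
    product with them and must be q u with q >= 0. For the displacement r (w - u) and k = 1 - w.u,
    the linear term is - r q k and the quadratic one at most 2 N r^2 k, with N = M n^2; the sum is
    nonpositive as soon as 2 N r <= q. *)
Lemma inner_ball G rho x u (e M g0 r : R) (i1 : 'I_n) : C2 rho -> 0 < e -> 0 <= M -> 0 < g0 ->
  (forall z, (forall k, `|z ord0 k| < e) -> (G (x + z) <-> rho (x + z) <= 0)) ->
  (forall i j z, (forall k, `|z ord0 k| < e) -> `|partial j (partial i rho) (x + z)| <= M) ->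
  g0 <= `|partial i1 rho x| ->
  G x -> dot u u = 1 -> (forall y, G y -> dot y u <= dot x u) ->
  0 < r -> 2 * r < e -> 2 * M * n%:R ^+ 2 * r <= g0 ->
  forall w, dot w w <= 1 -> G (x - r *: u + r *: w).
Proof.
move=> C2r e0 M0 g00 hG hM hg Gx u1 hu r0 re Mr w w1.
have rx : rho x <= 0.
  by have := hG 0; rewrite addr0 => <- // k; rewrite mxE normr0.
set g : V := \row_i partial i rho x.
have T v : (forall k, `|v ord0 k| < e) ->
    rho (x + v) <= dot g v + M * n%:R ^+ 2 * dot v v.
  move=> hv; have := @taylor_upper_bound rho x v M C2r M0; rewrite -/g => h.
  have := h (fun i j z zv => hM i j z (fun k => le_lt_trans (zv k) (hv k))); lra.
set N := M * n%:R ^+ 2 in T.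
have N0 : 0 <= N by rewrite mulr_ge0 // exprn_ge0.
have pos v : 0 < dot v u -> 0 <= dot g v.
  move=> vu; rewrite leNgt; apply/negP => gv.
  set D := dot v v; have D0 : 0 <= D by exact: dot_ge0.
  (* The first bound keeps [x + c *: v] in the region where [rho] describes [G]; the second makes
     the negative linear term dominate. *)
  pose c := Num.min (e / (2 * (enorm v + 1))) (- dot g v / (N * D + 1)).
  have ev0 : 0 <= enorm v by rewrite enormE sqrtr_ge0.
  have ND : 0 < N * D + 1 by rewrite ltr_wpDl // mulr_ge0.
  have c0 : 0 < c.
    rewrite lt_min; apply/andP; split; first by rewrite divr_gt0 // mulr_gt0 // ltr_wpDl.
    by rewrite divr_gt0 // oppr_gt0.
  have ce : c * enorm v < e.
    have : c * (2 * (enorm v + 1)) <= e.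
      by rewrite -ler_pdivlMr ?mulr_gt0 ?ltr_wpDl // ge_min lexx.
    by have := mulr_ge0 (ltW c0) ev0; lra.
  have cN : c * (N * D + 1) <= - dot g v by rewrite -ler_pdivlMr // ge_min lexx orbT.
  have small k : `|(c *: v) ord0 k| < e.
    rewrite mxE normrM (gtr0_norm c0); apply: le_lt_trans ce.
    by rewrite ler_wpM2l ?(ltW c0) // coord_le_enorm.
  have : G (x + c *: v).
    apply/hG => //; apply: le_trans (T _ small) _; rewrite !dotZr dotZl -/D.
    have : c * (c * (N * D + 1)) <= c * - dot g v by rewrite ler_pM2l.
    by have := sqr_ge0 c; lra.
  by move/hu; rewrite dotDl dotZl; have := mulr_gt0 c0 vu; lra.
set q := dot g u.
have q0 : 0 <= q by apply: pos; rewrite u1.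
pose p := g - q *: u.
have pu : dot p u = 0 by rewrite dotBl dotZl u1 mulr1 subrr.
have gp : dot g p = dot p p by rewrite [in RHS]/p dotBl dotZl (dotC u) pu mulr0 subr0.
have pp : dot p p = 0.
  apply/eqP; rewrite eq_le dot_ge0 andbT; apply/ler_addgt0Pr => d d0; rewrite add0r.
  (* Testing [pos] on [t *: u - p] gives |p|^2 <= t q <= d. *)
  pose t := d / (q + 1); have q1 : 0 < q + 1 by rewrite ltr_wpDl.
  have t0 : 0 < t by rewrite divr_gt0.
  have tq : t * (q + 1) = d by rewrite /t divfK ?lt0r_neq0.
  have := pos (t *: u - p); rewrite dotBl dotZl u1 pu dotBr dotZr gp -/q.
  by rewrite mulr1 subr0 => /(_ t0); lra.
have gg : dot g g = q ^+ 2.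
  by have := dot_sub_sqr g u q; rewrite -/p pp u1 -/q; lra.
have gq : g0 <= q.
  rewrite -(@ler_pXn2r _ 2) ?nnegrE ?(ltW g00) // -gg; apply: le_trans (coord_sqr_le g i1).
  by rewrite -[leRHS]real_normK ?num_real // mxE lerXn2r ?nnegrE ?(ltW g00).
pose k := 1 - dot w u.
have k0 : 0 <= k.
  have h := cauchy_schwarz w u1; rewrite /k.
  by have := sqr_ge0 (dot w u - 1); lra.
have -> : x - r *: u + r *: w = x + r *: (w - u).
  by rewrite scalerBr addrAC -addrA.
have small i : `|(r *: (w - u)) ord0 i| < e.
  rewrite mxE normrM (gtr0_norm r0); apply: le_lt_trans re.
  rewrite mulrC; apply: ler_wpM2r; first exact: ltW.
  rewrite mxE [X in `|_ + X|]mxE; apply: le_trans (ler_normB _ _) _.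
  have : `|w ord0 i| <= 1 by apply: le_trans (coord_le_enorm _ _) _; rewrite enorm_le // expr1n.
  by have := unit_coord_le1 i u1; lra.
apply/hG => //; apply: le_trans (T _ small) _; rewrite !dotZr dotZl dotBr -/q.
have -> : dot g w = q * dot w u.
  have : dot p w = 0.
    rewrite /dot big1 // => i _; have := coord_sqr_le p i; rewrite pp => h.
    suff -> : p ord0 i = 0 by rewrite mul0r.
    by apply/eqP; rewrite -sqrf_eq0 eq_le sqr_ge0 andbT.
  by rewrite dotBl dotZl (dotC u w); lra.
have : dot (w - u) (w - u) <= 2 * k.
  by have := dot_sub_sqr w u 1; rewrite scale1r u1 /k; lra.
have rk : 0 <= r * k by rewrite mulr_ge0 // ltW.
move=> /(ler_wpM2l (mulr_ge0 N0 (sqr_ge0 r))).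
have : (r * k) * (2 * N * r) <= (r * k) * q.
  by apply: ler_wpM2l => //; apply: le_trans gq; rewrite /N mulrA.
by rewrite /k; lra.
Qed.

Lemma dist_lt_norm (a b d : R) : `|a - b| < d -> `|b| <= `|a| + d /\ `|a| - d <= `|b|.
Proof.
have := lerB_dist a b; have := lerB_dist b a; rewrite (distrC b).
by split; lra.
Qed.

Lemma support_not_interior (G : set V) x u : dot u u = 1 ->
  (forall y, G y -> dot y u <= dot x u) -> ~ (G°) x.
Proof.
move=> u1 hu /nbhs_ballP[e /= e0 xe].
have : G (x + (e / 2) *: u).
  apply: xe; split=> // i j; rewrite ord1 /ball /= [X in `|_ - X|]mxE opprD addrA subrr sub0r normrN.
  rewrite mxE normrM gtr0_norm ?divr_gt0 //.
  by have := unit_coord_le1 j u1; have := normr_ge0 (u ord0 j); nra.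
by move/hu; rewrite dotDl dotZl u1; lra.
Qed.

(** A point with a supporting direction is not interior. Near each boundary point the bounds on the
    defining function give one radius valid for all nearby points, and compactness of the boundary
    makes the radius uniform. *)
Lemma rolling_ball (G : set V) : compact G -> C2_boundary G ->
  exists2 r0 : R, 0 < r0 & forall r, 0 < r < r0 -> forall x u, G x -> dot u u = 1 ->
    (forall y, G y -> dot y u <= dot x u) ->
    forall w, dot w w <= 1 -> G (x - r *: u + r *: w).
Proof.
move=> cG C2G.
have clG : closed G by apply: compact_closed cG; exact: norm_hausdorff.
pose P (r : R) x := forall u, G x -> dot u u = 1 -> (forall y, G y -> dot y u <= dot x u) ->
  forall w, dot w w <= 1 -> G (x - r *: u + r *: w).
have cB : compact (G `&` ~` G°).
  by apply: compact_closedI => //; apply: open_closedC; exact: open_interior.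
have loc x0 : (G `&` ~` G°) x0 -> \forall x \near x0 & r \near (0 : R)^'+, P r x.
  move=> [Gx0 nGx0]; have [U [oU [Ux0 [rho [C2r [[i1 pi1] hU]]]]]] := C2G x0 (subset_closure Gx0) nGx0.
  pose d2 i j := partial j (partial i rho).
  (* The added 1 here and the halving in [g0] leave room for continuity: both bounds persist near
     [x0]. *)
  pose M : R := \big[Num.max/0]_(p : 'I_n * 'I_n) (`|d2 p.1 p.2 x0| + 1).
  have M0 : 0 <= M by exact: bigmax_ge_id.
  pose g0 := `|partial i1 rho x0| / 2.
  have g00 : 0 < g0 by rewrite divr_gt0 // normr_gt0.
  have C2r' := C2r; case: C2r' => _ [_ [c1 [_ c2]]].
  have : \forall y \near x0, [/\ U y, forall p : 'I_n * 'I_n, `|d2 p.1 p.2 y| <= M & g0 <= `|partial i1 rho y|].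
    have nd (f : V -> R) d : continuous f -> 0 < d -> \forall y \near x0, `|f x0 - f y| < d.
      by move=> cf d0; move/cvgrPdist_lt: (cf x0); exact.
    have nU : \forall y \near x0, U y by exact: open_nbhs_nbhs.
    have nM : \forall y \near x0, forall p : 'I_n * 'I_n, `|d2 p.1 p.2 y| <= M.
      apply: (@filter_forall _ _ (fun (p : 'I_n * 'I_n) y => `|d2 p.1 p.2 y| <= M) (nbhs x0)) => p.
      have := nd _ _ (c2 p.1 p.2) ltr01.
      apply: filterS => y hy; apply: le_trans (le_bigmax _ _ p).
      by have [] := dist_lt_norm hy.
    have ng : \forall y \near x0, g0 <= `|partial i1 rho y|.
      have := nd _ _ (c1 i1) g00; apply: filterS => y hy.
      by have [_] := dist_lt_norm hy; rewrite {1}(splitr `|_|) addrK.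
    by apply: filterS3 nU nM ng => y.
  move=> /nbhs_ballP[e /= e0 he].
  have K0 : 0 < 2 * M * n%:R ^+ 2 + 1 by rewrite ltr_wpDl // !mulr_ge0 ?exprn_ge0.
  (* The first bound gives 2 r < e / 2, where e / 2 is the region available around a nearby [x]; the
     second gives 2 M n^2 r <= g0. *)
  pose rr := Num.min (e / 4) (g0 / (2 * M * n%:R ^+ 2 + 1)).
  have rr0 : 0 < rr by rewrite lt_min; apply/andP; split; apply: divr_gt0.
  exists (ball x0 (e / 2), [set r : R | 0 < r < rr]).
    split=> /=; first by apply: nbhsx_ballx; rewrite divr_gt0.
    apply/nbhs_ballP; exists rr => //= r; rewrite /ball /= sub0r normrN => h r0.
    by rewrite r0 (le_lt_trans (ler_norm r)).
  move=> [x r] /= [hx /andP[r0 rr1]] u Gx u1 hu.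
  have near_x z : (forall k, `|z ord0 k| < e / 2) -> ball x0 e (x + z).
    move=> hz; split=> // i j; rewrite ord1 /ball /= mxE.
    have := hx.2 ord0 j; rewrite /ball /= => h1.
    rewrite opprD addrA; apply: le_lt_trans (ler_normB _ _) _.
    by have := hz j; lra.
  have e20 : 0 < e / 2 by rewrite divr_gt0.
  have [_ _ hg] : [/\ U x, forall p : 'I_n * 'I_n, `|d2 p.1 p.2 x| <= M & g0 <= `|partial i1 rho x|].
    by rewrite -[x]addr0; apply/he/near_x => k; rewrite mxE normr0.
  apply: (@inner_ball G rho x u (e / 2) M g0 r i1) => //.
  - by move=> z /near_x /he [Uz _ _]; exact: hU.
  - by move=> i j z /near_x /he [_ h _]; exact: (h (i, j)).
  - by move: rr1; rewrite lt_min => /andP[h _]; lra.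
  - move: rr1; rewrite lt_min => /andP[_]; rewrite ltr_pdivlMr // => h.
    by move: h r0; set A := 2 * M * _; lra.
have := (iffLR (compact_near_coveringP _) cB) _ _ P (@at_right_proper_filter R 0) loc.
move=> /nbhs_ballP[r0 /= r00 hr]; exists r0 => // r /andP[r1 r2] x u Gx u1 hu.
apply: (hr r) => //.
  by rewrite /ball /= sub0r normrN gtr0_norm.
by split=> //; exact: support_not_interior u1 hu.
Qed.

End RollingBall.

(** * Convex hulls and the two bounds *)

Section Hull.
Variables (R : realType) (n : nat).
Local Notation V := 'rV[R]_n.
Implicit Types (G K L A : set V).

Lemma closed_of_compact G : compact G -> closed G.
Proof. by apply: compact_closed; exact: norm_hausdorff. Qed.

Lemma closure_thick A (e : R) : 0 < e -> closure A `<=` thick A e.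
Proof.
move=> e0 x /(_ _ (nbhsx_ballx x e e0)) [y [Ay [_ xy]]]; exists y => // i.
by have := xy ord0 i; rewrite /ball /= => /ltW.
Qed.

(** With [closure_thick], the closure is the intersection of the thickenings; convexity reaches it
    through [convex_thick]. *)
Lemma thick_closure A x : (forall e : R, 0 < e -> thick A e x) -> closure A x.
Proof.
move=> h B /nbhs_ballP[e /= e0 xB].
have e20 : 0 < e / 2 by rewrite divr_gt0.
have [y Ay xy] := h _ e20.
exists y; split=> //; apply: xB; split=> // i j; rewrite ord1 /ball /=.
by apply: le_lt_trans (xy j) _; lra.
Qed.

Lemma convex_thick A e : convexR A -> convexR (thick A e).
Proof.
move=> Ac x y t [x' Ax' hx] [y' Ay' hy] /andP[t0 t1].
exists (t *: x' + (1 - t) *: y') => [|i]; first by apply: Ac => //; rewrite t0.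
have -> : (t *: x + (1 - t) *: y) ord0 i - (t *: x' + (1 - t) *: y') ord0 i =
  t * (x ord0 i - x' ord0 i) + (1 - t) * (y ord0 i - y' ord0 i) by rewrite !mxE; ring.
have t1' : 0 <= 1 - t by rewrite subr_ge0.
apply: le_trans (ler_normD _ _) _; rewrite !normrM (ger0_norm t0) (ger0_norm t1').
by have := ler_wpM2l t0 (hx i); have := ler_wpM2l t1' (hy i); lra.
Qed.

Lemma conv_hull_sub A B : A `<=` B -> convexR B -> conv_hull A `<=` B.
Proof. by move=> AB Bc x; apply. Qed.

Lemma sub_conv_hull A : A `<=` conv_hull A.
Proof. by move=> x Ax C [_]; apply. Qed.

Lemma convex_conv_hull A : convexR (conv_hull A).
Proof. by move=> x y t hx hy t01 C CA; apply: CA.1 => //; [exact: hx|exact: hy]. Qed.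

Lemma sub_cchull K L : K `|` L `<=` cchull K L.
Proof. by apply: subset_trans (@subset_closure _ _); exact: sub_conv_hull. Qed.

Lemma cchull_sub G K L : compact G -> convexR G -> K `<=` G -> L `<=` G -> cchull K L `<=` G.
Proof.
move=> cG Gc KG LG; rewrite (closure_id G).1; last exact: closed_of_compact.
by apply: closure_subset; apply: conv_hull_sub => // x [/KG|/LG].
Qed.

Lemma ccset_cchull G K L : compact G -> convexR G -> K `<=` G -> L `<=` G -> K !=set0 ->
  ccset (cchull K L).
Proof.
move=> cG Gc KG LG [k Kk]; split; [|split].
- by exists k; apply: sub_cchull; left.
- by apply: subclosed_compact cG (cchull_sub cG Gc KG LG); exact: closed_closure.
move=> x y t hx hy t01; apply: thick_closure => e e0.
apply: convex_thick t01; [exact: convex_conv_hull| |]; exact: closure_thick.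
Qed.

(** The thickening of [K] by [d] is convex and contains [L], hence the hull; passing to the closure
    costs the second [d]. *)
Lemma cchull_thick K L d : convexR K -> 0 < d -> L `<=` enlarge K d ->
  cchull K L `<=` thick K (2 * d).
Proof.
move=> Kc d0 LK x /(closure_thick d0) [y hy xy].
have [] : thick K d y.
  apply: hy; split; first exact: convex_thick.
  move=> z [Kz|/LK [w Kw zw]]; first exact: thick_ge0 (ltW d0) _ Kz.
  exists w => // i; apply: le_trans zw; have := coord_le_enorm (z - w) i.
  by rewrite mxE [X in `|_ + X|]mxE.
move=> z Kz yz; exists z => // i.
by apply: le_trans (ler_distD (y ord0 i) _ _) _; have := xy i; have := yz i; lra.
Qed.

Lemma cchullC K L : cchull K L = cchull L K.
Proof. by rewrite /cchull setUC. Qed.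

End Hull.

(** * Upper bound: volume under a small enlargement of one body *)

Section UpperBound.
Variables (R : realType) (n : nat).
Hypothesis n_gt0 : (0 < n)%N.
Local Notation V := 'rV[R]_n.
Implicit Types (G K L M : set V).

Lemma coord_bound_segsum G K (a b c : R) : 0 <= a -> 0 <= b -> a + b <= 2 -> 0 <= c ->
  coord_bound G c -> coord_bound K c -> coord_bound (segsum G K a b) (2 * c).
Proof.
move=> a0 b0 ab c0 Gb Kb x /segsumP[u [v [Gu Kv ->]]] i; rewrite !mxE.
apply: le_trans (ler_normD _ _) _; rewrite !normrM (ger0_norm a0) (ger0_norm b0).
have := ler_wpM2l a0 (Gb _ Gu i); have := ler_wpM2l b0 (Kb _ Kv i).
by have := ler_wpM2r c0 ab; lra.
Qed.

Lemma segsum_sub G K M a b : K `<=` M -> segsum G K a b `<=` segsum G M a b.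
Proof. by move=> KM x /segsumP[u [v [Gu /KM Mv ->]]]; apply/segsumP; exists u, v. Qed.

(** [G] absorbs the error: with q = 2 d / r, the vector t (m - k) is q (z - x0) for some z in the
    cube inside [G]. Then g + q z is (1 + q) times a convex combination of points of [G], and t k +
    q t k0 is (1 + q) t times one of points of [K]. *)
Lemma segsum_thick_sub G K (x0 k0 : V) (r d t : R) :
  convexR G -> convexR K -> K k0 -> 0 < r -> 0 < d -> 0 <= t <= 1 ->
  (forall x : V, (forall i, `|x ord0 i - x0 ord0 i| <= r) -> G x) ->
  segsum G (thick K (2 * d)) 1 t `<=`
  [set (1 + 2 * d / r) *: x - (2 * d / r) *: (x0 + t *: k0) | x in segsum G K 1 t].
Proof.
move=> Gc Kc Kk0 r0 d0 /andP[t0 t1] ball _ /segsumP[g [m [Gg [k Kk mk] ->]]].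
set q := 2 * d / r; have q0 : 0 < q by rewrite divr_gt0 // mulr_gt0.
have q1 : 0 < 1 + q by rewrite addr_gt0.
pose c := (1 + q)^-1; have c0 : 0 < c by rewrite invr_gt0.
have c1 : c <= 1 by rewrite invf_le1 // lerDl ltW.
have c01 : 0 <= c <= 1 by rewrite c1 ltW.
pose z := x0 + (t / q) *: (m - k).
have Gz : G z.
  have tq0 : 0 <= t / q by rewrite mulr_ge0 ?invr_ge0 ?(ltW q0).
  apply: ball => i; rewrite mxE addrAC subrr add0r !mxE normrM (ger0_norm tq0).
  have h : t * `|m ord0 i - k ord0 i| <= 1 * (2 * d) by apply: ler_pM.
  have -> : r = 1 * (2 * d) / q by rewrite /q; field; rewrite !lt0r_neq0.
  by rewrite mulrAC ler_pM2r ?invr_gt0.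
exists (c *: g + (1 - c) *: z + t *: (c *: k + (1 - c) *: k0)).
  apply/segsumP; exists (c *: g + (1 - c) *: z), (c *: k + (1 - c) *: k0).
  by split; rewrite ?scale1r //; [exact: Gc|exact: Kc].
apply: row_ext => i; rewrite !mxE /c; field.
by rewrite !lt0r_neq0.
Qed.

(** Convexity in [d]: on [0, 1] the power lies below its chord. *)
Lemma one_plus_pow_le (c d : R) m : 0 <= c -> 0 <= d <= 1 ->
  (1 + c * d) ^+ m <= 1 + d * (1 + c) ^+ m.
Proof.
move=> c0 /andP[d0 d1].
suff : (1 + c * d) ^+ m <= 1 + d * ((1 + c) ^+ m - 1) by lra.
elim: m => [|m IH]; first by rewrite !expr0 subrr mulr0 addr0.
have c1 : 1 <= (1 + c) ^+ m by rewrite exprn_ege1 // lerDl.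
rewrite !exprS; set A := (1 + c) ^+ m in IH c1 *.
have cd : 0 <= 1 + c * d by rewrite addr_ge0 // mulr_ge0.
apply: le_trans (ler_wpM2l cd IH) _.
have : 0 <= c * (A - 1) * (d * (1 - d)) by rewrite !mulr_ge0 ?subr_ge0.
by lra.
Qed.

Lemma Vol_segsum_thick G : compact G -> convexR G -> G° !=set0 ->
  exists2 C : R, 0 <= C & forall K M d t, ccset K -> ccset M -> K `<=` M -> M `<=` G ->
    0 < d -> M `<=` thick K (2 * d) -> 0 <= t <= 1 ->
    Vol (segsum G K 1 t) <= Vol (segsum G M 1 t) <= Vol (segsum G K 1 t) + C * d.
Proof.
move=> cG Gc [x0 /nbhs_ballP[e /= e0 hx0]].
have [b b0 Gb] := compact_coord_bound cG.
have ball (x : V) : (forall i, `|x ord0 i - x0 ord0 i| <= e / 2) -> G x.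
  move=> h; apply: hx0; split=> // i j; rewrite ord1 /ball /= distrC.
  by apply: le_lt_trans (h j) _; lra.
pose c := 4 / e; have c0 : 0 <= c by rewrite divr_ge0 // ltW.
pose Q := [set x : V | forall i, `|x ord0 i| <= 2 * b].
have Qb : coord_bound Q (2 * b) by [].
exists (Vol Q * (1 + c) ^+ n) => [|K M d t cK cM KM MG d0 MK t01].
  by rewrite mulr_ge0 ?Vol_ge0 ?exprn_ge0 ?addr_ge0.
have /andP[t0 t1] := t01.
have t2 : 1 + t <= 2 by lra.
have bK := coord_bound_segsum ler01 t0 t2 b0 Gb (coord_bound_sub (subset_trans KM MG) Gb).
have bM := coord_bound_segsum ler01 t0 t2 b0 Gb (coord_bound_sub MG Gb).
have -> /= : Vol (segsum G K 1 t) <= Vol (segsum G M 1 t).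
  by apply: (Vol_le n_gt0 bM); exact: segsum_sub.
have VK : Vol (segsum G K 1 t) <= Vol Q by apply: (Vol_le n_gt0 Qb) => x /bK.
have VM : Vol (segsum G M 1 t) <= Vol Q by apply: (Vol_le n_gt0 Qb) => x /bM.
have VK0 : 0 <= Vol (segsum G K 1 t) by exact: Vol_ge0.
have VQ0 : 0 <= Vol Q by exact: Vol_ge0.
have c1 : 1 <= (1 + c) ^+ n by rewrite exprn_ege1 // lerDl.
(* For d > 1 the volume of [Q] alone is already within the error term. *)
have [d1|/ltW d1] := leP d 1; last first.
  have : Vol Q * 1 <= Vol Q * ((1 + c) ^+ n * d).
    by rewrite ler_wpM2l // -[leLHS]mulr1 ler_pM.
  by rewrite mulr1 mulrA; lra.
have [k0 Kk0] := cK.1.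
have e20 : 0 < e / 2 by rewrite divr_gt0.
have q0 : 0 < 1 + 2 * d / (e / 2) by rewrite addr_gt0 // divr_gt0 // mulr_gt0.
have sub := segsum_thick_sub Gc cK.2.2 Kk0 e20 d0 t01 ball.
have bA : exists B, coord_bound [set (1 + 2 * d / (e / 2)) *: x - (2 * d / (e / 2)) *: (x0 + t *: k0) | x in segsum G K 1 t] B.
  set v := _ *: (x0 + _); set a := 1 + _ in q0 *.
  exists (a * (2 * b) + \sum_i `|v ord0 i|) => _ [x hx <-] i.
  rewrite mxE [X in `|X + _|]mxE; apply: le_trans (ler_normD _ _) _; apply: lerD.
    by rewrite normrM (gtr0_norm q0) ler_pM2l //; exact: bK.
  by rewrite mxE normrN (bigD1 i) //= lerDl sumr_ge0.
have [B hB] := bA.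
have := Vol_le n_gt0 hB (subset_trans (segsum_sub MK) sub).
rewrite (Vol_affine n_gt0 _ q0 bK) => h; apply: le_trans h _.
have -> : 1 + 2 * d / (e / 2) = 1 + c * d by rewrite /c; field; rewrite lt0r_neq0.
have d01 : 0 <= d <= 1 by rewrite d1 ltW.
have := ler_wpM2r VK0 (one_plus_pow_le n c0 d01).
have : Vol (segsum G K 1 t) * (d * (1 + c) ^+ n) <= Vol Q * (d * (1 + c) ^+ n).
  by rewrite ler_wpM2r // mulr_ge0 ?(ltW d0) // exprn_ge0 // addr_ge0.
lra.
Qed.

End UpperBound.

(** * Lower bound: the volume missed because of a far point *)

Section LowerBound.
Variables (R : realType) (n : nat).
Hypothesis n_gt0 : (0 < n)%N.
Local Notation V := 'rV[R]_n.
Implicit Types (G K L M : set V).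

Lemma compact_segsum G K (a b : R) : compact G -> compact K -> compact (segsum G K a b).
Proof. by move=> cG cK; apply: compact_msum; case. Qed.

Lemma continuous_dot (u : V) : continuous (fun x : V => dot x u).
Proof.
apply: continuous_big; first exact: add_continuous.
move=> i _ x; apply: (@cvgM _ _ (nbhs x) _ (fun y : V => y ord0 i) (fun=> u ord0 i)).
  exact: continuous_coord.
exact: cvg_cst.
Qed.

Lemma Vol_segsum_gap G : compact G -> convexR G -> C2_boundary G ->
  exists2 c : R, 0 < c & forall L M p (e s : R), ccset L -> ccset M -> L `<=` M -> M `<=` G ->
    M p -> 0 < e -> (forall y, L y -> e ^+ 2 < dot (p - y) (p - y)) -> 1 / 3 <= s <= 2 / 3 ->
    Vol (segsum G L (1 - s) s) + c * Num.sqrt e ^+ n.+1 <= Vol (segsum G M (1 - s) s).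
Proof.
move=> cG Gc C2G; have [r0 r00 roll] := rolling_ball cG C2G.
have [b b0 Gb] := compact_coord_bound cG.
have n0 : 0 < n%:R :> R by rewrite ltr0n.
(* Since 1 - s >= 1/3, the radius r1 / (1 - s) stays below r0. A ball of that radius in [G] becomes
   one of radius exactly [r1] in (1 - s) G. *)
pose r1 := r0 / 4; have r10 : 0 < r1 by rewrite divr_gt0.
pose D := 2 * b * n%:R + 1; have D0 : 0 < D by rewrite ltr_wpDl // !mulr_ge0.
have nD0 : 0 < 2 * n%:R * D by rewrite !mulr_gt0.
(* The cap height will be l e. The bound l <= 1/3 <= s keeps it below the missing thickness s e; as
   e <= D, the other bound gives 2 n l e <= r1, required by [Vol_cap]. *)
pose l := Num.min (1 / 3) (r1 / (2 * n%:R * D)).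
have l0 : 0 < l by rewrite lt_min; apply/andP; split; apply: divr_gt0.
exists (cap_const n r1 * Num.sqrt l ^+ n.+1) => [|L M p e s cL cM LM MG Mp e0 far /andP[s1 s2]].
  by rewrite mulr_gt0 ?cap_const_gt0 // exprn_gt0 // sqrtr_gt0.
have Gp := MG _ Mp; have LG := subset_trans LM MG.
have [y0 Ly0] := cL.1.
have eD : e <= D.
  have h : dot (p - y0) (p - y0) <= (2 * b * n%:R) ^+ 2.
    have : dot (p - y0) (p - y0) <= \sum_(i < n) (2 * b) ^+ 2.
      apply: ler_sum => i _; rewrite -expr2 -[leLHS]real_normK ?num_real //.
      rewrite lerXn2r ?nnegrE ?mulr_ge0 // mxE [X in `|_ + X|]mxE.
      apply: le_trans (ler_normB _ _) _.
      by have := Gb _ Gp i; have := Gb _ (LG _ Ly0) i; lra.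
    rewrite sumr_const card_ord -[_ *+ n]mulr_natr => h; apply: le_trans h _.
    rewrite [leRHS]exprMn; apply: ler_wpM2l; first exact: sqr_ge0.
    by rewrite expr2 ler_peMr ?ler0n ?ler1n.
  have : e ^+ 2 < D ^+ 2.
    apply: lt_le_trans (far _ Ly0) (le_trans h _).
    by rewrite lerXn2r ?nnegrE ?(ltW D0) // ?mulr_ge0 ?ler0n // lerDl.
  by rewrite ltr_pXn2r ?nnegrE ?(ltW D0) ?(ltW e0) // => /ltW.
have [u [u1 sep]] := separation cL e0 far.
have [x0 Gx0 xmax] := compact_EVT_max (ex_intro _ p Gp) cG (continuous_subspaceT (@continuous_dot u)).
rewrite inE in Gx0.
have hmax y : G y -> dot y u <= dot x0 u by move=> Gy; apply: xmax; rewrite inE.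
have s0 : 0 < s by lra.
have s10 : 0 < 1 - s by lra.
pose r := r1 / (1 - s); have r_gt0 : 0 < r by rewrite divr_gt0.
have rE : (1 - s) * r = r1 by rewrite /r mulrC divfK // lt0r_neq0.
have r_lt : r < r0 by rewrite ltr_pdivrMr // /r1; have := r00; nra.
have ball : forall w, dot w w <= 1 -> G (x0 - r *: u + r *: w).
  by apply: roll => //; rewrite r_gt0.
pose o := (1 - s) *: (x0 - r *: u) + s *: p.
have ou : dot o u + r1 = (1 - s) * dot x0 u + s * dot p u.
  by rewrite /o dotDl !dotZl dotBl dotZl u1 -rE; ring.
rewrite -mulrA -exprMn -sqrtrM ?(ltW l0) //.
have l3 : l <= 1 / 3 by rewrite ge_min lexx.
have lr : l * (2 * n%:R * D) <= r1 by rewrite -ler_pdivlMr // ge_min lexx orbT.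
apply: (@Vol_cap R n n_gt0 _ _ o u r1 (l * e)) => //.
- exact: compact_segsum cG cM.2.1.
- exact: segsum_sub.
- move=> x hx; apply/segsumP; exists (x0 - r *: u + r *: (r1^-1 *: (x - o))), p; split=> //.
    apply: ball; rewrite dotZl dotZr mulrA -invfM -expr2 mulrC ler_pdivrMr ?exprn_gt0 //.
    by rewrite mul1r.
  rewrite scalerDr scalerA rE scalerA divff ?lt0r_neq0 // scale1r.
  by rewrite addrAC -/o addrC subrK.
- exact: mulr_gt0.
- apply: le_trans lr; rewrite mulrCA ler_pM2l // ler_pM2l // mulr_gt0 //.
move=> _ /segsumP[g [y [Gg Ly ->]]]; rewrite dotDl !dotZl ou.
have := ler_wpM2l (ltW s10) (hmax _ Gg); have := ler_wpM2l (ltW s0) (sep _ Ly).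
have := ler_wpM2r (ltW e0) l3; have := ler_wpM2r (ltW e0) s1; lra.
Qed.

End LowerBound.

(** * Hausdorff distance and the final estimates *)

Section Main.
Variables (R : realType) (n : nat).
Local Notation V := 'rV[R]_n.
Implicit Types (G K L M : set V).

Definition mvgap G K L M (j : nat) : R := 2 * MVj j G M - MVj j G K - MVj j G L.

Lemma mvgap_segsum (n_gt0 : (0 < n)%N) G K L M a b : ccset G -> ccset K -> ccset L -> ccset M ->
  0 <= a -> 0 <= b ->
  \sum_(j < n.+1) 'C(n, j)%:R * (a ^+ (n - j) * b ^+ j) * mvgap G K L M j =
  2 * Vol (segsum G M a b) - Vol (segsum G K a b) - Vol (segsum G L a b).
Proof.
move=> cG cK cL cM a0 b0; rewrite !Vol_segsum // mulr_sumr -!sumrB.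
by apply: eq_bigr => j _; rewrite /mvgap; ring.
Qed.

Local Notation hdset K L := [set d : R | 0 < d /\ K `<=` enlarge L d /\ L `<=` enlarge K d].

Lemma hdset_nonempty K L : ccset K -> ccset L -> hdset K L !=set0.
Proof.
move=> [[k Kk] [cK _]] [[l Ll] [cL _]].
have [a a0 Ka] := compact_coord_bound cK; have [b b0 Lb] := compact_coord_bound cL.
pose D := Num.sqrt (\sum_(i < n) (a + b) ^+ 2) + 1.
have D0 : 0 < D by rewrite ltr_wpDl // sqrtr_ge0.
have dD x y : (forall i, `|(x - y : V) ord0 i| <= a + b) -> enorm (x - y) <= D.
  move=> h; rewrite -[leLHS]addr0; apply: lerD => //.
  rewrite ler_sqrt; last by apply: sumr_ge0 => i _; exact: sqr_ge0.
  apply: ler_sum => i _; rewrite -[leLHS]real_normK ?num_real //.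
  by rewrite lerXn2r ?nnegrE ?addr_ge0.
exists D; split=> //; split=> x xX; [exists l|exists k] => //; apply: dD => i;
  rewrite mxE [X in `|_ + X|]mxE; apply: le_trans (ler_normB _ _) _.
- exact: lerD (Ka _ xX i) (Lb _ Ll i).
- by rewrite addrC; exact: lerD (Ka _ Kk i) (Lb _ xX i).
Qed.

(** This makes the [inf] in [hausdorff] a genuine infimum rather than a default value. *)
Lemma hausdorff_has_inf K L : ccset K -> ccset L -> has_inf (hdset K L).
Proof. by move=> cK cL; split; [exact: hdset_nonempty|exists 0 => d [/ltW]]. Qed.

Lemma hausdorff_ge0 K L : ccset K -> ccset L -> 0 <= hausdorff K L.
Proof. by move=> cK cL; apply: lb_le_inf (hdset_nonempty cK cL) _ => d [/ltW]. Qed.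

Lemma far_point K L (e : R) : ccset K -> ccset L -> 0 < e -> e < hausdorff K L ->
  (exists2 p, K p & forall y, L y -> e ^+ 2 < dot (p - y) (p - y)) \/
  (exists2 p, L p & forall y, K y -> e ^+ 2 < dot (p - y) (p - y)).
Proof.
move=> cK cL e0 he; apply: contrapT => /not_orP[h1 h2].
suff /(ge_inf (hausdorff_has_inf cK cL).2) : hdset K L e by rewrite leNgt he.
have sub (A B : set V) : ~ (exists2 p, A p & forall y, B y -> e ^+ 2 < dot (p - y) (p - y)) ->
    A `<=` enlarge B e.
  move=> h x Ax; apply: contrapT => hx; apply: h; exists x => // y By.
  by rewrite ltNge -enorm_le ?(ltW e0) //; apply/negP => xy; apply: hx; exists y.
by split=> //; split; exact: sub.
Qed.

Lemma dG_upper (n_gt0 : (0 < n)%N) G : compact G -> convexR G -> G° !=set0 ->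
  exists2 C : R, 0 <= C & forall K L, ccset K -> K `<=` G -> ccset L -> L `<=` G ->
    dG G K L <= C * hausdorff K L.
Proof.
move=> cG Gc iG; have [C1 C10 hC1] := Vol_segsum_thick n_gt0 cG Gc iG.
have [C2 C20 hC2] := coef_sum_bound R n.
have ccG : ccset G by split=> //; have [x /interior_subset] := iG; exists x.
exists (C2 * (2 * C1)) => [|K L cK KG cL LG]; first by rewrite !mulr_ge0.
have cM := ccset_cchull cG Gc KG LG cK.1; have MG := cchull_sub cG Gc KG LG.
set M := cchull K L in cM MG.
have [KM LM] : K `<=` M /\ L `<=` M by split=> x hx; apply: sub_cchull; [left|right].
(* The Hausdorff distance is an infimum, so the bound is proved for each admissible [d]. Giving [G]
   weight 1 makes the volume gap a polynomial in t in the monomial basis, as [coef_sum_bound]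
   expects; the 2 in [2 * C1] adds the contributions of [K] and [L]. *)
have H d : hdset K L d -> dG G K L <= C2 * (2 * C1) * d.
  move=> [d0 [KL LK]]; apply: le_trans (ler_norm _) _.
  rewrite -mulrA; apply: (hC2 (mvgap G K L M)); first by rewrite !mulr_ge0 // ltW.
  move=> t t01; have /andP[t0 t1] := t01.
  have -> : \sum_(j < n.+1) 'C(n, j)%:R * t ^+ j * mvgap G K L M j =
      \sum_(j < n.+1) 'C(n, j)%:R * (1 ^+ (n - j) * t ^+ j) * mvgap G K L M j.
    by apply: eq_bigr => j _; rewrite expr1n mul1r.
  rewrite mvgap_segsum //.
  have /andP[k1 k2] := hC1 K M d t cK cM KM MG d0 (cchull_thick cK.2.2 d0 LK) t01.
  have MLt : M `<=` thick L (2 * d) by rewrite /M cchullC; exact: cchull_thick cL.2.2 d0 KL.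
  have /andP[l1 l2] := hC1 L M d t cL cM LM MG d0 MLt t01.
  by rewrite ger0_norm; lra.
(* A positive constant can be divided out of the infimum; if it is 0, any admissible [d]
   concludes. *)
have [C0|C0] := eqVneq (C2 * (2 * C1)) 0.
  by have [d /H] := hdset_nonempty cK cL; rewrite C0 !mul0r.
have Cp : 0 < C2 * (2 * C1) by rewrite lt0r C0 !mulr_ge0.
rewrite -ler_pdivrMl //; apply: lb_le_inf (hdset_nonempty cK cL) _ => d /H.
by rewrite ler_pdivrMl.
Qed.

Lemma dG_lower (n_gt0 : (0 < n)%N) G : compact G -> convexR G -> G° !=set0 -> C2_boundary G ->
  exists2 c : R, 0 < c & forall K L, ccset K -> K `<=` G -> ccset L -> L `<=` G ->
    c * Num.sqrt (hausdorff K L) ^+ n.+1 <= dG G K L.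
Proof.
move=> cG Gc iG C2G; have [c c0 hc] := Vol_segsum_gap n_gt0 cG Gc C2G.
have ccG : ccset G by split=> //; have [x /interior_subset] := iG; exists x.
(* Far points are taken at half the Hausdorff distance, strictly below it, hence the factor 1/2
   under the root; 1/3 is the length of the interval of s where the gap is bounded below. *)
exists (c * Num.sqrt (1 / 2) ^+ n.+1 / 3) => [|K L cK KG cL LG].
  by rewrite divr_gt0 // mulr_gt0 // exprn_gt0 // sqrtr_gt0 divr_gt0.
have cM := ccset_cchull cG Gc KG LG cK.1; have MG := cchull_sub cG Gc KG LG.
set M := cchull K L in cM MG.
have [KM LM] : K `<=` M /\ L `<=` M by split=> x hx; apply: sub_cchull; [left|right].
have [b b0 Gb] := compact_coord_bound cG.
have mono A s : 0 <= s <= 1 -> A `<=` M ->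
    Vol (segsum G A (1 - s) s) <= Vol (segsum G M (1 - s) s).
  move=> /andP[s0 s1] AM.
  have bM : coord_bound (segsum G M (1 - s) s) (2 * b).
    by apply: coord_bound_segsum => //; [lra|lra|exact: coord_bound_sub MG Gb].
  by apply: (Vol_le n_gt0 bM); exact: segsum_sub.
have bE s : 0 <= s <= 1 -> bern n (mvgap G K L M) s =
    2 * Vol (segsum G M (1 - s) s) - Vol (segsum G K (1 - s) s) - Vol (segsum G L (1 - s) s).
  by move=> /andP[s0 s1]; apply: mvgap_segsum => //; rewrite subr_ge0.
have h0 := hausdorff_ge0 cK cL; set h := hausdorff K L in h0 *.
have -> : c * Num.sqrt (1 / 2) ^+ n.+1 / 3 * Num.sqrt h ^+ n.+1 =
    c * Num.sqrt (h / 2) ^+ n.+1 / 3.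
  have -> : h / 2 = 1 / 2 * h by rewrite mul1r mulrC.
  by rewrite (@sqrtrM _ (1 / 2)) ?divr_ge0 // exprMn; ring.
set B := c * _.
have B0 : 0 <= B by rewrite mulr_ge0 ?(ltW c0) // exprn_ge0 // sqrtr_ge0.
apply: (@le_trans _ _ (B / 3 * n.+1%:R)).
  by rewrite ler_peMr ?divr_ge0 // ler1n.
apply: (bern_sum_ge (d := mvgap G K L M)) => s hs.
  by rewrite bE //; have := mono K s hs KM; have := mono L s hs LM; lra.
have s01 : 0 <= s <= 1 by move: hs => /andP[s1 s2]; apply/andP; split; lra.
rewrite bE //; have mK := mono K s s01 KM; have mL := mono L s s01 LM.
have [h00|hp] := eqVneq h 0.
  by move: B0; rewrite /B h00 mul0r sqrtr0 expr0n /= mulr0 => _; lra.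
have h2 : 0 < h / 2 by rewrite divr_gt0 // lt0r hp.
have h2h : h / 2 < hausdorff K L by rewrite -/h; lra.
(* A point of [K] far from [L] opens a gap between [L] and the hull, while the term of [K] is
   nonnegative by monotonicity; the other case is symmetric. *)
have [[p Kp far]|[p Lp far]] := far_point cK cL h2 h2h.
- by have := hc L M p (h / 2) s cL cM LM MG (KM _ Kp) h2 far hs; rewrite -/B; lra.
- by have := hc K M p (h / 2) s cK cM KM MG (LM _ Lp) h2 far hs; rewrite -/B; lra.
Qed.

End Main.

(** There are no slots to fill, so [MVj 0 G] is the same number for all bodies and cancels, whatever
    [epsilon] chose. *)
Lemma dG_dim0 (R : realType) (G K L : set 'rV[R]_0) : dG G K L = 0.
Proof.
rewrite /dG big_ord1.
have e (A B : set 'rV[R]_0) : MVj 0 G A = MVj 0 G B.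
  by congr (MV _); apply: funext; case.
by rewrite (e _ K) (e L K); ring.
Qed.

Lemma hausdorff_dim0 (R : realType) (K L : set 'rV[R]_0) : ccset K -> ccset L ->
  hausdorff K L = 0.
Proof.
move=> cK cL; apply/eqP; rewrite eq_le hausdorff_ge0 // andbT.
apply/ler_addgt0Pr => e e0; rewrite add0r.
apply: (ge_inf (hausdorff_has_inf cK cL).2); split=> //.
have [k Kk] := cK.1; have [l Ll] := cL.1.
have z (x y : 'rV[R]_0) : enorm (x - y) <= e by rewrite /enorm big_ord0 sqrtr0 ltW.
by split=> x _; [exists l|exists k].
Qed.

Theorem theorem1p2 (R : realType) (n : nat) (G : set 'rV[R]_n) :
  compact G -> convexR G -> G° !=set0 -> C2_boundary G ->
  exists C : R, 1 < C /\
    forall K L : set 'rV[R]_n,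
      ccset K -> K `<=` G -> ccset L -> L `<=` G ->
      C^-1 * hausdorff K L `^ ((n.+1)%:R / 2) <= dG G K L /\
      dG G K L <= C * hausdorff K L.
Proof.
case: n G => [|n] G cG Gc iG C2G.
  (* Both distances vanish here, and so does 0 raised to 1/2, the exponent being nonzero. *)
  exists 2; split=> [|K L cK _ cL _]; first by rewrite ltr1n.
  by rewrite dG_dim0 hausdorff_dim0 // powR0 ?mulr0 // lt0r_neq0 // divr_gt0.
have n_gt0 : (0 < n.+1)%N by [].
have [C C0 hC] := dG_upper n_gt0 cG Gc iG.
have [c c0 hc] := dG_lower n_gt0 cG Gc iG C2G.
have ci0 : 0 < c^-1 by rewrite invr_gt0.
exists (2 + C + c^-1); split=> [|K L cK KG cL LG]; first by lra.
have h0 := hausdorff_ge0 cK cL; split; last first.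
  by apply: le_trans (hC K L cK KG cL LG) _; apply: ler_wpM2r => //; lra.
apply: le_trans (hc K L cK KG cL LG); rewrite mulrC [_ / 2]mulrC powRrM.
rewrite powR12_sqrt // powR_mulrn ?sqrtr_ge0 // mulrC; apply: ler_wpM2r.
  by rewrite exprn_ge0 // sqrtr_ge0.
by rewrite invf_ple ?posrE //; lra.
Qed.
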